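(* Let $X$ be an $8$-torus with a (flat) $\mathrm{SU}(4)$-structure $(g,J,\omega,\theta)$. Take $\gamma\in A_+$, $\gamma=\frac12(c+\bar c)$ with $c\in\bigwedge^{2,0}$, and $\omega'=2(\omega+\gamma)/|\omega+\gamma|$. Let $\beta\in H^4(X,\mathbb Z)$. If (1) $\beta$ is traceless $\omega$-HYM, and (2) $\beta\wedge c\wedge\bar c=6k\,|c|^2\,\mathrm{vol}$, where $k$ is defined by $\beta\wedge\omega^2=24k\,\mathrm{vol}$ and $\omega^2\wedge c\wedge\bar c=2|c|^2\,\mathrm{vol}$, then $\beta$ is traceless $\omega'$-HYM.
   Context: $X=V/\Lambda$ with $V$ a real $8$-dimensional vector space and $\Lambda\subset V$ a lattice. A flat $\mathrm{SU}(4)$-structure on $X$ consists of translation-invariant $(g,J,\omega,\theta)$: a complex structure $J$ on $V$, a $J$-compatible scalar product $g$, its Kähler form $\omega$, with $g(x,y)=\omega(x,Jy)$, and a $(4,0)$-form $\theta$ with $|\theta|=4$; in suitable complex coordinates $\omega=\frac i2\sum_{j=1}^4dz_j\wedge d\bar z_j$, $\theta=dz_1\wedge dz_2\wedge dz_3\wedge dz_4$. Here $|\cdot|$ is the (Hermitian) norm on forms induced by $g$ (so $|dz_j|^2=2$, $|\omega|=2$), and $\mathrm{vol}=\omega^4/24$. $\bigwedge^{i,j}$ denotes the translation-invariant $(i,j)$-forms with respect to $J$; translation-invariant forms are identified with cohomology classes of $X$, so that cup product is wedge product. $A_+$ is the real $6$-dimensional space $A_+=\{\frac12(c+\bar c):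 c\in\bigwedge^{2,0},\ c\wedge c=\frac14|c|^2\theta\}$. For $\gamma\in A_+$, the form $\omega'=2(\omega+\gamma)/|\omega+\gamma|$ is a flat Kähler form for the same metric $g$ with respect to the complex structure $J'$ on $V$ defined by $g(x,y)=\omega'(x,J'y)$. For a Hermitian complex vector bundle $E\to X$ of rank $r$, $\beta(E)=c_2(E)-\frac{r-1}{2r}c_1(E)^2$. $\mathcal A_E$ is the set of unitary connections $A$ on $E$ with $\mathrm{Tr}\,F_A$ harmonic, and $F_A^o=F_A-\frac1r(\mathrm{Tr}F_A)\,\mathrm{Id}$. For a flat Kähler form $\omega$ with complex structure $J$, $A\in\mathcal A_E$ is traceless $\omega$-HYM if $F_A^o$ is of type $(1,1)$ with respect to $J$ and $F_A^o\wedge\omega^3=0$. A class $\beta\in H^4(X,\mathbb Z)$ is traceless $\omega$-HYM if there are a bundle $E\to X$ with $\beta=\beta(E)$ and a connection $A\in\mathcal A_E$ which is traceless $\omega$-HYM. Similarly for $(\omega',J')$. *)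

(* Defs.v *)
(* MathComp-Analysis over an abstract [R : realType], with C = R[i].
   The 8-torus is X = V / Lam with V = R^8 and Lam an arbitrary lattice of V;
   objects on X are written upstairs, as Lam-periodic objects on V. *)
From HB Require Import structures.
From mathcomp Require Import all_boot all_order all_algebra all_fingroup.
From mathcomp Require Import complex.
From mathcomp Require Import all_classical all_reals all_analysis.
Set Implicit Arguments.
Unset Strict Implicit.
Unset Printing Implicit Defensive.
Import Order.TTheory GRing.Theory Num.Theory.
Import numFieldNormedType.Exports.
Local Open Scope classical_set_scope.
Local Open Scope complex_scope.
Local Open Scope ring_scope.

Notation V8 R := 'rV[R]_8.

Definition is_lattice (R : realType) (Lam : set (V8 R)) : Prop :=
  exists B : 'M[R]_8, B \in unitmx /\
    Lam = [set x | exists z : 'rV[int]_8, x = map_mx intr z *m B].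

(** ** Translation-invariant forms *)

(* Complex-valued translation-invariant k-forms; multilinearity and
   alternation are the separate predicate [is_form]. *)
Definition inv_form (R : realType) (k : nat) : Type := k.-tuple (V8 R) -> R[i].

Definition upd (R : realType) (k : nat) (v : k.-tuple (V8 R)) (j : 'I_k)
    (x : V8 R) : k.-tuple (V8 R) :=
  [tuple if i == j then x else tnth v i | i < k].

Definition is_form (R : realType) (k : nat) (al : inv_form R k) : Prop :=
  (forall v j (s : R) x y,
     al (upd v j (s *: x + y)) = s%:C * al (upd v j x) + al (upd v j y)) /\
  (forall v i j, i != j -> tnth v i = tnth v j -> al v = 0).

(* Normalised so that (a /\ b)(x, y) = a(x) b(y) - a(y) b(x) for 1-forms. *)
Definition wedge_form (R : realType) (p q : nat) (al : inv_form R p)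
    (be : inv_form R q) : inv_form R (p + q) :=
  fun v => ((p`! * q`!)%N%:R)^-1 *
    \sum_(s : 'S_(p + q)) (-1) ^+ s *
       al [tuple tnth v (s (lshift q i)) | i < p] *
       be [tuple tnth v (s (rshift p i)) | i < q].

Definition conj_form (R : realType) (k : nat) (al : inv_form R k) :
    inv_form R k :=
  fun v => conjc (al v).

(* Type (p, q): the C-multilinear extension of [al] to V (x) C vanishes on
   every family taken from T^{1,0} = {x - i J x} and T^{0,1} = {x + i J x}
   whose number of T^{1,0}-members is not p.  Here [S] is the set of positions
   taken from T^{1,0}, and the product of the (v_j -+ i J v_j) is expanded,
   [T] being the set of positions where J v_j is selected. *)
Definition of_type (R : realType) (J : V8 R -> V8 R) (p q : nat)
    (al : inv_form R (p + q)) : Prop :=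
  forall (S : {set 'I_(p + q)}) (v : (p + q).-tuple (V8 R)), #|S| != p ->
    \sum_(T : {set 'I_(p + q)})
      (\prod_(j in T) (if j \in S then - 'i%C else 'i%C)) *
      al [tuple if j \in T then J (tnth v j) else tnth v j | j < p + q] = 0.

(** ** Scalar products and flat Kaehler structures *)

Definition scalar_product (R : realType) (g : V8 R -> V8 R -> R) : Prop :=
  [/\ forall (s : R) x y z, g (s *: x + y) z = s * g x z + g y z,
      forall x y, g x y = g y x &
      forall x, x != 0 -> 0 < g x x].

Definition bvec (R : realType) (i : 'I_8) : V8 R := delta_mx 0 i.

(* The coefficients g^{ij} of the dual metric in the standard basis. *)
Definition dual_metric (R : realType) (g : V8 R -> V8 R -> R) : 'M[R]_8 :=
  invmx (\matrix_(i, j) g (bvec R i) (bvec R j)).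

(* The Hermitian product induced by g, for which the wedge products
   e^{i_1} /\ ... /\ e^{i_k}, i_1 < ... < i_k, of a g-orthonormal coframe are
   orthonormal: (1/k!) g^{i_1 j_1} ... g^{i_k j_k} al_{i_1..i_k} be_{j_1..j_k}^*. *)
Definition finner (R : realType) (g : V8 R -> V8 R -> R) (k : nat)
    (al be : inv_form R k) : R[i] :=
  (k`!%:R)^-1 *
  \sum_(I : {ffun 'I_k -> 'I_8}) \sum_(K : {ffun 'I_k -> 'I_8})
    (\prod_(a < k) dual_metric g (I a) (K a))%:C *
    al [tuple bvec R (I a) | a < k] * conjc (be [tuple bvec R (K a) | a < k]).

Definition fnorm (R : realType) (g : V8 R -> V8 R -> R) (k : nat)
    (al : inv_form R k) : R := Num.sqrt (complex.Re (finner g al al)).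

(* [om] is the Kaehler form of the scalar product [g] and the complex
   structure [J] compatible with it. *)
Definition flat_kahler (R : realType) (g : V8 R -> V8 R -> R)
    (J : {linear V8 R -> V8 R}) (om : inv_form R 2) : Prop :=
  [/\ scalar_product g,
      forall x, J (J x) = - x,
      forall x y, g (J x) (J y) = g x y,
      is_form om &
      forall x y, (g x y)%:C = om [tuple x; J y]].

Definition flat_SU4 (R : realType) (g : V8 R -> V8 R -> R)
    (J : {linear V8 R -> V8 R}) (om : inv_form R 2) (th : inv_form R 4) : Prop :=
  [/\ flat_kahler g J om, is_form th, @of_type R J 4 0 th & fnorm g th = 4].

Definition vol_form (R : realType) (om : inv_form R 2) : inv_form R 8 :=
  fun v => wedge_form om (wedge_form om (wedge_form om om)) v / 24%:R.

Definition A_plus (R : realType) (g : V8 R -> V8 R -> R)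
    (J : {linear V8 R -> V8 R}) (th : inv_form R 4) (ga : inv_form R 2) : Prop :=
  exists c : inv_form R 2,
    [/\ is_form c, @of_type R J 2 0 c,
        forall v, wedge_form c c v = (fnorm g c ^+ 2 / 4)%:C * th v &
        forall v, ga v = (c v + conj_form c v) / 2%:R].

(* 2 (om + ga) / |om + ga| *)
Definition rotated_form (R : realType) (g : V8 R -> V8 R -> R)
    (om ga : inv_form R 2) : inv_form R 2 :=
  fun v => (2 / fnorm g (fun w => om w + ga w))%:C * (om v + ga v).

(** ** Calculus on V *)

(* f is k+1 times differentiable on the open set U. *)
Fixpoint diff_on (R : realType) (k : nat) (U : set (V8 R)) (f : V8 R -> R) :
    Prop :=
  (forall x, U x -> differentiable f x) /\
  (if k is k'.+1 then forall v, diff_on k' U (fun x => 'D_v f x) else True).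

Definition smooth_on (R : realType) (U : set (V8 R)) (f : V8 R -> R[i]) : Prop :=
  forall k, diff_on k U (fun x => complex.Re (f x)) /\
            diff_on k U (fun x => complex.Im (f x)).

(* R[i] carries no normed R-module structure in the library, so complex-valued
   functions are differentiated through their real and imaginary parts. *)
Definition cderiv (R : realType) (v : V8 R) (f : V8 R -> R[i]) (x : V8 R) :
    R[i] :=
  ('D_v (fun y => complex.Re (f y)) x) +i* ('D_v (fun y => complex.Im (f y)) x).

Definition mderiv (R : realType) (r : nat) (v : V8 R) (M : V8 R -> 'M[R[i]]_r)
    (x : V8 R) : 'M[R[i]]_r :=
  \matrix_(a, b) cderiv v (fun y => M y a b) x.

Definition extd (R : realType) (k : nat) (al : V8 R -> inv_form R k) :
    V8 R -> inv_form R k.+1 :=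
  fun x v => \sum_(i < k.+1) (-1) ^+ i *
    cderiv (tnth v i) (fun y => al y [tuple tnth v (lift i j) | j < k]) x.

(* The formal adjoint d^* of d with respect to the flat metric g. *)
Definition codiff (R : realType) (g : V8 R -> V8 R -> R) (k : nat)
    (al : V8 R -> inv_form R k.+1) : V8 R -> inv_form R k :=
  fun x v => - \sum_(i < 8) \sum_(j < 8) (dual_metric g i j)%:C *
    cderiv (bvec R i) (fun y => al y [tuple of bvec R j :: v]) x.

(** ** Hermitian bundles and unitary connections on V / Lam *)

Definition adjmx (R : realType) (r : nat) (M : 'M[R[i]]_r) : 'M[R[i]]_r :=
  map_mx conjc M^T.

(* A rank r Hermitian bundle on V / Lam, given by a trivialising open cover and
   its U(r)-valued transition functions.  Open subsets of V / Lam are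
   represented by their Lam-invariant preimages; in local unitary frames the
   components of a section satisfy s_i = (trans i j) s_j. *)
Record hbundle (R : realType) (Lam : set (V8 R)) (r : nat) := HBundle {
  bidx : Type;
  chart : bidx -> set (V8 R);
  trans : bidx -> bidx -> V8 R -> 'M[R[i]]_r;
  chart_open : forall i, open (chart i);
  chart_periodic : forall i x l, Lam l -> chart i x -> chart i (x + l);
  chart_cover : forall x, exists i, chart i x;
  trans_smooth : forall i j a b,
    smooth_on (chart i `&` chart j) (fun x => trans i j x a b);
  trans_periodic : forall i j x l, Lam l -> chart i x -> chart j x ->
    trans i j (x + l) = trans i j x;
  trans_unitary : forall i j x, chart i x -> chart j x ->
    trans i j x *m adjmx (trans i j x) = 1%:M;
  trans_cocycle : forall i j k x, chart i x -> chart j x -> chart k x ->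
    trans i j x *m trans j k x = trans i k x
}.

(* Local connection matrices: [A i x v] is the value at x, on the tangent
   vector v, of the u(r)-valued 1-form A_i of d + A_i over [chart i]. *)
Definition conn_data (R : realType) (Lam : set (V8 R)) (r : nat)
    (E : hbundle Lam r) : Type := bidx E -> V8 R -> V8 R -> 'M[R[i]]_r.

(* The gluing rule is A_i = h A_j h^{-1} - (dh) h^{-1} with h = trans i j. *)
Definition unitary_connection (R : realType) (Lam : set (V8 R)) (r : nat)
    (E : hbundle Lam r) (A : conn_data E) : Prop :=
  [/\ forall i x, chart i x -> forall (s : R) u v,
        A i x (s *: u + v) = s%:C *: A i x u + A i x v,
      forall i x, chart i x -> forall v, adjmx (A i x v) = - A i x v,
      forall i v a b, smooth_on (chart i) (fun x => A i x v a b),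
      forall i x l, Lam l -> chart i x -> forall v, A i (x + l) v = A i x v &
      forall i j x, chart i x -> chart j x -> forall v,
        A i x v *m trans i j x + mderiv v (trans i j) x
        = trans i j x *m A j x v].

(* Matrix-valued 2-forms. *)
Definition mform2 (R : realType) (r : nat) : Type :=
  2.-tuple (V8 R) -> 'M[R[i]]_r.

(* F = dA + A /\ A, for a matrix-valued 1-form A. *)
Definition curvature (R : realType) (r : nat) (A : V8 R -> V8 R -> 'M[R[i]]_r)
    (x : V8 R) : mform2 R r :=
  fun w => let u := tnth w ord0 in let v := tnth w ord_max in
    mderiv u (fun y => A y v) x - mderiv v (fun y => A y u) x
    + (A x u *m A x v - A x v *m A x u).

Definition mentry (R : realType) (r : nat) (F : mform2 R r) (a b : 'I_r) :
    inv_form R 2 := fun v => F v a b.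

Definition trF (R : realType) (r : nat) (F : mform2 R r) : inv_form R 2 :=
  fun v => \tr (F v).

(* F^o = F - (1/r) (Tr F) Id *)
Definition traceless (R : realType) (r : nat) (F : mform2 R r) : mform2 R r :=
  fun v => F v - ((r%:R)^-1 * trF F v)%:M.

(** ** Chern classes *)

(* The components of degree 2 and 4 of det(1 + (i / 2 pi) F). *)
Definition chern1 (R : realType) (r : nat) (F : mform2 R r) : inv_form R 2 :=
  fun v => 'i%C * ((2 * pi)^-1)%:C * trF F v.

Definition chern2 (R : realType) (r : nat) (F : mform2 R r) : inv_form R 4 :=
  fun v => ((8 * pi ^+ 2)^-1)%:C *
    (\sum_(a < r) \sum_(b < r) wedge_form (mentry F a b) (mentry F b a) v
     - wedge_form (trF F) (trF F) v).

(* The global form on V / Lam given on the charts of E by the [eta i] has the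
   de Rham class of the translation-invariant form [al]: it differs from [al]
   by the differential of a smooth periodic form. *)
Definition has_class (R : realType) (Lam : set (V8 R)) (r : nat)
    (E : hbundle Lam r) (k : nat) (eta : bidx E -> V8 R -> inv_form R k.+1)
    (al : inv_form R k.+1) : Prop :=
  is_form al /\
  exists psi : V8 R -> inv_form R k,
    [/\ forall x, is_form (psi x),
        forall v, smooth_on setT (fun x => psi x v),
        forall x l, Lam l -> forall v, psi (x + l) v = psi x v &
        forall i x, chart i x -> forall v, eta i x v = al v + extd psi x v].

(* Chern-Weil: every bundle has unitary connections, and the classes of the
   Chern forms do not depend on the connection; hence "for all". *)
Definition is_c1 (R : realType) (Lam : set (V8 R)) (r : nat)
    (E : hbundle Lam r) (al : inv_form R 2) : Prop :=
  forall A : conn_data E, unitary_connection A ->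
    has_class (fun i x => chern1 (curvature (A i) x)) al.

Definition is_c2 (R : realType) (Lam : set (V8 R)) (r : nat)
    (E : hbundle Lam r) (al : inv_form R 4) : Prop :=
  forall A : conn_data E, unitary_connection A ->
    has_class (fun i x => chern2 (curvature (A i) x)) al.

(* beta = beta(E) = c_2(E) - ((r-1) / 2r) c_1(E)^2 *)
Definition is_beta (R : realType) (Lam : set (V8 R)) (r : nat)
    (E : hbundle Lam r) (be : inv_form R 4) : Prop :=
  exists (c1 : inv_form R 2) (c2 : inv_form R 4),
    [/\ is_c1 E c1, is_c2 E c2 &
        forall v, be v = c2 v - (r%:R - 1) / (2%:R * r%:R) * wedge_form c1 c1 v].

(* H^4(V / Lam, Z), as the invariant forms with integral periods: the integral
   over the 4-cycle spanned by l_1, ..., l_4 in Lam is be(l_1, ..., l_4). *)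
Definition integral_class (R : realType) (Lam : set (V8 R)) (be : inv_form R 4) :
    Prop :=
  is_form be /\
  forall v : 4.-tuple (V8 R), (forall i, Lam (tnth v i)) ->
    exists m : int, be v = m%:~R.

(** ** Traceless Hermitian Yang-Mills connections *)

(* On a closed manifold a form is harmonic iff it is closed and coclosed; the
   traces of the local curvature matrices glue to a global 2-form. *)
Definition in_AE (R : realType) (Lam : set (V8 R)) (g : V8 R -> V8 R -> R)
    (r : nat) (E : hbundle Lam r) (A : conn_data E) : Prop :=
  unitary_connection A /\
  forall i x, chart i x ->
    (forall v, extd (fun y => trF (curvature (A i) y)) x v = 0) /\
    (forall v, codiff g (fun y => trF (curvature (A i) y)) x v = 0).

Definition traceless_HYM_conn (R : realType) (Lam : set (V8 R)) (r : nat)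
    (J : {linear V8 R -> V8 R}) (om : inv_form R 2) (E : hbundle Lam r)
    (A : conn_data E) : Prop :=
  forall i x, chart i x -> forall a b : 'I_r,
    let Fo := mentry (traceless (curvature (A i) x)) a b in
    @of_type R J 1 1 Fo /\
    forall v, wedge_form Fo (wedge_form om (wedge_form om om)) v = 0.

Definition traceless_HYM (R : realType) (Lam : set (V8 R))
    (g : V8 R -> V8 R -> R) (J : {linear V8 R -> V8 R}) (om : inv_form R 2)
    (be : inv_form R 4) : Prop :=
  exists (r : nat) (E : hbundle Lam r) (A : conn_data E),
    [/\ (0 < r)%N, is_beta E be, in_AE g A & traceless_HYM_conn J om A].

(* Main.v *)
Require Import Defs.
From HB Require Import structures.
From mathcomp Require Import all_boot all_order all_algebra all_fingroup.
From mathcomp Require Import complex.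
From mathcomp Require Import all_classical all_reals all_analysis.
From mathcomp Require Import ring lra zify.
Set Implicit Arguments.
Unset Strict Implicit.
Unset Printing Implicit Defensive.
Import Order.TTheory GRing.Theory Num.Theory.
Import numFieldNormedType.Exports.
Local Open Scope classical_set_scope.
Local Open Scope complex_scope.
Local Open Scope ring_scope.

(** Let K be the g-skew endomorphism with gamma(x, y) = g(Kx, y). It anticommutes
    with J, since gamma is the real part of the (2,0)-form c, and the
    normalisation of c /\ c says exactly that K^2 = - t^2 with t^2 = |c|^2 / 8
    ([conformal], an equality case of the Cauchy-Schwarz inequality). Hence
    J' = (J + K) / sqrt (1 + t^2) is a complex structure, and omega' is its
    Kaehler form for g ([flat_kahler_rotated]). If c = 0, nothing changes.

    The bundle and the connection that serve for omega serve for omega' too. It is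
    enough that each entry a of the traceless curvature is K-invariant,
    a(Kx, Ky) = t^2 a(x, y): then a has type (1,1) for J' ([invariant_rotated]).
    It is primitive for omega' in any case ([primitive_rotated]).

    Invariance comes from a sum of squares. For K now scaled to K^2 = -1, the
    vectors u, Ju, Ku, JKu and a second orthogonal copy of them form a frame in
    which J, K and JK are signed permutations ([exists_quaternionic_frame]). There
    a /\ b /\ x /\ x, for x the Kaehler form of one of the three, is expressed by
    traces ([wedge4_star]), and for a primitive of type (1,1) it follows that
      a /\ conj a /\ (c /\ conj c - |c|^2 / 4 omega^2)
        = t^2 / 2 (|a - K a K^-1|^2 + |a - (JK) a (JK)^-1|^2) vol
    ([wedge4_positive]). Summed over the entries of the traceless curvature, the
    left side is, up to a negative constant, the Chern form of beta
    ([chern_beta]) wedged with c /\ conj c - |c|^2 / 4 omega^2. The hypothesis on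
    beta /\ c /\ conj c says that this has integral zero, as
    6k |c|^2 = |c|^2 / 4 * 24k. So all the squares vanish ([curvature_commutes]).

    Two points are analytic. The first Chern form is constant, because it differs
    from its class by an exact coclosed form, which vanishes ([coclosed_exact_eq0]);
    so the Chern form of beta represents beta ([traceless_beta]). And instead of
    integrals over the torus, Riemann sums over the N^8 points of finer and finer
    grids are used: for the derivative of a periodic function they are O(1/N)
    ([mean_zero_derive_row]), for a nonnegative function that is not zero they are
    not ([mean_zero_ge0]). *)

(** * The alternation operator and associativity of the wedge product *)

Section BlockPerm.
Variables p q : nat.

Lemma split_lshiftE (i : 'I_p) : fintype.split (lshift q i) = inl i.
Proof. exact: (unsplitK (inl i)). Qed.

Lemma split_rshiftE (i : 'I_q) : fintype.split (rshift p i) = inr i.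
Proof. exact: (unsplitK (inr i)). Qed.

Definition blockperm_fun (t : 'S_p) (u : 'S_q) (i : 'I_(p + q)) : 'I_(p + q) :=
  match fintype.split i with
  | inl j => lshift q (t j)
  | inr j => rshift p (u j)
  end.

Lemma blockperm_inj t u : injective (blockperm_fun t u).
Proof.
move=> i j; rewrite /blockperm_fun.
case: (split_ordP i) => a ->; case: (split_ordP j) => b ->;
  rewrite ?split_lshiftE ?split_rshiftE.
- by move/lshift_inj/perm_inj ->.
- by move/eqP; rewrite eq_lrshift.
- by move/eqP; rewrite eq_rlshift.
- by move/rshift_inj/perm_inj ->.
Qed.

Definition blockperm t u : 'S_(p + q) := perm (@blockperm_inj t u).

Lemma blockpermL t u i : blockperm t u (lshift q i) = lshift q (t i).
Proof.
rewrite permE /blockperm_fun.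
by rewrite split_lshiftE.
Qed.

Lemma blockpermR t u i : blockperm t u (rshift p i) = rshift p (u i).
Proof.
rewrite permE /blockperm_fun.
by rewrite split_rshiftE.
Qed.

(** The permutation matrix of a block permutation is block diagonal, so the sign
    can be read off its determinant. *)
Lemma sgn_blockperm (S : comNzRingType) t u :
  (-1) ^+ blockperm t u = (-1) ^+ t * (-1) ^+ u :> S.
Proof.
rewrite -!det_perm.
have -> : perm_mx (blockperm t u) = block_mx (perm_mx t) 0 0 (perm_mx u) :> 'M[S]_(p + q).
  apply/matrixP=> i j; rewrite !mxE.
  case: (split_ordP i) => a ->; case: (split_ordP j) => b ->;
  rewrite ?blockpermL ?blockpermR !mxE ?split_lshiftE ?split_rshiftE ?mxE ?split_lshiftE ?split_rshiftE ?mxE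
    ?eq_lshift ?eq_rshift ?eq_lrshift ?eq_rlshift //.
by rewrite (det_ublock (perm_mx t) 0 (perm_mx u)).
Qed.

End BlockPerm.

Section Alternation.
Variable R : realType.

Definition ptuple n (v : n.-tuple (V8 R)) (s : 'S_n) : n.-tuple (V8 R) :=
  [tuple tnth v (s i) | i < n].

Definition alternation n (f : inv_form R n) : inv_form R n :=
  fun v => \sum_(s : 'S_n) (-1) ^+ s * f (ptuple v s).

Definition tens p q (a : inv_form R p) (b : inv_form R q) : inv_form R (p + q) :=
  fun v => a [tuple tnth v (lshift q i) | i < p] *
           b [tuple tnth v (rshift p i) | i < q].

Lemma ptupleM n (v : n.-tuple (V8 R)) (s t : 'S_n) :
  ptuple (ptuple v s) t = ptuple v (t * s)%g.
Proof. by apply: eq_from_tnth => i; rewrite !tnth_mktuple permM. Qed.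

Lemma alternation_perm n (f : inv_form R n) (t : 'S_n) v :
  alternation (fun w => f (ptuple w t)) v = (-1) ^+ t * alternation f v.
Proof.
rewrite /alternation mulr_sumr.
rewrite [RHS](reindex_inj (mulgI t)) /=.
apply: eq_bigr => s _; rewrite ptupleM odd_permM signr_addb !mulrA.
by rewrite -[(-1) ^+ t * _]expr2 sqrr_sign mul1r.
Qed.

Lemma wedge_alternation p q (a : inv_form R p) (b : inv_form R q) v :
  wedge_form a b v = ((p`!)%:R)^-1 * ((q`!)%:R)^-1 * alternation (tens a b) v.
Proof.
rewrite /wedge_form natrM invfM; congr (_ * _).
apply: eq_bigr => s _; rewrite -mulrA /tens; congr (_ * (a _ * b _)).
  by apply: eq_from_tnth => i; rewrite !tnth_mktuple.
by apply: eq_from_tnth => i; rewrite !tnth_mktuple.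
Qed.

(** Averaging over S_p inside an average over S_(p+q) changes nothing but the
    number of terms: each t in S_p, extended by the identity, is absorbed into
    the outer permutation. This is what makes the wedge product associative. *)
Lemma alternation_tensl p q (f : inv_form R p) (b : inv_form R q) v :
  alternation (tens (alternation f) b) v = (p`!)%:R * alternation (tens f b) v.
Proof.
rewrite {1}/alternation.
transitivity (\sum_(t : 'S_p) \sum_(s : 'S_(p + q)) (-1) ^+ t * ((-1) ^+ s *
     (tens f b (ptuple (ptuple v s) (blockperm t 1))))).
  rewrite exchange_big /=; apply: eq_bigr => s _.
  rewrite /tens /alternation mulr_suml mulr_sumr; apply: eq_bigr => t _.
  rewrite -!mulrA [LHS]mulrCA; congr (_ * (_ * (f _ * b _))).
    by apply: eq_from_tnth => i; rewrite !tnth_mktuple blockpermL.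
  by apply: eq_from_tnth => i; rewrite !tnth_mktuple blockpermR perm1.
rewrite (eq_bigr (fun=> alternation (tens f b) v)); last first.
  move=> t _; rewrite -mulr_sumr.
  have -> : \sum_(s : 'S_(p+q)) (-1) ^+ s * tens f b (ptuple (ptuple v s) (blockperm t 1))
    = alternation (fun w => tens f b (ptuple w (blockperm t 1))) v by [].
  by rewrite alternation_perm sgn_blockperm odd_perm1 mulr1 mulrA -expr2 sqrr_sign mul1r.
by rewrite sumr_const card_Sn mulr_natl.
Qed.

Lemma alternation_tensr p q (a : inv_form R p) (f : inv_form R q) v :
  alternation (tens a (alternation f)) v = (q`!)%:R * alternation (tens a f) v.
Proof.
rewrite {1}/alternation.
transitivity (\sum_(t : 'S_q) \sum_(s : 'S_(p + q)) (-1) ^+ t * ((-1) ^+ s *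
     (tens a f (ptuple (ptuple v s) (blockperm 1 t))))).
  rewrite exchange_big /=; apply: eq_bigr => s _.
  rewrite /tens /alternation !mulr_sumr; apply: eq_bigr => t _.
  rewrite [X in _ * X = _]mulrCA [LHS]mulrCA; congr (_ * (_ * (a _ * f _))).
    by apply: eq_from_tnth => i; rewrite !tnth_mktuple blockpermL perm1.
  by apply: eq_from_tnth => i; rewrite !tnth_mktuple blockpermR.
rewrite (eq_bigr (fun=> alternation (tens a f) v)); last first.
  move=> t _; rewrite -mulr_sumr.
  have -> : \sum_(s : 'S_(p+q)) (-1) ^+ s * tens a f (ptuple (ptuple v s) (blockperm 1 t))
    = alternation (fun w => tens a f (ptuple w (blockperm 1 t))) v by [].
  by rewrite alternation_perm sgn_blockperm odd_perm1 mul1r mulrA -expr2 sqrr_sign mul1r.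
by rewrite sumr_const card_Sn mulr_natl.
Qed.

Lemma factC_neq0 n : (n`!)%:R != 0 :> R[i].
Proof. by rewrite pnatr_eq0 -lt0n fact_gt0. Qed.

Lemma tensZl p q k (a : inv_form R p) (b : inv_form R q) :
  tens (fun v => k * a v) b = fun v => k * tens a b v.
Proof. by apply/funext => v; rewrite /tens mulrA. Qed.

Lemma tensZr p q k (a : inv_form R p) (b : inv_form R q) :
  tens a (fun v => k * b v) = fun v => k * tens a b v.
Proof. by apply/funext => v; rewrite /tens mulrCA. Qed.

Lemma alternationZ n k (f : inv_form R n) v :
  alternation (fun w => k * f w) v = k * alternation f v.
Proof. by rewrite /alternation mulr_sumr; apply: eq_bigr => s _; rewrite mulrCA. Qed.

Lemma wedge_assocr p q n (a : inv_form R p) (b : inv_form R q) (c : inv_form R n) v :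
  wedge_form a (wedge_form b c) v =
  ((p`!)%:R)^-1 * ((q`!)%:R)^-1 * ((n`!)%:R)^-1 * alternation (tens a (tens b c)) v.
Proof.
rewrite wedge_alternation.
have -> : wedge_form b c = fun w => ((q`!)%:R)^-1 * ((n`!)%:R)^-1 * alternation (tens b c) w.
  by apply/funext => w; rewrite wedge_alternation.
rewrite tensZr alternationZ alternation_tensr.
move: (factC_neq0 (q + n)) (factC_neq0 p) (factC_neq0 q) (factC_neq0 n).
move: (_ `!)%:R (p`!)%:R (q`!)%:R (n`!)%:R (alternation _ _) => x y z w A ? ? ? ?.
by field; do ?[apply/andP; split].
Qed.

Definition tens4 (a b c d : inv_form R 2) : inv_form R 8 := fun v =>
  let w i := tnth v (inord i) in
  a [tuple w 0%N; w 1%N] * b [tuple w 2%N; w 3%N] *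
  c [tuple w 4%N; w 5%N] * d [tuple w 6%N; w 7%N].

Definition wedge4 (a b c d : inv_form R 2) : inv_form R 8 := fun v =>
  16^-1 * alternation (tens4 a b c d) v.

Lemma ord2P (i : 'I_2) : i = ord0 \/ i = ord_max.
Proof. by case: i => [[|[|]]] //= h; [left|right]; apply: val_inj. Qed.

Lemma tuple2P (T : Type) (f : 'I_2 -> T) : [tuple f i | i < 2] = [tuple f ord0; f ord_max].
Proof.
apply: eq_from_tnth => i; rewrite tnth_mktuple.
by case: (ord2P i) => ->.
Qed.

(** With [tens4E'], both bracketings of a product of four 2-forms become the
    alternation of one and the same tensor. *)
Lemma tens4E (a b c d : inv_form R 2) :
  tens4 a b c d = tens (tens a b) (tens c d).
Proof.
apply/funext => v; rewrite /tens4 /tens !tuple2P !tnth_mktuple !mulrA.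
by congr (a _ * b _ * c _ * d _); apply: eq_from_tnth => i;
  rewrite !(tnth_nth 0); case: (ord2P i) => ->; rewrite /= ?inordK //=.
Qed.

Lemma tens4E' (a b c d : inv_form R 2) :
  tens4 a b c d = tens a (tens b (tens c d)).
Proof.
apply/funext => v; rewrite /tens4 /tens !tuple2P !tnth_mktuple !mulrA.
by congr (a _ * b _ * c _ * d _); apply: eq_from_tnth => i;
  rewrite !(tnth_nth 0); case: (ord2P i) => ->; rewrite /= ?inordK //=.
Qed.

End Alternation.

(** * Levi-Civita symbols and multilinear expansion *)

Section TupleSums.
Variable S : comNzRingType.

Lemma sum_tuple_cons (T : finType) n (F : n.+1.-tuple T -> S) :
  \sum_(t : n.+1.-tuple T) F t =
  \sum_(x : T) \sum_(t : n.-tuple T) F (cons_tuple x t).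
Proof.
rewrite pair_big /=.
rewrite (reindex (fun p : T * n.-tuple T => cons_tuple p.1 p.2)) //=.
exists (fun t : n.+1.-tuple T => (thead t, behead_tuple t)) => [[x t]|t] _ /=.
  by congr pair; apply: val_inj.
by rewrite [RHS]tuple_eta.
Qed.

Lemma sum_tuple0 (T : finType) (F : 0.-tuple T -> S) :
  \sum_(t : 0.-tuple T) F t = F [tuple].
Proof. by rewrite (big_pred1 [tuple]) // => t; apply/esym/eqP; rewrite (tuple0 t). Qed.

Lemma sum_ffun_tuple (T : finType) n (F : n.-tuple T -> S) :
  \sum_(f : {ffun 'I_n -> T}) F [tuple f i | i < n] = \sum_(t : n.-tuple T) F t.
Proof.
rewrite [RHS](reindex (fun f : {ffun 'I_n -> T} => [tuple f i | i < n])) //=.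
exists (fun t : n.-tuple T => [ffun i => tnth t i]) => t _.
  by apply/ffunP => i; rewrite ffunE tnth_mktuple.
by apply: eq_from_tnth => i; rewrite tnth_mktuple ffunE.
Qed.

(** The Levi-Civita symbol, as the determinant of a 0/1 matrix; the default n of
    [nth] is out of range, so that a short sequence gives a zero row. *)
Definition levi n (t : seq nat) : S :=
  \det (\matrix_(i < n, j < n) (nth n t i == j)%:R).

(** Turns a sum over permutations into a sum over all index tuples, where each
    index can be summed separately. *)
Lemma alternating_sum_tuple n (G : n.-tuple 'I_n -> S) :
  \sum_(s : 'S_n) (-1) ^+ s * G [tuple s i | i < n] =
  \sum_(t : n.-tuple 'I_n) G t * levi n (map val t).
Proof.
transitivity (\sum_(t : n.-tuple 'I_n) \sum_(s : 'S_n)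
   G t * ((-1) ^+ s * ([tuple s i | i < n] == t)%:R)).
  rewrite exchange_big /=; apply: eq_bigr => s _.
  rewrite (bigD1 [tuple s i | i < n]) //= eqxx mulr1 mulrC big1 ?addr0 //.
  by move=> t; rewrite eq_sym => /negbTE ->; rewrite !mulr0.
apply: eq_bigr => t _; rewrite -mulr_sumr; congr (_ * _); apply: eq_bigr => s _.
congr (_ * _); transitivity (\prod_(i < n) (tnth t i == s i)%:R : S); last first.
  apply: eq_bigr => i _; rewrite mxE (nth_map i) ?size_tuple //.
  by rewrite (tnth_nth i).
have [/eqP e|] := boolP (_ == t).
  by rewrite big1 // => i _; rewrite -e tnth_mktuple eqxx.
move=> ne; have [i /negbTE h] : exists i, tnth t i != s i.
  apply/existsP; apply: contraR ne; rewrite negb_exists => /forallP h.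
  by apply/eqP/eq_from_tnth => i; rewrite tnth_mktuple; apply/esym/eqP; have := h i; rewrite negbK.
by rewrite (bigD1 i) //= h mul0r.
Qed.

(** A version of [levi] that the kernel can evaluate, by expanding the
    determinant along its first row; a repeated index or one out of range
    gives 0. *)
Fixpoint levi_rec (n : nat) (t : seq nat) : int :=
  if n is n'.+1 then
    if t is x :: t' then
      if (x <= n')%N && (x \notin t')
      then let e := levi_rec n' (map (unbump x) t') in if odd x then - e else e
      else 0
    else 0
  else 1.

Lemma levi_recP n t : size t = n -> levi n t = (levi_rec n t)%:~R.
Proof.
elim: n t => [|n IH] [|x t] //=; first by rewrite /levi det_mx00.
move=> [st]; rewrite /levi.
set M := \matrix_(_, _) _.
case: ifP => [/andP [xn xt]|/negbT].
  have xn' : (x < n.+1)%N by [].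
  rewrite (expand_det_row M ord0) (bigD1 (Ordinal xn')) //= big1 ?addr0; last first.
    move=> j /negbTE hj; rewrite mxE /= (_ : (x == j) = false) ?mul0r //.
    by rewrite eq_sym -hj.
  rewrite mxE /= eqxx mul1r /cofactor /= add0n.
  have -> : row' ord0 (col' (Ordinal xn') M) =
      \matrix_(i < n, j < n) (nth n (map (unbump x) t) i == j)%:R.
    apply/matrixP => i j; rewrite !mxE /= (nth_map n) ?st //.
    have : nth n t i != x.
      by apply: contraNneq xt => <-; rewrite mem_nth ?st.
    have -> : nth n.+1 t i = nth n t i by apply: set_nth_default; rewrite st.
    move: (nth n t i) => y yx; congr (_%:R); congr (nat_of_bool _).
    apply/eqP/eqP => [->|<-]; first exact: bumpK.
    by rewrite unbumpK.
  rewrite -/(levi n _) IH ?size_map // -signr_odd.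
  by case: (odd x); rewrite ?expr0 ?expr1 ?mul1r // mulN1r mulrNz.
rewrite negb_and -ltnNge negbK mulr0z => /orP [nx|xt].
  rewrite (expand_det_row M ord0) big1 // => j _; rewrite mxE /=.
  by rewrite (_ : (x == j) = false) ?mul0r //; apply/negbTE; move: (ltn_ord j); lia.
have it : (index x t < n)%N by rewrite -st index_mem.
apply: (determinant_alternate (i1 := ord0) (i2 := lift ord0 (Ordinal it))) => //.
move=> j; rewrite !mxE /=; congr (nat_of_bool (_ == _))%:R.
by rewrite nth_index.
Qed.

End TupleSums.

Section Multilinear.
Variable R : realType.

Definition multilinear k (al : inv_form R k) : Prop :=
  forall v j (s : R) x y,
     al (upd v j (s *: x + y)) = s%:C * al (upd v j x) + al (upd v j y).

Lemma upd_cons0 k (x y : V8 R) (v : k.-tuple (V8 R)) :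
  upd (cons_tuple x v) ord0 y = cons_tuple y v.
Proof.
apply: eq_from_tnth => i; rewrite tnth_mktuple.
by case: (unliftP ord0 i) => [j|] ->; rewrite ?eqxx // ?tnthS.
Qed.

Lemma upd_consS k (x y : V8 R) (v : k.-tuple (V8 R)) j :
  upd (cons_tuple x v) (lift ord0 j) y = cons_tuple x (upd v j y).
Proof.
apply: eq_from_tnth => i; rewrite tnth_mktuple.
case: (unliftP ord0 i) => [l|] ->; last by [].
by rewrite (inj_eq lift_inj) !tnthS tnth_mktuple.
Qed.

Lemma real_lin0 (f : V8 R -> R[i]) :
  (forall (s : R) x y, f (s *: x + y) = s%:C * f x + f y) -> f 0 = 0.
Proof.
move=> lf; have := lf 1 0 0; rewrite scaler0 addr0 mul1r.
by move/eqP; rewrite -subr_eq0 opprD addrA subrr sub0r oppr_eq0 => /eqP.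
Qed.

Lemma real_lin_sum (f : V8 R -> R[i]) (I : Type) (r : seq I) (s : I -> R) (x : I -> V8 R) :
  (forall (s : R) x y, f (s *: x + y) = s%:C * f x + f y) ->
  f (\sum_(i <- r) s i *: x i) = \sum_(i <- r) (s i)%:C * f (x i).
Proof.
move=> lf; elim: r => [|i r IH]; first by rewrite !big_nil real_lin0.
by rewrite !big_cons lf IH.
Qed.

Lemma multilinear_expand k (al : inv_form R k) (e : 'I_8 -> V8 R) (co : V8 R -> 'I_8 -> R)
    (eco : forall x, x = \sum_p co x p *: e p) v : multilinear al ->
  al v = \sum_(t : k.-tuple 'I_8)
    (\prod_(i < k) co (tnth v i) (tnth t i))%:C * al (map_tuple e t).
Proof.
elim: k al v => [|k IH] al v mal.
  rewrite sum_tuple0 big_ord0 mul1r; congr al.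
  by apply: val_inj; rewrite [v]tuple0.
case/tupleP: v => x v; rewrite sum_tuple_cons.
transitivity (\sum_p (co x p)%:C * al (cons_tuple (e p) v)).
  have lin (s : R) y z : al (cons_tuple (s *: y + z) v) =
      s%:C * al (cons_tuple y v) + al (cons_tuple z v).
    by have := mal (cons_tuple 0 v) ord0 s y z; rewrite !upd_cons0.
  have := real_lin_sum (f := fun y => al (cons_tuple y v)) (index_enum _) (co x) e lin.
  by rewrite -eco.
apply: eq_bigr => p _.
rewrite (IH (fun w => al (cons_tuple (e p) w)) v); last first.
  by move=> w j s y z; have := mal (cons_tuple (e p) w) (lift ord0 j) s y z; rewrite !upd_consS.
rewrite mulr_sumr; apply: eq_bigr => t _.
rewrite big_ord_recl /= !tnth0 mulrA -rmorphM; congr ((_ * _)%:C * al _).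
  by apply: eq_bigr => i _; rewrite !tnthS.
exact: val_inj.
Qed.

End Multilinear.

(** * The product with the square of a Kaehler form, in a quaternionic frame *)

Section Table.

(** In the basis u, Ju, Ku, JKu, v, Jv, Kv, JKv, each of the units J, K, JK
    (numbered 1, 2, 3) maps a basis vector to plus or minus another one:
    [qpar] gives the index of the image and [qneg] its sign. *)
Definition qpar (m p : nat) : nat :=
  nth 0%N (nth [::] [:: [:: 0; 1; 2; 3; 4; 5; 6; 7]; [:: 1; 0; 3; 2; 5; 4; 7; 6];
    [:: 2; 3; 0; 1; 6; 7; 4; 5]; [:: 3; 2; 1; 0; 7; 6; 5; 4]]%N m) p.

Definition qneg (m p : nat) : bool :=
  nth false (nth [::] [:: [:: false; false; false; false];
   [:: false; true; false; true]; [:: false; true; true; false];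
   [:: false; false; true; true]] m) (p %% 4)%N.

Definition qsgn m p : int := if qneg m p then -1 else 1.

(** The entry g(I e_p, e_q) of the unit I numbered m, that is the coefficient
    of its Kaehler form. *)
Definition qent (m p q : nat) : int := if q == qpar m p then qsgn m p else 0.

Definition sum8 (F : nat -> int) : int :=
  F 0%N + (F 1%N + (F 2%N + (F 3%N + (F 4%N + (F 5%N + (F 6%N + F 7%N)))))).

Lemma sum8E (F : nat -> int) : \sum_(i < 8) F i = sum8 F.
Proof. by rewrite /sum8 !big_ord_recl big_ord0 addr0. Qed.

Definition all8 (P : nat -> bool) : bool := all P (iota 0 8).

Lemma all8P (P : nat -> bool) : all8 P -> forall p : 'I_8, P p.
Proof. by move/allP => h p; apply: h; rewrite mem_iota /= ltn_ord. Qed.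

Definition sgmul (a b : bool) (x : int) := if a (+) b then - x else x.

(** Says that omega^2/2 is its own Hodge dual for the Kaehler form omega of the
    unit m. Contracting the Levi-Civita symbol with omega twice only needs the
    pairs (u, qpar m u), hence two sums instead of four. *)
Definition dual_check (m p q r t : nat) : bool :=
  sum8 (fun u => sum8 (fun w => sgmul (qneg m u) (qneg m w)
     (levi_rec 8 [:: p; q; r; t; u; qpar m u; w; qpar m w])))
  == 8 * (qent m p q * qent m r t - qent m p r * qent m q t + qent m p t * qent m q r).


Arguments levi_rec : simpl never.
Arguments sum8 : simpl never.
Arguments dual_check : simpl never.
Arguments qpar : simpl never.
Arguments qneg : simpl never.

Lemma dual_check_aux :
  [&& all8 (fun p => all8 (fun q => all8 (fun r => all8 (fun t => dual_check 1 p q r t)))),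
      all8 (fun p => all8 (fun q => all8 (fun r => all8 (fun t => dual_check 2 p q r t)))) &
      all8 (fun p => all8 (fun q => all8 (fun r => all8 (fun t => dual_check 3 p q r t))))].
Proof. by vm_compute. Qed.

Definition unit_index m := (m \in [:: 1; 2; 3])%N.

Lemma dual_checkP m (p q r t : 'I_8) : unit_index m ->  dual_check m p q r t.
Proof.
have /and3P [h1 h2 h3] := dual_check_aux.
rewrite /unit_index !inE => /or3P [] /eqP ->.
- exact: (all8P (all8P (all8P (all8P h1 p) q) r) t).
- exact: (all8P (all8P (all8P (all8P h2 p) q) r) t).
- exact: (all8P (all8P (all8P (all8P h3 p) q) r) t).
Qed.

Lemma qpar_lt m (p : 'I_8) : unit_index m -> (qpar m p < 8)%N.
Proof.
rewrite /unit_index !inE => /or3P [] /eqP ->.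
- exact: (all8P (P := fun p => qpar 1 p < 8)%N).
- exact: (all8P (P := fun p => qpar 2 p < 8)%N).
- exact: (all8P (P := fun p => qpar 3 p < 8)%N).
Qed.

Lemma sum_qent (S : comNzRingType) m (p : 'I_8) (G : nat -> S) : unit_index m ->
  \sum_(q < 8) (qent m p q)%:~R * G q = (qsgn m p)%:~R * G (qpar m p).
Proof.
move=> hm; rewrite (bigD1 (Ordinal (qpar_lt p hm))) //= big1 => [|q hq].
  by rewrite addr0 /qent eqxx.
rewrite /qent (_ : (q == qpar m p :> nat) = false) ?mulr0z ?mul0r //.
by apply/negbTE.
Qed.

Lemma levi_dual (S : comNzRingType) m (p q r t : 'I_8) : unit_index m ->
  \sum_(u < 8) \sum_(v < 8) \sum_(w < 8) \sum_(x < 8)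
    (qent m u v)%:~R * ((qent m w x)%:~R *
      levi S 8 [:: (p : nat); (q : nat); (r : nat); (t : nat); (u : nat); (v : nat); (w : nat); (x : nat)])
  = 8 * ((qent m p q)%:~R * (qent m r t)%:~R - (qent m p r)%:~R * (qent m q t)%:~R
        + (qent m p t)%:~R * (qent m q r)%:~R).
Proof.
move=> hm; have /eqP e := dual_checkP p q r t hm.
transitivity ((sum8 (fun u => sum8 (fun w => sgmul (qneg m u) (qneg m w)
     (levi_rec 8 [:: (p : nat); (q : nat); (r : nat); (t : nat); u; qpar m u; w; qpar m w]))))%:~R : S); last first.
  by rewrite e !(rmorphM, rmorphB, rmorphD).
rewrite -sum8E rmorph_sum /=; apply: eq_bigr => u _.
under eq_bigr => v _ do under eq_bigr => w _ do rewrite -mulr_sumr.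
under eq_bigr => v _ do rewrite -mulr_sumr.
rewrite (sum_qent u (fun v => \sum_(w < 8) \sum_(x < 8) (qent m w x)%:~R *
      levi S 8 [:: (p : nat); (q : nat); (r : nat); (t : nat); (u : nat); v; (w : nat); (x : nat)])) //.
rewrite -sum8E rmorph_sum /= mulr_sumr; apply: eq_bigr => w _.
rewrite (sum_qent w (fun x => 
      levi S 8 [:: (p : nat); (q : nat); (r : nat); (t : nat); (u : nat); qpar m u; (w : nat); x])) //.
rewrite levi_recP // /sgmul /qsgn; move: (levi_rec _ _) => y.
by case: (qneg m u); case: (qneg m w); rewrite /= ?mulrNz ?mul1r ?mulN1r ?opprK.
Qed.

End Table.

Section Star.
Variable R : realType.
Implicit Types (a b c d x : inv_form R 2) (e : 'I_8 -> V8 R).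

Definition form_mx e a : 'M[R[i]]_8 := \matrix_(p, q) a [tuple e p; e q].

Lemma wedge4_frame a b c d e :
  wedge4 a b c d (mktuple e) = 16^-1 *
  \sum_p \sum_q \sum_r \sum_t \sum_u \sum_v \sum_w \sum_x
    form_mx e a p q * form_mx e b r t * form_mx e c u v * form_mx e d w x *
    levi _ 8 [:: (p : nat); (q : nat); (r : nat); (t : nat); (u : nat); (v : nat); (w : nat); (x : nat)].
Proof.
rewrite /wedge4 /alternation; congr (_ * _).
transitivity (\sum_(s : 'S_8) (-1) ^+ s * tens4 a b c d (map_tuple e [tuple s i | i < 8])).
  apply: eq_bigr => s _; congr (_ * tens4 _ _ _ _ _).
  by apply: eq_from_tnth => i; rewrite [LHS]tnth_mktuple tnth_mktuple [RHS]tnth_map tnth_mktuple.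
rewrite (alternating_sum_tuple (fun t => tens4 a b c d (map_tuple e t))).
do 8!(rewrite sum_tuple_cons; apply: eq_bigr => ? _).
by rewrite sum_tuple0 /tens4 !(tnth_nth 0) /= !inordK //= !mxE.
Qed.

Definition qmx m : 'M[R[i]]_8 := \matrix_(p, q) (qent m p q)%:~R.

Definition skew_form a := forall u v, a [tuple u; v] = - a [tuple v; u].

(** Since omega^2/2 is self-dual, a /\ b /\ omega^2 is (up to the volume) the
    pairing of a /\ b with omega^2: a trace term and a term comparing a with the
    conjugate of b by the complex structure. On primitive (1,1)-forms this is
    the Hodge-Riemann relation. *)
Lemma wedge4_star m a b x e : unit_index m -> skew_form b -> form_mx e x = qmx m ->
  wedge4 a b x x (mktuple e) =
   2^-1 * (\tr (form_mx e a *m (qmx m)^T) * \tr (form_mx e b *m (qmx m)^T))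
   - \tr (form_mx e a *m qmx m *m (form_mx e b)^T *m (qmx m)^T).
Proof.
move=> hm sb hx; rewrite wedge4_frame hx.
set A := form_mx e a; set B := form_mx e b; set X := qmx m.
have BT p q : B q p = - B p q by rewrite !mxE sb.
transitivity (16^-1 * \sum_p \sum_q \sum_r \sum_t A p q * B r t *
   (8 * (X p q * X r t - X p r * X q t + X p t * X q r))).
  congr (_ * _); apply: eq_bigr => p _; apply: eq_bigr => q _.
  apply: eq_bigr => r _; apply: eq_bigr => t _.
  have := levi_dual R[i] p q r t hm; rewrite !mxE => <-.
  rewrite mulr_sumr; apply: eq_bigr => u _.
  rewrite mulr_sumr; apply: eq_bigr => v _.
  rewrite mulr_sumr; apply: eq_bigr => w _.
  rewrite mulr_sumr; apply: eq_bigr => y _.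
  by rewrite !mxE !mulrA.
pose S4 (F : 'I_8 -> 'I_8 -> 'I_8 -> 'I_8 -> R[i]) := \sum_p \sum_q \sum_r \sum_t F p q r t.
have S4D F G : S4 F + S4 G = S4 (fun p q r t => F p q r t + G p q r t).
  by rewrite /S4; do 4!(rewrite -big_split; apply: eq_bigr => ? _).
have S4Z k F : k * S4 F = S4 (fun p q r t => k * F p q r t).
  by rewrite /S4; do 4!(rewrite mulr_sumr; apply: eq_bigr => ? _).
have S4E F G : (forall p q r t, F p q r t = G p q r t) -> S4 F = S4 G.
  by move=> FG; rewrite /S4; do 4!(apply: eq_bigr => ? _).
have trA (C : 'M[R[i]]_8) : \tr (C *m X^T) = \sum_p \sum_q C p q * X p q.
  by rewrite /mxtrace; apply: eq_bigr => p _; rewrite mxE; apply: eq_bigr => q _; rewrite mxE.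
have E1 : \tr (A *m X^T) * \tr (B *m X^T) = S4 (fun p q r t => A p q * B r t * (X p q * X r t)).
  rewrite !trA /S4 mulr_suml; apply: eq_bigr => p _; rewrite mulr_suml; apply: eq_bigr => q _.
  by do 2!(rewrite mulr_sumr; apply: eq_bigr => ? _); rewrite mulrACA.
have E2 : \tr (A *m X *m B^T *m X^T) = S4 (fun p q r t => A p q * B r t * (X p r * X q t)).
  rewrite trA /S4; apply: eq_bigr => p _; rewrite [RHS]exchange_big /=.
  apply: eq_bigr => r _; rewrite mxE mulr_suml [RHS]exchange_big /=.
  apply: eq_bigr => t _; rewrite !mxE !mulr_suml.
  by apply: eq_bigr => q _; rewrite !mxE; ring.
have E3 : S4 (fun p q r t => A p q * B r t * (X p t * X q r)) = - \tr (A *m X *m B^T *m X^T).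
  rewrite E2 -mulN1r S4Z /S4; apply: eq_bigr => p _; apply: eq_bigr => q _.
  rewrite exchange_big /=; apply: eq_bigr => r _; apply: eq_bigr => t _.
  by rewrite BT; ring.
rewrite E1 -/(S4 _).
have -> : \tr (A *m X *m B^T *m X^T) = 2^-1 * S4 (fun p q r t => A p q * B r t * (X p r * X q t)) - 2^-1 * S4 (fun p q r t => A p q * B r t * (X p t * X q r)).
  by rewrite E3 -E2; move: (\tr _) => y; field.
rewrite opprB -[- (2^-1 * _)]mulNr !S4Z !S4D; apply: S4E => p q r t; by field.
Qed.
End Star.

(** * Orthonormal frames of a scalar product *)

Section Metric.
Variables (R : realType) (g : V8 R -> V8 R -> R).
Hypothesis hg : scalar_product g.
Implicit Types (x y z : V8 R).

Lemma sp_linl (s : R) x y z : g (s *: x + y) z = s * g x z + g y z.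
Proof. by case: hg. Qed.
Lemma sp_sym x y : g x y = g y x. Proof. by case: hg. Qed.
Lemma sp_gt0 x : x != 0 -> 0 < g x x. Proof. by case: hg => _ _; apply. Qed.

Lemma sp0l z : g 0 z = 0.
Proof. by have := sp_linl 1 0 0 z; rewrite scaler0 addr0 mul1r; lra. Qed.
Lemma spDl x y z : g (x + y) z = g x z + g y z.
Proof. by rewrite -[x]scale1r sp_linl mul1r scale1r. Qed.
Lemma spZl s x z : g (s *: x) z = s * g x z.
Proof. by rewrite -[s *: x]addr0 sp_linl sp0l addr0. Qed.
Lemma spNl x z : g (- x) z = - g x z.
Proof. by rewrite -scaleN1r spZl mulN1r. Qed.
Lemma spDr x y z : g z (x + y) = g z x + g z y.
Proof. by rewrite ![g z _]sp_sym spDl. Qed.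
Lemma spZr s x z : g z (s *: x) = s * g z x.
Proof. by rewrite ![g z _]sp_sym spZl. Qed.
Lemma spNr x z : g z (- x) = - g z x.
Proof. by rewrite ![g z _]sp_sym spNl. Qed.
Lemma sp_suml (I : Type) (r : seq I) (P : pred I) (F : I -> V8 R) z :
  g (\sum_(i <- r | P i) F i) z = \sum_(i <- r | P i) g (F i) z.
Proof. by elim/big_rec2: _ => [|i y1 y2 _ <-]; rewrite ?sp0l ?spDl. Qed.
Lemma sp_sumr (I : Type) (r : seq I) (P : pred I) (F : I -> V8 R) z :
  g z (\sum_(i <- r | P i) F i) = \sum_(i <- r | P i) g z (F i).
Proof. by rewrite sp_sym sp_suml; apply: eq_bigr => i _; rewrite sp_sym. Qed.

Lemma sp_eq0 x : (g x x == 0) = (x == 0).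
Proof. by have [->|/sp_gt0 /gt_eqF ->//] := eqVneq x 0; rewrite sp0l eqxx. Qed.

Lemma bvec_sum x : x = \sum_j x 0 j *: bvec R j.
Proof. by rewrite {1}[x]row_sum_delta. Qed.

Lemma exists_unit_orthogonal n (u : 'I_n -> V8 R) : (n < 8)%N ->
  exists2 x, g x x = 1 & forall i, g x (u i) = 0.
Proof.
move=> n8; pose U := \matrix_(j < 8, i < n) g (bvec R j) (u i).
have xU x i : (x *m U) 0 i = g x (u i).
  rewrite {2}[x]bvec_sum sp_suml mxE; apply: eq_bigr => j _.
  by rewrite mxE spZl.
have : kermx U != 0.
  rewrite kermx_eq0 /row_free neq_ltn; apply/orP; left.
  exact: leq_ltn_trans (rank_leq_col U) n8.
rewrite -nz_row_eq0; set x := nz_row _ => x0.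
have xk : x *m U = 0 by apply/sub_kermxP; exact: nz_row_sub.
have gx := sp_gt0 x0.
exists ((Num.sqrt (g x x))^-1 *: x) => [|i].
  rewrite spZl spZr mulrA -expr2 exprVn sqr_sqrtr ?ltW // mulVf //; exact: lt0r_neq0.
by rewrite spZl -xU xk mxE mulr0.
Qed.

(** Orthonormal bases adapted to a complex or quaternionic structure are built by
    choosing each vector orthogonal to the images of the previous ones under the
    structure; the images of the last vector impose nothing, which gives the
    bound on n. *)
Lemma exists_orthogonal_orbits m (O : 'I_m -> V8 R -> V8 R) n : (n * m < 8 + m)%N ->
  exists f : nat -> V8 R, forall i, (i < n)%N -> g (f i) (f i) = 1 /\
    forall j, (j < i)%N -> forall a, g (f i) (O a (f j)) = 0.
Proof.
elim: n => [|n IH] nm; first by exists (fun=> 0).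
have [|f hf] := IH; first by rewrite mulSn in nm; lia.
have nm8 : (#|{: 'I_n * 'I_m}| < 8)%N.
  by rewrite card_prod !card_ord; rewrite mulSn in nm; lia.
have [x x1 xu] := exists_unit_orthogonal
  (fun k => let p : 'I_n * 'I_m := enum_val k in O p.2 (f p.1)) nm8.
exists (fun i => if i == n then x else f i) => i.
rewrite ltnS leq_eqVlt; case: eqP => [-> _|_ /= ltin].
  split=> // j jn a; rewrite ltn_eqF //.
  by have := xu (enum_rank (Ordinal jn, a)); rewrite /= enum_rankK.
have [h1 h2] := hf i ltin; split=> // j ji a.
by rewrite ltn_eqF ?h2 // (ltn_trans ji).
Qed.

Definition orthonormal_frame (e : 'I_8 -> V8 R) := forall p q, g (e p) (e q) = (p == q)%:R.

Section Frame.
Variables (e : 'I_8 -> V8 R) (he : orthonormal_frame e).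

Let E : 'M[R]_8 := \matrix_(p, j) e p 0 j.
Let G : 'M[R]_8 := \matrix_(i, j) g (bvec R i) (bvec R j).

Lemma gramE x y : g x y = (x *m G *m y^T) 0 0.
Proof.
rewrite {1}[y]bvec_sum sp_sumr mxE; apply: eq_bigr => j _.
rewrite spZr !mxE mulrC; congr (_ * _).
rewrite {1}[x]bvec_sum sp_suml; apply: eq_bigr => i _.
by rewrite spZl mxE.
Qed.

Lemma frame_gram : E *m G *m E^T = 1%:M.
Proof.
apply/matrixP => p q; have := he p q; rewrite gramE !mxE => <-.
apply: eq_bigr => j _; rewrite !mxE; congr (_ * _).
by apply: eq_bigr => i _; rewrite !mxE.
Qed.

Lemma frame_gramV : G *m E^T *m E = 1%:M.
Proof. by apply: mulmx1C; rewrite mulmxA frame_gram. Qed.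

Lemma frame_expand x : x = \sum_p g x (e p) *: e p.
Proof.
rewrite -{1}[x]mulmx1 -frame_gramV !mulmxA.
apply/rowP => j; rewrite mxE summxE; apply: eq_bigr => p _.
rewrite !mxE gramE !mxE; congr (_ * _); apply: eq_bigr => i _.
by rewrite !mxE.
Qed.

Lemma dual_metric_frame i j : dual_metric g i j = \sum_p e p 0 i * e p 0 j.
Proof.
have -> : dual_metric g = E^T *m E.
  have GV : G *m (E^T *m E) = 1%:M by rewrite mulmxA frame_gramV.
  have /= uG := mulmx1_unit GV.
  rewrite /dual_metric -/G; apply: (can_inj (mulKmx uG.1)).
  by rewrite mulmxV ?uG.1 // GV.
by rewrite !mxE; apply: eq_bigr => p _; rewrite !mxE.
Qed.

(** The norm of forms is defined in the standard basis with the inverse Gram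
    matrix; that matrix is E^T E for the matrix E of an orthonormal frame, so
    the two sums agree. *)
Lemma finner_frame k (al be : inv_form R k) : multilinear al -> multilinear be ->
  finner g al be = (k`!%:R)^-1 *
    \sum_(t : k.-tuple 'I_8) al (map_tuple e t) * conjc (be (map_tuple e t)).
Proof.
move=> mal mbe; congr (_ * _).
have ex al' t : multilinear al' -> al' (map_tuple e t) =
   \sum_(I : {ffun 'I_k -> 'I_8}) (\prod_(a < k) e (tnth t a) 0 (I a))%:C *
      al' [tuple bvec R (I a) | a < k].
  move=> mal'; rewrite (multilinear_expand (co := fun x j => x 0 j) bvec_sum) //.
  rewrite -sum_ffun_tuple; apply: eq_bigr => I _; congr (_%:C * al' _).
    by apply: eq_bigr => a _; rewrite tnth_map tnth_mktuple.
  by apply: eq_from_tnth => a; rewrite tnth_map !tnth_mktuple.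
transitivity (\sum_(t : k.-tuple 'I_8) \sum_(I : {ffun 'I_k -> 'I_8})
   \sum_(K : {ffun 'I_k -> 'I_8})
   (\prod_(a < k) (e (tnth t a) 0 (I a) * e (tnth t a) 0 (K a)))%:C *
     al [tuple bvec R (I a) | a < k] * conjc (be [tuple bvec R (K a) | a < k])); last first.
  apply: eq_bigr => t _; rewrite (ex al) // (ex be) // rmorph_sum mulr_suml.
  apply: eq_bigr => I _; rewrite mulr_sumr; apply: eq_bigr => K _.
  rewrite big_split /= rmorphM [X in _ * _ * _ = _ * X]rmorphM /=.
  by rewrite [X in _ = _ * (X * _)]conjc_real; ring.
rewrite [RHS]exchange_big /=; apply: eq_bigr => I _.
rewrite [RHS]exchange_big /=; apply: eq_bigr => K _.
rewrite -!mulr_suml; congr (_ * _ * _).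
rewrite -rmorph_sum /=; congr (_%:C).
rewrite -sum_ffun_tuple.
under eq_bigr => a _ do rewrite dual_metric_frame.
rewrite bigA_distr_bigA /=; apply: eq_bigr => f _; apply: eq_bigr => a _.
by rewrite tnth_mktuple.
Qed.

(** Top-degree forms are determined by their value on one basis. *)
Lemma alternation_frame (f : inv_form R 8) v : multilinear f ->
  alternation f v = (\det (\matrix_(i, p) g (tnth v i) (e p)))%:C *
    alternation f (mktuple e).
Proof.
move=> mf; set M := \matrix_(i, p) _.
have L (t : 8.-tuple 'I_8) : \sum_(s : 'S_8) (-1) ^+ s *
   (\prod_(i < 8) g (tnth v (s i)) (e (tnth t i)))%:C = (\det M)%:C * levi R[i] 8 (map val t).
  rewrite /levi; set P := \matrix_(_, _) _.
  transitivity (\det (map_mx (real_complex R) M *m P^T)); last first.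
    by rewrite det_mulmx det_tr -det_map_mx.
  rewrite -det_tr; apply: eq_bigr => s _; congr (_ * _).
  rewrite rmorph_prod; apply: eq_bigr => i _; rewrite !mxE.
  rewrite (bigD1 (tnth t i)) //= big1 => [|p /negbTE hp].
    rewrite !mxE (nth_map (tnth t i)) ?size_tuple // -tnth_nth eqxx mulr1 addr0 //.
  rewrite !mxE (nth_map (tnth t i)) ?size_tuple // -tnth_nth.
  by rewrite (_ : (_ == _) = false) ?mulr0 // eq_sym.
transitivity (\sum_(t : 8.-tuple 'I_8) (\det M)%:C * levi R[i] 8 (map val t) * f (map_tuple e t)).
  under [RHS]eq_bigr => t _ do rewrite -L mulr_suml.
  rewrite exchange_big /=; apply: eq_bigr => s _.
  rewrite (multilinear_expand frame_expand) // mulr_sumr; apply: eq_bigr => t _.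
  by rewrite mulrA; congr (_ * _%:C * _); apply: eq_bigr => i _; rewrite tnth_mktuple.
have -> : alternation f (mktuple e) =
    \sum_(s : 'S_8) (-1) ^+ s * f (map_tuple e [tuple s i | i < 8]).
  apply: eq_bigr => s _; congr (_ * f _).
  apply: eq_from_tnth => i; rewrite [LHS]tnth_mktuple tnth_mktuple [RHS]tnth_map.
  by rewrite tnth_mktuple.
rewrite (alternating_sum_tuple (fun t => f (map_tuple e t))) mulr_sumr.
by apply: eq_bigr => t _; rewrite -mulrA [levi _ _ _ * _]mulrC.
Qed.

End Frame.
End Metric.

(** * 2-forms, their types, and the wedge of two of them *)

Section TwoForms.
Variable R : realType.
Implicit Types (a b : inv_form R 2) (x y z : V8 R).

Definition bilinear2 a := forall z (s : R) x y,
  a [tuple s *: x + y; z] = s%:C * a [tuple x; z] + a [tuple y; z] /\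
  a [tuple z; s *: x + y] = s%:C * a [tuple z; x] + a [tuple z; y].

Lemma tuple2_eta (T : Type) (w : 2.-tuple T) : w = [tuple tnth w ord0; tnth w ord_max].
Proof. by apply: eq_from_tnth => i; case: (ord2P i) => ->. Qed.

Lemma upd2_0 x y z : upd [tuple x; y] ord0 z = [tuple z; y].
Proof. by apply: eq_from_tnth => i; rewrite tnth_mktuple; case: (ord2P i) => ->. Qed.
Lemma upd2_1 x y z : upd [tuple x; y] ord_max z = [tuple x; z].
Proof. by apply: eq_from_tnth => i; rewrite tnth_mktuple; case: (ord2P i) => ->. Qed.

Lemma multilinear2P a : multilinear a <-> bilinear2 a.
Proof.
split=> [ma z s x y|ba v j s x y].
  by split; [have := ma [tuple 0; z] ord0 s x y|have := ma [tuple z; 0] ord_max s x y];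
    rewrite ?(upd2_0, upd2_1).
rewrite [v]tuple2_eta; move: (tnth v _) (tnth v _) => u w.
have [h1 _] := ba u s x y; have [_ h2] := ba w s x y.
by case: (ord2P j) => ->; rewrite ?(upd2_0, upd2_1).
Qed.

Lemma is_form_bilinear a : is_form a -> bilinear2 a.
Proof. by case=> ma _; apply/multilinear2P. Qed.

Lemma bilinear2Dl a x y z : bilinear2 a -> a [tuple x + y; z] = a [tuple x; z] + a [tuple y; z].
Proof. by move/(_ z 1 x y) => [+ _]; rewrite scale1r mul1r. Qed.
Lemma bilinear2Dr a x y z : bilinear2 a -> a [tuple z; x + y] = a [tuple z; x] + a [tuple z; y].
Proof. by move/(_ z 1 x y) => [_]; rewrite scale1r mul1r. Qed.

Lemma bilinear2_0 a z : bilinear2 a -> a [tuple 0; z] = 0 /\ a [tuple z; 0] = 0.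
Proof.
move=> ba; split; [apply: (real_lin0 (f := fun x => a [tuple x; z]))|
  apply: (real_lin0 (f := fun x => a [tuple z; x]))] => s x y; by case: (ba z s x y).
Qed.

Lemma bilinear2Zl a s x z : bilinear2 a -> a [tuple s *: x; z] = s%:C * a [tuple x; z].
Proof.
move=> ba; have [h _] := ba z s x 0.
by rewrite addr0 (bilinear2_0 z ba).1 addr0 in h.
Qed.
Lemma bilinear2Zr a s x z : bilinear2 a -> a [tuple z; s *: x] = s%:C * a [tuple z; x].
Proof.
move=> ba; have [_ h] := ba z s x 0.
by rewrite addr0 (bilinear2_0 z ba).2 addr0 in h.
Qed.
Lemma bilinear2Nr a x z : bilinear2 a -> a [tuple z; - x] = - a [tuple z; x].
Proof. by move=> ba; rewrite -scaleN1r bilinear2Zr // rmorphN mulN1r. Qed.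

Lemma is_form_skew a : is_form a -> skew_form a.
Proof.
move=> fa; have ba := is_form_bilinear fa; case: fa => _ alt u v.
have nul w : a [tuple w; w] = 0 by apply: (alt _ ord0 ord_max).
have := nul (u + v); rewrite bilinear2Dl // !bilinear2Dr // !nul add0r addr0.
by move/eqP; rewrite addr_eq0 => /eqP.
Qed.

Lemma is_form2I a : bilinear2 a -> (forall x, a [tuple x; x] = 0) -> is_form a.
Proof.
move=> ba na; split; first exact/multilinear2P.
move=> v i j ij; rewrite [v]tuple2_eta.
by case: (ord2P i) ij => ->; case: (ord2P j) => -> //= _; rewrite /tnth /= => ->.
Qed.

Lemma sum_set2 (F : {set 'I_2} -> R[i]) :
  \sum_(T : {set 'I_2}) F T =
  F finset.set0 + F [set ord0]%SET + F [set ord_max]%SET + F (finset.setTfor 'I_2).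
Proof.
pose h (p : bool * bool) : {set 'I_2} := [set i : 'I_2 | if i == ord0 then p.1 else p.2]%SET.
rewrite (reindex h) /=; last first.
  exists (fun T : {set 'I_2} => (ord0 \in T, ord_max \in T)) => [[p q]|T] _.
    by rewrite /h !inE.
  by apply/setP => i; rewrite /h inE; case: (ord2P i) => ->.
have -> : \sum_j F (h j) = \sum_(p : bool) \sum_(q : bool) F (h (p, q)).
  by rewrite pair_big; apply: eq_bigr => -[].
rewrite !big_bool /= addrC -addrA addrC -!addrA [RHS]addrC.
rewrite (_ : h (true, true) = finset.setTfor 'I_2); last first.
  by apply/setP => i; rewrite !inE; case: (ord2P i) => ->.
rewrite (_ : h (false, false) = finset.set0); last first.
  by apply/setP => i; rewrite !inE; case: (ord2P i) => ->.
rewrite (_ : h (true, false) = [set ord0]%SET); last first.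
  by apply/setP => i; rewrite !inE; case: (ord2P i) => ->.
rewrite (_ : h (false, true) = [set ord_max]%SET); last first.
  by apply/setP => i; rewrite !inE; case: (ord2P i) => ->.
ring.
Qed.

Variable J : V8 R -> V8 R.

Let of_type_sum a (S : {set 'I_2}) x y :
  let k (i : 'I_2) := if i \in S then - 'i%C else 'i%C : R[i] in
  \sum_(T : {set 'I_2}) (\prod_(j in T) k j) *
      a [tuple if j \in T then J (tnth [tuple x; y] j) else tnth [tuple x; y] j | j < 2]
  = a [tuple x; y] + k ord0 * a [tuple J x; y] + k ord_max * a [tuple x; J y]
    + k ord0 * k ord_max * a [tuple J x; J y].
Proof.
move=> k; rewrite sum_set2 big_set0 !big_set1 mul1r.
rewrite (_ : \prod_(j in _) k j = k ord0 * k ord_max); last first.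
  rewrite (eq_bigl xpredT) => [|i]; last by rewrite !inE.
  by rewrite !big_ord_recl big_ord0 mulr1; congr (_ * k _); apply: val_inj.
by congr (a _ + _ * a _ + _ * a _ + _ * a _); apply: eq_from_tnth => i;
  rewrite tnth_mktuple !inE; case: (ord2P i) => ->.
Qed.

Lemma of_type11P a : @of_type R J 1 1 a <->
  (forall x y, a [tuple J x; J y] = a [tuple x; y] /\
               a [tuple J x; y] = - a [tuple x; J y]).
Proof.
split=> [ta x y|h S v hS].
  have := ta finset.set0 [tuple x; y]; rewrite cards0 => /(_ isT).
  rewrite of_type_sum !inE.
  have := ta (finset.setTfor 'I_2) [tuple x; y]; rewrite cardsT card_ord => /(_ isT).
  rewrite of_type_sum !inE.
  rewrite mulrNN -expr2 sqr_i.
  move: (a _) (a _) (a _) (a _) => s r q p.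
  move=> e1 e2; have i0 : 'i%C != 0 :> R[i] by rewrite -sqrf_eq0 sqr_i oppr_eq0 oner_eq0.
  split.
    have : 2 * (p - s) = 0.
      transitivity (0 + 0 : R[i]); last exact: addr0.
      by rewrite -{1}e1 -e2; ring.
    by move/eqP; rewrite mulf_eq0 pnatr_eq0 /= subr_eq0 => /eqP ->.
  have : 2 * ('i%C * (q + r)) = 0.
    transitivity (0 - 0 : R[i]); last exact: subr0.
    by rewrite -{1}e2 -e1; ring.
  by move/eqP; rewrite !mulf_eq0 pnatr_eq0 (negbTE i0) /= addr_eq0 => /eqP.
rewrite [v]tuple2_eta; move: (tnth v _) (tnth v _) => y x.
rewrite of_type_sum; have [-> ->] := h x y.
have : (ord0 \in S) = (ord_max \in S).
  apply/idP/idP => hi; apply: contraNT hS => hj; apply/eqP/eqP/cards1P.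
    by exists ord0; apply/setP => i; rewrite inE; case: (ord2P i) => ->; rewrite ?hi ?(negbTE hj).
  by exists ord_max; apply/setP => i; rewrite inE; case: (ord2P i) => ->; rewrite ?hi ?(negbTE hj).
move=> ->; case: ifP => _; rewrite ?mulrNN -expr2 sqr_i; ring.
Qed.

(** The three vanishing conditions of type (2,0) (no member, or one member, taken
    from T^(1,0)) are three linear equations in the four values of a. *)
Lemma of_type20P a : @of_type R J 2 0 a ->
  forall x y, a [tuple J x; y] = 'i%C * a [tuple x; y] /\
              a [tuple x; J y] = 'i%C * a [tuple x; y].
Proof.
move=> ta x y.
have := ta finset.set0 [tuple x; y]; rewrite cards0 => /(_ isT).
rewrite of_type_sum !inE -expr2 sqr_i.
have := ta [set ord0]%SET [tuple x; y]; rewrite cards1 => /(_ isT).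
rewrite of_type_sum !inE /= !(mulNr, mulrN) -expr2 sqr_i mulN1r opprK.
have := ta [set ord_max]%SET [tuple x; y]; rewrite cards1 => /(_ isT).
rewrite of_type_sum !inE /= !(mulNr, mulrN) -expr2 sqr_i mulN1r opprK.
move: (a _) (a _) (a _) (a _) => s r q p. move=> e1 e2 e3.
have ii : 'i%C * 'i%C = -1 :> R[i] by rewrite -expr2 sqr_i.
have h (z : R[i]) : 2 * z = 0 -> z = 0 by move/eqP; rewrite mulf_eq0 pnatr_eq0 => /eqP.
have e4 : s = - p.
  apply/eqP; rewrite -addr_eq0; apply/eqP/h; transitivity (0 + 0 : R[i]); last exact: addr0.
  by rewrite -{1}e1 -e2; ring.
have e5 : r = q.
  apply/eqP; rewrite -subr_eq0; apply/eqP/h.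
  transitivity (- ('i%C * 'i%C) * (2 * (r - q))); first by rewrite ii opprK mul1r.
  transitivity (- 'i%C * (0 - 0) : R[i]); last by rewrite subr0 mulr0.
  by rewrite -{1}e2 -e1; ring.
have e6 : q = 'i%C * p.
  apply/eqP; rewrite -subr_eq0; apply/eqP/h.
  transitivity (- 'i%C * (2 * p) - 'i%C * 'i%C * (2 * q)); first by rewrite ii; ring.
  by rewrite -[RHS](mulr0 (- 'i%C)) -e3 e4 e5; ring.
by rewrite e5 e6.
Qed.

End TwoForms.

Section Wedge22.

Fixpoint words (n m : nat) : seq (seq nat) :=
  if m is m'.+1 then [seq x :: t | x <- iota 0 n, t <- words n m'] else [:: [::]].

Lemma sum_words (S : comNzRingType) n m (H : seq nat -> S) :
  \sum_(t : m.-tuple 'I_n) H (map val t) = \sum_(l <- words n m) H l.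
Proof.
elim: m H => [|m IH] H; first by rewrite sum_tuple0 big_seq1.
rewrite sum_tuple_cons big_allpairs_dep /=.
rewrite -(big_mkord xpredT (fun x => \sum_(t : m.-tuple 'I_n) H (x :: map val t))).
rewrite /index_iota subn0; apply: eq_bigr => x _.
exact: (IH (fun t => H (x :: t))).
Qed.

Variable R : realType.
Implicit Types (a b : inv_form R 2).

Lemma wedge22 a b (v : 4.-tuple (V8 R)) : skew_form a -> skew_form b ->
  let A i j := a [tuple nth 0 v i; nth 0 v j] in
  let B i j := b [tuple nth 0 v i; nth 0 v j] in
  wedge_form a b v = A 0%N 1%N * B 2%N 3%N - A 0%N 2%N * B 1%N 3%N + A 0%N 3%N * B 1%N 2%N
   + A 1%N 2%N * B 0%N 3%N - A 1%N 3%N * B 0%N 2%N + A 2%N 3%N * B 0%N 1%N.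
Proof.
move=> sa sb A B; rewrite wedge_alternation.
pose H (l : seq nat) := A (nth 0%N l 0) (nth 0%N l 1) * B (nth 0%N l 2) (nth 0%N l 3).
have -> : alternation (tens a b) v = \sum_(l <- words 4 4) H l * (levi_rec 4 l)%:~R.
  rewrite -(sum_words 4 4 (fun l => H l * (levi_rec 4 l)%:~R)).
  have := alternating_sum_tuple (fun t : 4.-tuple 'I_4 => H (map val t)).
  under [in X in _ = X -> _]eq_bigr => t _ do rewrite levi_recP ?size_map ?size_tuple //.
  move=> <-; apply: eq_bigr => s _; congr (_ * _).
  have nthv k (hk : (k < 4)%N) : nth 0%N (map val [tuple s i | i < 4]) k = s (Ordinal hk).
    rewrite (nth_map ord0) ?size_tuple //.
    by rewrite -(tnth_nth ord0 [tuple s i | i < 4] (Ordinal hk)) tnth_mktuple.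
  rewrite /tens !tuple2P /H /A /B !nthv -!tnth_nth !tnth_mktuple.
  by congr (a [tuple tnth v (s _); tnth v (s _)] * b [tuple tnth v (s _); tnth v (s _)]);
    apply: val_inj.
rewrite (bigID (fun l => levi_rec 4 l == 0)) /= big1 ?add0r => [|l /eqP ->]; last by rewrite mulr0.
rewrite -big_filter.
have -> : [seq i <- words 4 4 | levi_rec 4 i != 0] = 
 [:: [:: 0; 1; 2; 3]; [:: 0; 1; 3; 2]; [:: 0; 2; 1; 3]; [:: 0; 2; 3; 1]; [:: 0; 3; 1; 2]; [:: 0; 3; 2; 1];
 [:: 1; 0; 2; 3]; [:: 1; 0; 3; 2]; [:: 1; 2; 0; 3]; [:: 1; 2; 3; 0]; [:: 1; 3; 0; 2]; [:: 1; 3; 2; 0];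
 [:: 2; 0; 1; 3]; [:: 2; 0; 3; 1]; [:: 2; 1; 0; 3]; [:: 2; 1; 3; 0]; [:: 2; 3; 0; 1]; [:: 2; 3; 1; 0];
 [:: 3; 0; 1; 2]; [:: 3; 0; 2; 1]; [:: 3; 1; 0; 2]; [:: 3; 1; 2; 0]; [:: 3; 2; 0; 1]; [:: 3; 2; 1; 0]]%N.
  by vm_compute.
have sA i j : A i j = - A j i by apply: sa.
have sB i j : B i j = - B j i by apply: sb.
rewrite !big_cons big_nil /H /= /levi_rec /=.
rewrite (sA 1%N 0%N) (sA 2%N 0%N) (sA 3%N 0%N) (sA 2%N 1%N) (sA 3%N 1%N) (sA 3%N 2%N).
rewrite (sB 1%N 0%N) (sB 2%N 0%N) (sB 3%N 0%N) (sB 2%N 1%N) (sB 3%N 1%N) (sB 3%N 2%N).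
rewrite (_ : 2`! = 2%N) // !opprK; by field.
Qed.

End Wedge22.

(** * Norms of forms and unitary frames *)

Section SqNorm.
Variable R : realType.
Implicit Types z w : R[i].

Definition sqnorm z : R := complex.Re z ^+ 2 + complex.Im z ^+ 2.

Lemma sqnormE z : z * conjc z = (sqnorm z)%:C.
Proof.
case: z => a b; rewrite /sqnorm /=; apply/eqP; rewrite eq_complex /=.
by apply/andP; split; apply/eqP; ring.
Qed.
Lemma sqnormM z w : sqnorm (z * w) = sqnorm z * sqnorm w.
Proof. by case: z => a b; case: w => a' b'; rewrite /sqnorm /=; ring. Qed.
Lemma sqnorm_ge0 z : 0 <= sqnorm z.
Proof. by rewrite addr_ge0 ?sqr_ge0. Qed.
Lemma sqnorm_eq0 z : sqnorm z = 0 -> z = 0.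
Proof.
case: z => a b; rewrite /sqnorm /= => /eqP; rewrite paddr_eq0 ?sqr_ge0 //.
by rewrite !sqrf_eq0 => /andP [/eqP -> /eqP ->].
Qed.
Lemma sqnormi : sqnorm 'i%C = 1.
Proof. by rewrite /sqnorm /= expr0n add0r expr1n. Qed.
Lemma sqnormR (x : R) : sqnorm x%:C = x ^+ 2.
Proof. by rewrite /sqnorm /= expr0n addr0. Qed.
Lemma sqnormN z : sqnorm (- z) = sqnorm z.
Proof. by case: z => a b; rewrite /sqnorm /= !sqrrN. Qed.
Lemma sqnorm0 : sqnorm 0 = 0.
Proof. by rewrite -[0]/(0%:C) sqnormR expr0n. Qed.

End SqNorm.

Section FormNorm.
Variables (R : realType) (g : V8 R -> V8 R -> R).
Hypothesis hg : scalar_product g.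
Variables (e : 'I_8 -> V8 R) (he : orthonormal_frame g e).

Lemma fnorm_frame k (al : inv_form R k) : multilinear al ->
  fnorm g al ^+ 2 = (k`!%:R)^-1 * \sum_(t : k.-tuple 'I_8) sqnorm (al (map_tuple e t)).
Proof.
move=> mal; have E : finner g al al =
    ((k`!%:R)^-1 * \sum_(t : k.-tuple 'I_8) sqnorm (al (map_tuple e t)))%:C.
  rewrite (finner_frame hg he) // rmorphM fmorphV rmorph_nat rmorph_sum /=; congr (_ * _).
  by apply: eq_bigr => t _; rewrite sqnormE.
rewrite /fnorm E /= sqr_sqrtr // mulr_ge0 ?invr_ge0 ?ler0n // sumr_ge0 // => t _.
exact: sqnorm_ge0.
Qed.

Lemma fnorm2_frame (a : inv_form R 2) : bilinear2 a ->
  fnorm g a ^+ 2 = 2^-1 * \sum_p \sum_q sqnorm (a [tuple e p; e q]).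
Proof.
move=> /multilinear2P ma; rewrite fnorm_frame //; congr (_ * _).
do 2!(rewrite sum_tuple_cons; apply: eq_bigr => ? _).
rewrite sum_tuple0; congr (sqnorm (a _)); exact: val_inj.
Qed.

Lemma fnorm4_frame (a : inv_form R 4) : multilinear a ->
  fnorm g a ^+ 2 = 24^-1 * \sum_p \sum_q \sum_r \sum_s sqnorm (a [tuple e p; e q; e r; e s]).
Proof.
move=> ma; rewrite fnorm_frame //; congr (_ * _).
do 4!(rewrite sum_tuple_cons; apply: eq_bigr => ? _).
rewrite sum_tuple0; congr (sqnorm (a _)); exact: val_inj.
Qed.

Lemma riesz2 (a : inv_form R 2) : bilinear2 a ->
  exists K : {linear V8 R -> V8 R}, forall x y, complex.Re (a [tuple x; y]) = g (K x) y.
Proof.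
move=> ba; pose phi x y := complex.Re (a [tuple x; y]).
have phil (s : R) x y z : phi (s *: x + y) z = s * phi x z + phi y z.
  rewrite /phi; have [-> _] := ba z s x y.
  by case: (a _) => ? ?; case: (a _) => ? ? /=; rewrite mul0r subr0.
have phir (s : R) x y z : phi z (s *: x + y) = s * phi z x + phi z y.
  rewrite /phi; have [_ ->] := ba z s x y.
  by case: (a _) => ? ?; case: (a _) => ? ? /=; rewrite mul0r subr0.
have sum_lin (f : V8 R -> R) (I : finType) (s : I -> R) (x : I -> V8 R) :
    (forall (s : R) x y, f (s *: x + y) = s * f x + f y) ->
    f (\sum_i s i *: x i) = \sum_i s i * f (x i).
  move=> lf; have f0 : f 0 = 0 by have := lf 1 0 0; rewrite scaler0 addr0 mul1r; lra.
  elim/big_rec2: _ => [//|i u v _ <-]; first by rewrite lf.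
pose M := \matrix_(j < 8) \sum_p phi (bvec R j) (e p) *: e p.
exists (mulmxr M) => x y /=; rewrite -/(phi x y).
rewrite {1}(bvec_sum x) (sum_lin (phi ^~ y)) //.
rewrite mulmx_sum_row sp_suml //; apply: eq_bigr => j _.
rewrite spZl // rowK sp_suml // {1}(frame_expand hg he y) (sum_lin (phi (bvec R j))) //.
by congr (_ * _); apply: eq_bigr => p _; rewrite spZl // (sp_sym hg y) mulrC.
Qed.

Lemma parseval x y : g x y = \sum_p g x (e p) * g y (e p).
Proof.
rewrite {1}(frame_expand hg he y) sp_sumr //; apply: eq_bigr => p _.
by rewrite spZr // mulrC.
Qed.

End FormNorm.

Section Kaehler.
Variables (R : realType) (g : V8 R -> V8 R -> R) (J : {linear V8 R -> V8 R}).
Hypotheses (hg : scalar_product g) (JJ : forall x, J (J x) = - x).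
Hypothesis gJJ : forall x y, g (J x) (J y) = g x y.

Lemma J_skew x y : g (J x) y = - g x (J y).
Proof. by rewrite -[in RHS](gJJ x) JJ spNr // opprK. Qed.

Lemma g_J x : g x (J x) = 0.
Proof. by have := J_skew x x; rewrite sp_sym //; lra. Qed.

Lemma exists_unitary_frame : exists f : 'I_4 -> V8 R,
  forall i j, g (f i) (f j) = (i == j)%:R /\ g (f i) (J (f j)) = 0.
Proof.
have [//|f hf] := @exists_orthogonal_orbits R g hg 2
  (fun i => if i == ord0 then id else J) 4.
have lt (i j : 'I_4) : (j < i)%N -> g (f i) (f j) = 0 /\ g (f i) (J (f j)) = 0.
  move=> ji; have [_ h] := hf i (ltn_ord i); have h' := h j ji.
  by split; [exact: (h' ord0)|exact: (h' ord_max)].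
exists (fun i => f i) => i j; have [ij|ji|/val_inj ->] := ltngtP i j.
- have [h1 h2] := lt j i ij; rewrite sp_sym // h1.
  have -> : (i == j) = false by apply/negbTE; rewrite neq_ltn ij.
  by split=> //; rewrite -[RHS]oppr0 -h2 -J_skew sp_sym.
- have [h1 h2] := lt i j ji; rewrite h1 h2.
  by have -> : (i == j) = false by apply/negbTE; rewrite neq_ltn ji orbT.
by have [-> _] := hf j (ltn_ord j); rewrite eqxx g_J.
Qed.

Definition unitary_frame (f : 'I_4 -> V8 R) (p : 'I_(4 + 4)) : V8 R :=
  match fintype.split p with inl i => f i | inr i => J (f i) end.

Lemma unitary_frame_orthonormal f :
  (forall i j, g (f i) (f j) = (i == j)%:R /\ g (f i) (J (f j)) = 0) ->
  orthonormal_frame g (unitary_frame f).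
Proof.
move=> hf p q; rewrite /unitary_frame.
case: (split_ordP (p : 'I_(4 + 4))) => i ->; case: (split_ordP (q : 'I_(4 + 4))) => j ->; rewrite ?split_lshiftE ?split_rshiftE
  ?eq_lshift ?eq_rshift ?eq_lrshift ?eq_rlshift ?gJJ; have [h1 h2] := hf i j => //.
  by rewrite h2 (_ : (_ == _) = false) //; exact: eq_lrshift.
have [_ h3] := hf j i; rewrite sp_sym // h3 (_ : (_ == _) = false) //.
exact: (eq_rlshift (m := 4) (n := 4)).
Qed.

Lemma sum_unitary_frame (S : nmodType) f (F : V8 R -> S) :
  \sum_(p < 8) F (unitary_frame f p) = \sum_(i < 4) (F (f i) + F (J (f i))).
Proof.
transitivity (\sum_(p < 4 + 4) F (unitary_frame f p)); first by [].
rewrite big_split_ord big_split /=; congr (_ + _).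
  by apply: eq_bigr => i _; rewrite /unitary_frame split_lshiftE.
by apply: eq_bigr => i _; rewrite /unitary_frame split_rshiftE.
Qed.

Lemma exists_orthonormal : exists e, orthonormal_frame g e.
Proof.
have [f hf] := exists_unitary_frame.
by exists (unitary_frame f); exact: unitary_frame_orthonormal.
Qed.

End Kaehler.

(** * The normalisation of c makes K conformal *)

Section AlternationLevi.
Variable R : realType.

Lemma alternation_repeat n (f : inv_form R n) (w : n.-tuple (V8 R)) (i j : 'I_n) :
  i != j -> tnth w i = tnth w j -> alternation f w = 0.
Proof.
move=> ij wij; have pw : ptuple w (tperm i j) = w.
  apply: eq_from_tnth => k; rewrite tnth_mktuple.
  by case: tpermP => [->|->|].
have : alternation f w = - alternation f w.
  rewrite -{1}pw {1}/alternation.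
  under eq_bigr => s _ do rewrite ptupleM.
  rewrite (reindex_inj (mulIg (tperm i j))) /= /alternation -sumrN.
  apply: eq_bigr => s _; rewrite -mulgA tperm2 mulg1 odd_permM odd_tperm ij.
  by rewrite addbT signrN mulNr.
move=> h; have : 2 * alternation f w = 0 by rewrite mulr_natl mulr2n {1}h addNr.
by move/eqP; rewrite mulf_eq0 pnatr_eq0 => /eqP.
Qed.

Lemma alternation_reindex n (f : inv_form R n) (v : n.-tuple (V8 R)) (t : n.-tuple 'I_n) :
  alternation f [tuple tnth v (tnth t i) | i < n] = levi _ n (map val t) * alternation f v.
Proof.
have [inj|] := boolP (injectiveb (tnth t)).
  have /injectiveP injt := inj; pose s := perm injt.
  have -> : [tuple tnth v (tnth t i) | i < n] = ptuple v s.
    by apply: eq_from_tnth => i; rewrite !tnth_mktuple permE.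
  have -> : levi R[i] n (map val t) = (-1) ^+ s.
    rewrite -det_perm; congr (\det _); apply/matrixP => i j; rewrite !mxE permE.
    by rewrite (nth_map (tnth t i)) ?size_tuple // -tnth_nth.
  rewrite {1}/alternation.
  under eq_bigr => u _ do rewrite ptupleM.
  rewrite (reindex_inj (mulIg s^-1%g)) /= /alternation mulr_sumr.
  apply: eq_bigr => u _; rewrite -mulgA mulVg mulg1 odd_permM odd_permV.
  by rewrite addbC signr_addb mulrA.
move=> /injectivePn [i [j ij tij]].
rewrite (alternation_repeat _ ij) ?tnth_mktuple ?tij //.
rewrite (_ : levi _ _ _ = 0) ?mul0r //; apply: (determinant_alternate ij) => k.
by rewrite !mxE !(nth_map (tnth t i)) ?size_tuple // -!tnth_nth tij.
Qed.

End AlternationLevi.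

Section Pfaffian.
Variable R : realType.

(** Equality case of |x|^2 + |y|^2 >= 2 |x . y|: the difference of the squares of
    the two sides is (|x|^2 - |y|^2)^2 plus the Lagrange sum of the 2x2 minors of
    x and the conjugate of y, so both vanish and y is a unit multiple of the
    conjugate of x. *)
Lemma cauchy_equality (x y : 'I_3 -> R[i]) :
  (\sum_i sqnorm (x i) + \sum_i sqnorm (y i)) ^+ 2 = 4 * sqnorm (\sum_i x i * y i) ->
  forall i j, x i * conjc (y j) = x j * conjc (y i) /\
              x i * conjc (x j) = y j * conjc (y i).
Proof.
set X := \sum_i sqnorm (x i); set Y := \sum_i sqnorm (y i) => h.
have X0 : 0 <= X by apply: sumr_ge0 => i _; exact: sqnorm_ge0.
pose T := \sum_i \sum_j sqnorm (x i * conjc (y j) - x j * conjc (y i)).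
have T0 : 0 <= T by do 2!(apply: sumr_ge0 => ? _); exact: sqnorm_ge0.
have E : (X - Y) ^+ 2 + 2 * T = 0.
  transitivity ((X + Y) ^+ 2 - 4 * sqnorm (\sum_i x i * y i)); last by rewrite h subrr.
  rewrite /X /Y /T !big_ord_recl !big_ord0 !addr0.
  move: (x _) (x _) (x _) (y _) (y _) (y _) => [a1 b1] [a2 b2] [a3 b3] [a4 b4] [a5 b5] [a6 b6].
  by rewrite /sqnorm /=; ring.
have XY : X = Y.
  apply/eqP; rewrite -subr_eq0 -sqrf_eq0; apply/eqP.
  by have := sqr_ge0 (X - Y); lra.
have Tz : T = 0 by have := sqr_ge0 (X - Y); lra.
have r i j : x i * conjc (y j) = x j * conjc (y i).
  apply/eqP; rewrite -subr_eq0; apply/eqP/sqnorm_eq0.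
  have := Tz; rewrite /T => /eqP; rewrite psumr_eq0; last first.
    by move=> k _; apply: sumr_ge0 => l _; exact: sqnorm_ge0.
  move=> /allP /(_ i (mem_index_enum _)) /=; rewrite psumr_eq0; last first.
    by move=> l _; exact: sqnorm_ge0.
  by move=> /allP /(_ j (mem_index_enum _)) /= /eqP.
move=> i j; split; first exact: r.
have zero (z : 'I_3 -> R[i]) k : \sum_i sqnorm (z i) = 0 -> z k = 0.
  move/eqP; rewrite psumr_eq0; last by move=> l _; exact: sqnorm_ge0.
  by move=> /allP /(_ k (mem_index_enum _)) /= /eqP /sqnorm_eq0.
have [X00|Xn0] := eqVneq X 0.
  rewrite (zero x i) // (zero y j) ?mul0r //; by rewrite -/Y -XY.
have XC : \sum_k x k * conjc (x k) = X%:C.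
  by rewrite rmorph_sum; apply: eq_bigr => k _; rewrite sqnormE.
have YC : \sum_k y k * conjc (y k) = X%:C.
  by rewrite XY rmorph_sum; apply: eq_bigr => k _; rewrite sqnormE.
apply: (mulIf (x := X%:C)); first by rewrite (fmorph_eq0 (real_complex R)).
rewrite -{1}YC -XC !mulr_sumr; apply: eq_bigr => k _.
have rc : conjc (x j) * y k = conjc (x k) * y j.
  by have := congr1 conjc (r j k); rewrite !rmorphM /= !conjcK.
transitivity ((x i * conjc (y k)) * (conjc (x j) * y k)); first ring.
by rewrite r rc; ring.
Qed.

End Pfaffian.

(* Closes z = w when z - w is, up to sign, the difference of the sides of r. *)
Ltac close_by r := lazymatch type of r with ?a = ?b =>
  first [by transitivity (a - b); [ring|rewrite r; ring]
        |by transitivity (b - a); [ring|rewrite r; ring]] end.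

Section Conformal.
Variables (R : realType) (g : V8 R -> V8 R -> R) (J : {linear V8 R -> V8 R}).
Hypotheses (hg : scalar_product g) (JJ : forall x, J (J x) = - x).
Hypothesis gJJ : forall x y, g (J x) (J y) = g x y.
Variables (c : inv_form R 2) (th : inv_form R 4).
Hypotheses (fc : is_form c) (hth : is_form th) (nth4 : fnorm g th = 4).
Hypothesis cJ : forall x y, c [tuple J x; y] = 'i%C * c [tuple x; y] /\
                            c [tuple x; J y] = 'i%C * c [tuple x; y].
Hypothesis ccth : forall v, wedge_form c c v = (fnorm g c ^+ 2 / 4)%:C * th v.

Let bc : bilinear2 c := is_form_bilinear fc.
Let sc : skew_form c := is_form_skew fc.
Let n := fnorm g c ^+ 2.

Section Gram.
Variable f : 'I_4 -> V8 R.
Hypothesis hf : forall i j, g (f i) (f j) = (i == j)%:R /\ g (f i) (J (f j)) = 0.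

Let e := unitary_frame J f.
Let he : orthonormal_frame g e := unitary_frame_orthonormal hg gJJ hf.

Lemma sum_unitary_frame_J (F : V8 R -> R) : (forall x, F (J x) = F x) ->
  \sum_(p < 8) F (e p) = 2 * \sum_i F (f i).
Proof.
move=> FJ; rewrite sum_unitary_frame mulr_sumr; apply: eq_bigr => i _.
by rewrite FJ mulr_natl mulr2n.
Qed.

Let sqi (z : R[i]) : sqnorm ('i%C * z) = sqnorm z.
Proof. by rewrite sqnormM sqnormi mul1r. Qed.

Lemma fnorm2_unitary : n = 2 * \sum_i \sum_j sqnorm (c [tuple f i; f j]).
Proof.
rewrite /n (fnorm2_frame hg he bc).
rewrite (sum_unitary_frame_J (F := fun x => \sum_q sqnorm (c [tuple x; e q]))); last first.
  by move=> x; apply: eq_bigr => q _; rewrite (cJ _ _).1 sqi.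
rewrite mulrA mulVf ?mul1r ?pnatr_eq0 // mulr_sumr; apply: eq_bigr => i _.
by rewrite (sum_unitary_frame_J (F := fun x => sqnorm (c [tuple f i; x]))) // => x; rewrite (cJ _ _).2 sqi.
Qed.

Let W x y z w := wedge_form c c [tuple x; y; z; w].
Let WE x y z w : W x y z w = 2 * (c [tuple x; y] * c [tuple z; w]
    - c [tuple x; z] * c [tuple y; w] + c [tuple x; w] * c [tuple y; z]).
Proof. by rewrite /W (wedge22 _ sc sc) /=; ring. Qed.

Let WJ x y z w : [/\ sqnorm (W (J x) y z w) = sqnorm (W x y z w),
    sqnorm (W x (J y) z w) = sqnorm (W x y z w),
    sqnorm (W x y (J z) w) = sqnorm (W x y z w) &
    sqnorm (W x y z (J w)) = sqnorm (W x y z w)].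
Proof.
split; rewrite -[RHS]sqi; congr sqnorm; rewrite !WE ?(fun a b => (cJ a b).1) ?(fun a b => (cJ a b).2); ring.
Qed.

Let sum_sqW : \sum_i \sum_j \sum_k \sum_l sqnorm (W (f i) (f j) (f k) (f l)) =
    24 * sqnorm (W (f (inord 0)) (f (inord 1)) (f (inord 2)) (f (inord 3))).
Proof.
transitivity (\sum_(t : 4.-tuple 'I_4) sqnorm (wedge_form c c [tuple f (tnth t i) | i < 4])).
  do 4!(rewrite sum_tuple_cons; apply: eq_bigr => ? _).
  rewrite sum_tuple0; congr (sqnorm (wedge_form c c _)).
  by apply: eq_from_tnth => -[[|[|[|[|]]]]] //= hi; rewrite tnth_mktuple (tnth_nth 0) (tnth_nth ord0).
pose v : 4.-tuple (V8 R) := [tuple f (inord 0); f (inord 1); f (inord 2); f (inord 3)].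
have vE i : tnth v i = f i.
  rewrite (tnth_nth 0) /=; case: i => [[|[|[|[|]]]]] //= hi; congr f; apply: val_inj;
  by rewrite /= inordK.
pose H (l : seq nat) : R := ((levi_rec 4 l) ^+ 2)%:~R.
transitivity (\sum_(t : 4.-tuple 'I_4) H (map val t) * sqnorm (wedge_form c c v)).
  apply: eq_bigr => t _; rewrite !wedge_alternation.
  have -> : [tuple f (tnth t i) | i < 4] = [tuple tnth v (tnth t i) | i < 4].
    by apply: eq_from_tnth => i; rewrite !tnth_mktuple vE.
  rewrite alternation_reindex levi_recP ?size_map ?size_tuple // mulrCA sqnormM; congr (_ * _).
  by rewrite /H rmorphXn /= -(rmorph_int (real_complex R)) sqnormR.
rewrite -mulr_suml sum_words /H -rmorph_sum /=; congr (_ * _).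
have -> : \sum_(l <- words 4 4) levi_rec 4 l ^+ 2 = 24%:Z; last by [].
by rewrite unlock; vm_compute.
Qed.

(** With c /\ c = |c|^2 theta / 4 and |theta| = 4 the norm of c /\ c is |c|^2.
    As c /\ c has type (4,0), only its value on the four frame vectors matters,
    and this value is twice the Pfaffian of c. *)
Lemma pfaffian_norm : (n / 4) ^+ 2 =
   sqnorm (W (f (inord 0)) (f (inord 1)) (f (inord 2)) (f (inord 3))).
Proof.
have := fnorm4_frame hg he (proj1 hth); rewrite nth4 => th16.
apply: (@mulIf _ (24 * 16)); first by rewrite mulf_neq0 ?pnatr_eq0.
transitivity (16 * (24 * sqnorm (W (f (inord 0)) (f (inord 1)) (f (inord 2)) (f (inord 3)))));
  last by ring.
rewrite -sum_sqW.
transitivity (\sum_p \sum_q \sum_r \sum_s sqnorm (W (e p) (e q) (e r) (e s))).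
  transitivity ((n / 4) ^+ 2 * (24 * 4 ^+ 2)); first by congr (_ * (_ * _)); ring.
  rewrite th16 mulVKf ?pnatr_eq0 // mulr_sumr.
  do 3!(apply: eq_bigr => ? _; rewrite mulr_sumr); apply: eq_bigr => ? _.
  by rewrite /W ccth sqnormM sqnormR.
rewrite (sum_unitary_frame_J (F := fun x => \sum_q \sum_r \sum_s sqnorm (W x (e q) (e r) (e s))));
  last by move=> x; apply: eq_bigr => q _; apply: eq_bigr => r _; apply: eq_bigr => s _;
     case: (WJ x (e q) (e r) (e s)).
rewrite !mulr_sumr; apply: eq_bigr => i _.
rewrite (sum_unitary_frame_J (F := fun x => \sum_r \sum_s sqnorm (W (f i) x (e r) (e s))));
  last by move=> x; apply: eq_bigr => r _; apply: eq_bigr => s _; case: (WJ (f i) x (e r) (e s)).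
rewrite !mulr_sumr; apply: eq_bigr => j _.
rewrite (sum_unitary_frame_J (F := fun x => \sum_s sqnorm (W (f i) (f j) x (e s))));
  last by move=> x; apply: eq_bigr => s _; case: (WJ (f i) (f j) x (e s)).
rewrite !mulr_sumr; apply: eq_bigr => k _.
rewrite (sum_unitary_frame_J (F := fun x => sqnorm (W (f i) (f j) (f k) x)));
  last by move=> x; case: (WJ (f i) (f j) (f k) x).
by rewrite !mulr_sumr; apply: eq_bigr => l _; ring.
Qed.

(** In a unitary frame c is a skew matrix C with entries c_ij, and
    [pfaffian_norm] is equality in [cauchy_equality] for x = (c_01, c_02, c_03)
    and y = (c_23, -c_13, c_12). The relations between x and y say that the rows
    of C are orthogonal and of equal length. *)
Lemma conformal_gram i j :
  \sum_k c [tuple f i; f k] * conjc (c [tuple f j; f k]) = (n / 8 * (i == j)%:R)%:C.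
Proof.
pose C (a b : nat) := c [tuple f (inord a); f (inord b)].
have CE (a b : 'I_4) : c [tuple f a; f b] = C a b by rewrite /C !inord_val.
have C0 a : C a a = 0.
  by have := sc (f (inord a)) (f (inord a)); rewrite -/(C a a) => /eqP;
     rewrite -addr_eq0 -mulr2n -mulr_natl mulf_eq0 pnatr_eq0 => /eqP.
have CN a b : C a b = - C b a by apply: sc.
pose x (k : 'I_3) := nth 0 [:: C 0%N 1%N; C 0%N 2%N; C 0%N 3%N] k.
pose y (k : 'I_3) := nth 0 [:: C 2%N 3%N; - C 1%N 3%N; C 1%N 2%N] k.
have nE : n / 4 = \sum_i sqnorm (x i) + \sum_i sqnorm (y i).
  rewrite fnorm2_unitary; under eq_bigr => a _ do under eq_bigr => b _ do rewrite CE.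
  rewrite !big_ord_recl !big_ord0 /bump /x /y /= !C0 sqnorm0 sqnormN.
  rewrite (CN 1%N 0%N) (CN 2%N 0%N) (CN 3%N 0%N) (CN 2%N 1%N) (CN 3%N 1%N) (CN 3%N 2%N) !sqnormN.
  by field.
have := pfaffian_norm; rewrite WE -/(C 0%N 1%N) -/(C 2%N 3%N) -/(C 0%N 2%N)
  -/(C 1%N 3%N) -/(C 0%N 3%N) -/(C 1%N 2%N) nE.
have -> : 2 * (C 0%N 1%N * C 2%N 3%N - C 0%N 2%N * C 1%N 3%N + C 0%N 3%N * C 1%N 2%N)
   = 2 * \sum_k x k * y k.
  by rewrite !big_ord_recl big_ord0 /x /y /=; ring.
rewrite sqnormM (_ : sqnorm 2 = 4); last by rewrite -(rmorph_nat (real_complex R)) sqnormR; ring.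
move/cauchy_equality => rel.
have o3 (k : nat) : (k < 3)%N -> 'I_3 by exact: Ordinal.
have r01 := rel (inord 0) (inord 1); have r02 := rel (inord 0) (inord 2).
have r12 := rel (inord 1) (inord 2); have r00 := rel (inord 0) (inord 0).
have r11 := rel (inord 1) (inord 1); have r22 := rel (inord 2) (inord 2).
move: r01 r02 r12 r00 r11 r22; rewrite /x /y !inordK //= !rmorphN /=.
move=> [r01 s01] [r02 s02] [r12 s12] [_ s00] [_ s11] [_ s22].
have nC : (n / 8)%:C = C 0%N 1%N * conjc (C 0%N 1%N) + C 0%N 2%N * conjc (C 0%N 2%N)
     + C 0%N 3%N * conjc (C 0%N 3%N).
  have -> : n / 8 = (n / 4) / 2 by field.
  have sumR (a1 a2 a3 b1 b2 b3 : R) : ((a1 + (a2 + a3) + (b1 + (b2 + b3))) / 2)%:C =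
      (a1%:C + (a2%:C + a3%:C) + (b1%:C + (b2%:C + b3%:C))) / 2.
    by rewrite rmorphM !rmorphD fmorphV rmorph_nat.
  rewrite nE /x /y !big_ord_recl !big_ord0 /= !addr0 sumR -!sqnormE.
  by rewrite rmorphN -s00 -s11 -s22; field.
rewrite rmorphM rmorph_nat /= nC.
have conj_eq (a b : R[i]) : a = b -> conjc a = conjc b by move=> ->.
have := conj_eq _ _ r01; have := conj_eq _ _ r02; have := conj_eq _ _ r12.
have := conj_eq _ _ s01; have := conj_eq _ _ s02; have := conj_eq _ _ s12.
rewrite !(rmorphM, rmorphN) /= !conjcK => s12' s02' s01' r12' r02' r01'.
under eq_bigr => k _ do rewrite !CE.
rewrite !big_ord_recl big_ord0 /=.
rewrite -[bump 0 0]/1%N -[bump 0 1]/2%N -[bump 0 2]/3%N.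
have CC := (CN 1%N 0%N, CN 2%N 0%N, CN 3%N 0%N, CN 2%N 1%N, CN 3%N 1%N, CN 3%N 2%N, C0 0%N, C0 1%N, C0 2%N, C0 3%N).
case: i => [[|[|[|[|]]]]] //= hi; case: j => [[|[|[|[|]]]]] //= hj;
  rewrite ?CC ?rmorphN ?rmorph0 ?rmorph1 /=;
  first [by do ?rewrite mulrNN; rewrite ?s00 ?s11 ?s22; ring | close_by r01 | close_by r02 | close_by r12
   | close_by s01 | close_by s02 | close_by s12 | close_by r01' | close_by r02' | close_by r12'
   | close_by s01' | close_by s02' | close_by s12' ].
Qed.

End Gram.

(** For the real part of c, written g(Kx, y), this is K^2 = - |c|^2 / 8. *)
Lemma conformal (K : {linear V8 R -> V8 R}) :
  (forall x y, complex.Re (c [tuple x; y]) = g (K x) y) ->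
  forall x y, g (K x) (K y) = n / 8 * g x y.
Proof.
move=> hK; have [f hf] := exists_unitary_frame hg JJ gJJ.
have he := unitary_frame_orthonormal hg gJJ hf.
set e := unitary_frame J f in he.
have gK x y : g (K x) (K y) =
    complex.Re (\sum_k c [tuple x; f k] * conjc (c [tuple y; f k])).
  rewrite (parseval hg he) (sum_unitary_frame _ _ (fun z => g (K x) z * g (K y) z)).
  rewrite raddf_sum; apply: eq_bigr => k _; rewrite -!hK (cJ x _).2 (cJ y _).2.
  by case: (c _) => ? ?; case: (c _) => ? ? /=; ring.
have gram := conformal_gram hf.
have gKe p q : g (K (e p)) (K (e q)) = n / 8 * (p == q)%:R.
  rewrite -he gK /e /unitary_frame.
  have S1 u v : \sum_k c [tuple J u; f k] * conjc (c [tuple v; f k]) =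
      'i%C * \sum_k c [tuple u; f k] * conjc (c [tuple v; f k]).
    by rewrite mulr_sumr; apply: eq_bigr => k _; rewrite (cJ _ _).1 mulrA.
  have S2 u v : \sum_k c [tuple u; f k] * conjc (c [tuple J v; f k]) =
      - 'i%C * \sum_k c [tuple u; f k] * conjc (c [tuple v; f k]).
    rewrite mulr_sumr; apply: eq_bigr => k _; rewrite (cJ _ _).1 rmorphM /=.
    rewrite mulrCA; congr (_ * _); apply/eqP; rewrite eq_complex /= oppr0; exact/andP.
  case: (fintype.split _) => i; case: (fintype.split _) => j; rewrite ?S1 ?S2 gram.
  - by rewrite (hf i j).1.
  - by rewrite (hf i j).2 /=; ring.
  - by rewrite (sp_sym hg) (hf j i).2 /=; ring.
  - by rewrite gJJ (hf i j).1 /=; ring.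
move=> x y; rewrite {1}(frame_expand hg he x) {1}(frame_expand hg he y) !linear_sum.
rewrite sp_suml // (parseval hg he x y) mulr_sumr; apply: eq_bigr => p _.
rewrite sp_sumr // (bigD1 p) //= big1 => [|q /negbTE qp].
  rewrite !linearZ /= spZl // spZr // gKe eqxx mulr1n; ring.
by rewrite !linearZ /= spZl // spZr // gKe eq_sym qp mulr0n; ring.
Qed.

End Conformal.

(** * The symmetric product of four 2-forms; quaternionic matrices *)

Section WedgeFour.
Variable R : realType.
Implicit Types (a b c d x y : inv_form R 2).

Lemma wedge_form_wedge4 a b c d v :
  wedge_form (wedge_form a b) (wedge_form c d) v = wedge4 a b c d v.
Proof.
rewrite wedge_assocr.
have -> : tens (wedge_form a b) (tens c d) = fun w => ((2`!)%:R^-1 * (2`!)%:R^-1) *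
    tens (alternation (tens a b)) (tens c d) w.
  rewrite -tensZl; congr (tens _ _); apply/funext => w; exact: wedge_alternation.
rewrite alternationZ alternation_tensl -tens4E /wedge4.
rewrite (_ : 2`! = 2%N) // (_ : (2 + 2)`! = 24%N) //.
by move: (alternation _ _) => z; field.
Qed.

Lemma wedge_form3_wedge4 a b c d v :
  wedge_form a (wedge_form b (wedge_form c d)) v = wedge4 a b c d v.
Proof.
rewrite wedge_assocr.
have -> : tens a (tens b (wedge_form c d)) = fun w => ((2`!)%:R^-1 * (2`!)%:R^-1) *
    tens a (tens b (alternation (tens c d))) w.
  rewrite -tensZr -tensZr; congr (tens _ (tens _ _)); apply/funext => w; exact: wedge_alternation.
rewrite alternationZ.
have -> : alternation (tens a (tens b (alternation (tens c d)))) v =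
   (4`!)%:R * alternation (tens a (tens b (tens c d))) v.
  have := factC_neq0 R 6 => f6.
  apply: (mulfI f6).
  rewrite -(alternation_tensr a (tens b (alternation (tens c d)))).
  rewrite mulrCA -(alternation_tensr a (tens b (tens c d))).
  have -> : alternation (tens b (alternation (tens c d))) =
    fun w => (4`!)%:R * alternation (tens b (tens c d)) w.
    by apply/funext => w; exact: alternation_tensr.
  by rewrite tensZr alternationZ.
rewrite -tens4E' /wedge4.
rewrite (_ : 2`! = 2%N) // (_ : 4`! = 24%N) //.
by move: (alternation _ _) => z; field.
Qed.

Lemma alternationD n (f h : inv_form R n) v :
  alternation (fun w => f w + h w) v = alternation f v + alternation h v.
Proof. by rewrite /alternation -big_split; apply: eq_bigr => s _; rewrite mulrDr. Qed.


Lemma tperm_inord i j k : (i < 8)%N -> (j < 8)%N -> (k < 8)%N ->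
  tperm (inord i) (inord j) (inord k : 'I_8) =
  inord (if k == i then j else if k == j then i else k)%N.
Proof.
move=> hi hj hk; rewrite permE /= -!val_eqE /= !inordK //.
by case: ifP => // _; case: ifP.
Qed.

(** Exchanging two of the 2-forms permutes their arguments by a product of two
    transpositions. *)
Lemma wedge4_swap34 a b c d v : wedge4 a b c d v = wedge4 a b d c v.
Proof.
pose s : 'S_8 := (tperm (inord 4) (inord 6) * tperm (inord 5) (inord 7))%g.
congr (_ * _); transitivity (alternation (fun w => tens4 a b d c (ptuple w s)) v); last first.
  rewrite alternation_perm odd_permM !odd_tperm -!val_eqE /= !inordK //=.
  by rewrite expr0 mul1r.
congr (alternation _ v); apply/funext => w; rewrite /tens4 !tnth_mktuple /s !permM.
by rewrite !tperm_inord //= -!mulrA; do 2!congr (_ * _); rewrite mulrC.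
Qed.

Lemma wedge4_swap24 a b c d v : wedge4 a b c d v = wedge4 a d c b v.
Proof.
pose s : 'S_8 := (tperm (inord 2) (inord 6) * tperm (inord 3) (inord 7))%g.
congr (_ * _); transitivity (alternation (fun w => tens4 a d c b (ptuple w s)) v); last first.
  rewrite alternation_perm odd_permM !odd_tperm -!val_eqE /= !inordK //=.
  by rewrite expr0 mul1r.
congr (alternation _ v); apply/funext => w; rewrite /tens4 !tnth_mktuple /s !permM.
by rewrite !tperm_inord //=; ring.
Qed.

Lemma tens4_multilinear a b c d :
  bilinear2 a -> bilinear2 b -> bilinear2 c -> bilinear2 d -> multilinear (tens4 a b c d).
Proof.
move=> ba bb bc bd v j r x y; rewrite /tens4 !tnth_mktuple.
have [k k8 ->] : exists2 k, (k < 8)%N & j = inord k.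
  by exists j; rewrite ?ltn_ord ?inord_val.
rewrite -!val_eqE /= !inordK //.
move: k k8 => [|[|[|[|[|[|[|[|]]]]]]]] //= _.
all: move: (tnth v (inord 0)) (tnth v (inord 1)) (tnth v (inord 2)) (tnth v (inord 3))
  (tnth v (inord 4)) (tnth v (inord 5)) (tnth v (inord 6)) (tnth v (inord 7)) =>
  w0 w1 w2 w3 w4 w5 w6 w7.
- by rewrite (ba w1 r x y).1; ring.
- by rewrite (ba w0 r x y).2; ring.
- by rewrite (bb w3 r x y).1; ring.
- by rewrite (bb w2 r x y).2; ring.
- by rewrite (bc w5 r x y).1; ring.
- by rewrite (bc w4 r x y).2; ring.
- by rewrite (bd w7 r x y).1; ring.
- by rewrite (bd w6 r x y).2; ring.
Qed.

Lemma wedge4D a b c x y v :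
  wedge4 a b c (fun w => x w + y w) v = wedge4 a b c x v + wedge4 a b c y v.
Proof.
rewrite /wedge4 -mulrDr -alternationD.
have -> : tens4 a b c (fun w => x w + y w) = fun w => tens4 a b c x w + tens4 a b c y w.
  by apply/funext => w; rewrite /tens4 mulrDr.
reflexivity.
Qed.

Lemma wedge4Z a b c x k v :
  wedge4 a b c (fun w => k * x w) v = k * wedge4 a b c x v.
Proof.
rewrite /wedge4.
have -> : tens4 a b c (fun w => k * x w) = fun w => k * tens4 a b c x w.
  by apply/funext => w; rewrite /tens4 mulrCA.
by rewrite alternationZ mulrCA.
Qed.

Lemma wedge4D3 a b c x y v :
  wedge4 a b (fun w => x w + y w) c v = wedge4 a b x c v + wedge4 a b y c v.
Proof. by rewrite wedge4_swap34 wedge4D !(wedge4_swap34 _ _ c). Qed.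

Lemma wedge4Z3 a b c x k v :
  wedge4 a b (fun w => k * x w) c v = k * wedge4 a b x c v.
Proof. by rewrite wedge4_swap34 wedge4Z (wedge4_swap34 _ _ c). Qed.

Lemma wedge4D2 a b c x y v :
  wedge4 a (fun w => x w + y w) b c v = wedge4 a x b c v + wedge4 a y b c v.
Proof. by rewrite wedge4_swap24 wedge4D !(wedge4_swap24 _ c). Qed.

Lemma wedge4Z2 a b c x k v :
  wedge4 a (fun w => k * x w) b c v = k * wedge4 a x b c v.
Proof. by rewrite wedge4_swap24 wedge4Z (wedge4_swap24 _ c). Qed.

End WedgeFour.

Section Units.
Variable R : realType.
Local Notation X := (@qmx R).

Definition units_check : bool :=
  all8 (fun p => all8 (fun q =>
   [&& all (fun m => qent m q p == - qent m p q) [:: 1; 2; 3]%N,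
       all (fun m => sum8 (fun r => qent m p r * qent m q r) == (p == q)%:Z) [:: 1; 2; 3]%N &
       all (fun mn => let: (m, n) := mn in (m == n) ||
         (sum8 (fun r => sum8 (fun s => qent m p s * qent n s r) * qent m q r) == - qent n p q))
        [seq (m, n) | m <- [:: 1; 2; 3]%N, n <- [:: 1; 2; 3]%N]])).

Lemma units_checkP : units_check.
Proof. by vm_compute. Qed.

Lemma sumR8 (F : nat -> int) : \sum_(i < 8) (F i)%:~R = (sum8 F)%:~R :> R[i].
Proof. by rewrite -sum8E rmorph_sum. Qed.

Let checked (p q : 'I_8) := all8P (all8P units_checkP p) q.

Lemma qmx_tr m : unit_index m -> (X m)^T = - X m.
Proof.
move=> hm; apply/matrixP => p q; rewrite !mxE.
by have /and3P [/allP /(_ m hm) /eqP -> _ _] := checked p q; rewrite rmorphN.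
Qed.

Lemma qmx_orth m : unit_index m -> X m *m (X m)^T = 1%:M.
Proof.
move=> hm; apply/matrixP => p q; rewrite !mxE.
under eq_bigr => r _ do rewrite !mxE -rmorphM.
rewrite (sumR8 (fun r => qent m p r * qent m q r)).
have /and3P [_ /allP /(_ m hm) /eqP -> _] := checked p q.
by rewrite pmulrn.
Qed.

Lemma qmx_conj m n : unit_index m -> unit_index n -> m != n ->
  X m *m X n *m (X m)^T = - X n.
Proof.
move=> hm hn mn; apply/matrixP => p q.
have E r : (X m *m X n) p r = (sum8 (fun s => qent m p s * qent n s r))%:~R.
  by rewrite mxE -sumR8; apply: eq_bigr => s _; rewrite !mxE rmorphM.
rewrite mxE; under eq_bigr => r _ do rewrite E !mxE -rmorphM.
rewrite (sumR8 (fun r => sum8 (fun s => qent m p s * qent n s r) * qent m q r)).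
have /and3P [_ _ /allP /(_ (m, n))] := checked p q.
rewrite (negbTE mn) /= => /(_ (allpairs_f _ hm hn)) /eqP ->.
by rewrite !mxE rmorphN.
Qed.

End Units.

Section HermitianNorm.
Variable R : realType.
Implicit Types A B : 'M[R[i]]_8.

Definition mxsqnorm A : R := \sum_p \sum_q sqnorm (A p q).

Lemma mxsqnorm_ge0 A : 0 <= mxsqnorm A.
Proof. by do 2!(apply: sumr_ge0 => ? _); exact: sqnorm_ge0. Qed.

Lemma mxsqnorm_eq0 A : mxsqnorm A = 0 -> A = 0.
Proof.
move=> h; apply/matrixP => p q; rewrite mxE; apply: sqnorm_eq0.
move/eqP: h; rewrite psumr_eq0; last by move=> k _; apply: sumr_ge0 => l _; exact: sqnorm_ge0.
move=> /allP /(_ p (mem_index_enum _)) /=; rewrite psumr_eq0; last first.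
  by move=> l _; exact: sqnorm_ge0.
by move=> /allP /(_ q (mem_index_enum _)) /= /eqP.
Qed.

Lemma mxtrace_adjmx A : \tr (A *m adjmx A) = (mxsqnorm A)%:C.
Proof.
rewrite /mxsqnorm rmorph_sum; apply: eq_bigr => p _; rewrite mxE rmorph_sum.
by apply: eq_bigr => q _; rewrite !mxE sqnormE.
Qed.

Lemma adjmxM A B : adjmx (A *m B) = adjmx B *m adjmx A.
Proof. by rewrite /adjmx trmx_mul map_mxM. Qed.

Lemma adjmxB A B : adjmx (A - B) = adjmx A - adjmx B.
Proof. by rewrite /adjmx linearB map_mxB. Qed.

Lemma adjmx_qmx m : adjmx (@qmx R m) = (qmx _ m)^T.
Proof.
apply/matrixP => p q; rewrite !mxE.
by move: (qent m q p) => [k|k]; rewrite ?NegzE ?rmorphN /= ?mulrNz ?rmorphN /= conjc_nat.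
Qed.

Lemma adjmx_qmxT m : adjmx (@qmx R m)^T = qmx _ m.
Proof. by apply/matrixP => p q; have := congr1 (fun M : 'M[R[i]]_8 => M q p) (adjmx_qmx m); rewrite !mxE. Qed.

(** The squared norm of the part of A that does not commute with the unit X. *)
Lemma mxsqnorm_commutator A m : unit_index m ->
  (mxsqnorm (A - qmx _ m *m A *m (qmx _ m)^T))%:C =
  2 * \tr (A *m adjmx A) - 2 * \tr (A *m qmx _ m *m adjmx A *m (qmx _ m)^T).
Proof.
move=> hm; set X := qmx _ m.
have XX : X *m X^T = 1%:M by exact: qmx_orth.
have XX' : X^T *m X = 1%:M by exact: mulmx1C.
have XT : X^T = - X by exact: qmx_tr.
rewrite -mxtrace_adjmx adjmxB !adjmxM adjmx_qmx adjmx_qmxT -/X.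
rewrite mulmxBl !mulmxBr !linearB /=.
have -> : \tr (X *m A *m X^T *m (X *m (adjmx A *m X^T))) = \tr (A *m adjmx A).
  rewrite !mulmxA -[_ *m X^T *m X]mulmxA XX' mulmx1 mxtrace_mulC !mulmxA XX' mul1mx //.
have -> : \tr (X *m A *m X^T *m adjmx A) = \tr (A *m X *m adjmx A *m X^T).
  rewrite XT !mulmxN !mulNmx !linearN /=; congr (- _).
  by rewrite -!mulmxA mxtrace_mulC !mulmxA.
rewrite !mulmxA; move: (\tr _) (\tr _) => u w; ring.
Qed.

End HermitianNorm.

Section Positivity.
Variable R : realType.
Local Notation X := (@qmx R).
Implicit Types (a c : inv_form R 2) (e : 'I_8 -> V8 R).

(** A matrix that commutes with the unit m is orthogonal to the unit n, because
    conjugation by m reverses n. *)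
Lemma invariant_trace0 (A : 'M[R[i]]_8) m n : unit_index m -> unit_index n -> m != n ->
  X m *m A *m (X m)^T = A -> \tr (A *m (X n)^T) = 0.
Proof.
move=> hm hn mn inv.
have conjT : X m *m (X n)^T *m (X m)^T = - (X n)^T.
  by have := congr1 trmx (qmx_conj R hm hn mn); rewrite !trmx_mul trmxK mulmxA linearN.
have conjT' : (X m)^T *m (X n)^T *m X m = - (X n)^T.
  have e : X m = - (X m)^T by rewrite qmx_tr // opprK.
  by rewrite {2}e mulmxN {1}qmx_tr // !mulNmx opprK.
have h : \tr (A *m (X n)^T) = - \tr (A *m (X n)^T).
  rewrite -{1}inv -!mulmxA mxtrace_mulC -!mulmxA [_ *m ((X n)^T *m _)]mulmxA conjT'.
  by rewrite mulmxN linearN.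
apply/eqP; have : 2 * \tr (A *m (X n)^T) = 0 by rewrite mulr_natl mulr2n {1}h addNr.
by move/eqP; rewrite mulf_eq0 pnatr_eq0.
Qed.

End Positivity.

(** * Quaternionic frames *)

Section Quaternionic.
Variables (R : realType) (g : V8 R -> V8 R -> R) (J K : {linear V8 R -> V8 R}).
Hypotheses (hg : scalar_product g) (JJ : forall x, J (J x) = - x) (KK : forall x, K (K x) = - x).
Hypotheses (gJJ : forall x y, g (J x) (J y) = g x y) (gKK : forall x y, g (K x) (K y) = g x y).
Hypothesis KJ : forall x, K (J x) = - J (K x).

(** The span of u, Ju, Ku, JKu is stable under J and K, which are skew; so a unit
    vector v orthogonal to it starts a second, orthogonal copy. *)
Lemma exists_quaternionic_frame : exists e, orthonormal_frame g e /\
  forall p q, [/\ g (J (e p)) (e q) = (qent 1 p q)%:~R, g (K (e p)) (e q) = (qent 2 p q)%:~R &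
                  g (J (K (e p))) (e q) = (qent 3 p q)%:~R].
Proof.
have [//|f hf] := @exists_orthogonal_orbits R g hg 4
  (fun a x => nth x [:: x; J x; K x; J (K x)] a) 2.
pose u := f 0%N; pose v := f 1%N.
have uu : g u u = 1 by case: (hf 0%N).
have vv : g v v = 1 by case: (hf 1%N).
have [vu vJu vKu vJKu] : [/\ g v u = 0, g v (J u) = 0, g v (K u) = 0 & g v (J (K u)) = 0].
  have [_ /(_ 0%N isT) h] := hf 1%N isT.
  have := (h (inord 0), h (inord 1), h (inord 2), h (inord 3)); rewrite !inordK //=.
  by case=> -[[-> ->] -> ->].
have sJ := J_skew hg JJ gJJ; have sK := J_skew hg KK gKK.
have sym := sp_sym hg; have gN := spNr hg.
have uv : g u v = 0 by rewrite sym.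
have uJv : g u (J v) = 0 by rewrite sym sJ vJu oppr0.
have uKv : g u (K v) = 0 by rewrite sym sK vKu oppr0.
have uJKv : g u (J (K v)) = 0 by rewrite sym sJ sK KJ gN !opprK vJKu oppr0.
have nJ w : g w (J w) = 0 by exact: g_J.
have nK w : g w (K w) = 0 by have := sK w w; rewrite sym; lra.
have nJK w : g w (J (K w)) = 0.
  by have := sym w (J (K w)); rewrite sJ sK KJ gN !opprK; lra.
have Jl x : J (- x) = - J x by exact: linearN.
have Kl x : K (- x) = - K x by exact: linearN.
pose e (p : nat) := nth 0 [:: u; J u; K u; J (K u); v; J v; K v; J (K v)] p.
have he : orthonormal_frame g (fun p : 'I_8 => e p).
  move=> p q; rewrite /e; case: p => [[|[|[|[|[|[|[|[|]]]]]]]]] //= hp;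
    case: q => [[|[|[|[|[|[|[|[|]]]]]]]]] //= hq;
    rewrite ?(sJ, sK, KJ, JJ, KK, Jl, Kl, gN, opprK) ?(uu, vv, vu, vJu, vKu, vJKu, uv, uJv, uKv, uJKv, nJ, nK, nJK)
     ?oppr0 //.
exists (fun p => e p); split=> // p q.
have act m (L : V8 R -> V8 R) : unit_index m ->
    L (e p) = (qsgn m p)%:~R *: e (qpar m p) -> g (L (e p)) (e q) = (qent m p q)%:~R.
  move=> hm ->; rewrite spZl // (he (Ordinal (qpar_lt p hm)) q) /qent.
  by rewrite -val_eqE eq_sym /=; case: eqP; rewrite ?mulr1 ?mulr0.
split; [apply: (act 1%N (fun x => J x))|apply: (act 2%N (fun x => K x))|
  apply: (act 3%N (fun x => J (K x)))] => //; rewrite /e; clear act; case: p => [[|[|[|[|[|[|[|[|]]]]]]]]] //= hp;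
  rewrite ?(KJ, JJ, KK, Jl, Kl, opprK) /qpar /qsgn /qneg /= ?scale1r ?scaleN1r //.
Qed.

End Quaternionic.

(** * The sum of squares and its consequences *)

Section GForm.
Variables (R : realType) (g : V8 R -> V8 R -> R).
Hypothesis hg : scalar_product g.
Local Notation X := (@qmx R).

(** The real 2-form attached to the endomorphism L; for a compatible complex
    structure it is the Kaehler form. *)
Definition gform (L : V8 R -> V8 R) : inv_form R 2 :=
  fun v => (g (L (tnth v ord0)) (tnth v ord_max))%:C.

Lemma gformE L x y : gform L [tuple x; y] = (g (L x) y)%:C. Proof. by []. Qed.

Lemma gform_bilinear (L : {linear V8 R -> V8 R}) : bilinear2 (gform L).
Proof.
move=> z s x y; rewrite !gformE; split; last by rewrite spDr // spZr // rmorphD rmorphM.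
by rewrite linearD linearZ /= spDl // spZl // rmorphD rmorphM.
Qed.

Lemma gform_skew (L : V8 R -> V8 R) : (forall x y, g (L x) y = - g x (L y)) -> skew_form (gform L).
Proof. by move=> h u v; rewrite !gformE h rmorphN (sp_sym hg u). Qed.

Variables (e : 'I_8 -> V8 R) (he : orthonormal_frame g e).

Lemma form_mx_act (L : {linear V8 R -> V8 R}) m a : bilinear2 a ->
  (forall p q, g (L (e p)) (e q) = (qent m p q)%:~R) ->
  form_mx (fun p => L (e p)) a = X m *m form_mx e a *m (X m)^T.
Proof.
move=> ba hL; apply/matrixP => p q; rewrite !mxE.
have La (p' : 'I_8) : L (e p') = \sum_(r < 8) (qent m p' r)%:~R *: e r.
  by rewrite {1}(frame_expand hg he (L (e p'))); apply: eq_bigr => r _; rewrite hL.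
have Ci (z : int) : (z%:~R : R)%:C = z%:~R by rewrite rmorph_int.
rewrite (La p) (La q).
rewrite (real_lin_sum (f := fun y => a [tuple _; y])); last by move=> s x y; case: (ba (\sum_(r < 8) (qent m p r)%:~R *: e r) s x y).
apply: eq_bigr => s _; rewrite (real_lin_sum (f := fun y => a [tuple y; e s])); last first.
  by move=> r x y; case: (ba (e s) r x y).
rewrite !mxE mulrC Ci; congr (_ * _); apply: eq_bigr => r _.
by rewrite !mxE Ci.
Qed.

Lemma form_mx_gform (L : V8 R -> V8 R) m : 
  (forall p q, g (L (e p)) (e q) = (qent m p q)%:~R) -> form_mx e (gform L) = X m.
Proof. by move=> h; apply/matrixP => p q; rewrite !mxE gformE h rmorph_int. Qed.

Lemma bilinear2_ext a b : bilinear2 a -> bilinear2 b -> form_mx e a = form_mx e b ->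
  forall x y, a [tuple x; y] = b [tuple x; y].
Proof.
move=> ba bb /matrixP ab x y.
rewrite (frame_expand hg he x) (frame_expand hg he y).
set x' := \sum_p _; 
have lin c : bilinear2 c -> c [tuple x'; \sum_q g y (e q) *: e q] =
   \sum_q \sum_p (g y (e q))%:C * ((g x (e p))%:C * c [tuple e p; e q]).
  move=> bc; rewrite (real_lin_sum (f := fun y => c [tuple _; y])); last first.
    by move=> s u v; case: (bc x' s u v).
  apply: eq_bigr => q _; rewrite (real_lin_sum (f := fun y => c [tuple y; e q])); last first.
    by move=> r u v; case: (bc (e q) r u v).
  by rewrite mulr_sumr.
rewrite !lin //; apply: eq_bigr => q _; apply: eq_bigr => p _; congr (_ * (_ * _)).
by have := ab p q; rewrite !mxE.
Qed.

End GForm.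

Section HYM.
Variables (R : realType) (g : V8 R -> V8 R -> R) (J K : {linear V8 R -> V8 R}).
Hypotheses (hg : scalar_product g) (JJ : forall x, J (J x) = - x) (KK : forall x, K (K x) = - x).
Hypotheses (gJJ : forall x y, g (J x) (J y) = g x y) (gKK : forall x y, g (K x) (K y) = g x y).
Variables (e : 'I_8 -> V8 R) (he : orthonormal_frame g e).
Hypothesis hq : forall p q, [/\ g (J (e p)) (e q) = (qent 1 p q)%:~R,
  g (K (e p)) (e q) = (qent 2 p q)%:~R & g (J (K (e p))) (e q) = (qent 3 p q)%:~R].
Local Notation X := (@qmx R).

Let om := gform g J.
Let k1 := gform g K.
Let k2 := gform g (J \o K).

Let X1E : form_mx e om = X 1. Proof. by apply: form_mx_gform => p q; case: (hq p q). Qed.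
Let X2E : form_mx e k1 = X 2. Proof. by apply: form_mx_gform => p q; case: (hq p q). Qed.
Let X3E : form_mx e k2 = X 3.
Proof. by apply: form_mx_gform => p q; case: (hq p q). Qed.

Let bom : bilinear2 om := gform_bilinear hg J.
Let bk1 : bilinear2 k1 := gform_bilinear hg K.
Let som : skew_form om. Proof. by apply: gform_skew => //; exact: J_skew. Qed.
Let sk1 : skew_form k1. Proof. by apply: gform_skew => //; exact: J_skew. Qed.

(** Two cases of [wedge4_star]: the products with three Kaehler forms of which at
    least two agree. *)
Lemma wedge4_units m n a x y : unit_index m -> unit_index n ->
  form_mx e x = X m -> form_mx e y = X n -> skew_form y ->
  wedge4 a y x x (mktuple e) =
    (if m == n then 3 else 1) * \tr (form_mx e a *m (X n)^T).
Proof.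
move=> hm hn xE yE sy; rewrite (wedge4_star _ hm sy xE) yE.
rewrite -!mulmxA; have [<-|mn] := eqVneq m n.
  have XX : X m *m (X m)^T = 1%:M := qmx_orth R hm.
  rewrite (mulmxA (X m)) XX mul1mx mxtrace1.
  by move: (\tr _) => z; field.
have conjT : X m *m ((X n)^T *m (X m)^T) = - (X n)^T.
  by have := congr1 trmx (qmx_conj R hm hn mn); rewrite !trmx_mul trmxK linearN.
rewrite conjT mulmxN linearN opprK.
have -> : \tr (X n *m (X m)^T) = 0.
  have XX' : (X n)^T *m X n = 1%:M by apply: mulmx1C; exact: qmx_orth.
  apply: (invariant_trace0 hn hm); first by rewrite eq_sym.
  by rewrite -mulmxA qmx_orth // mulmx1.
by rewrite !mulr0 add0r mul1r.
Qed.

Variable a : inv_form R 2.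
Hypotheses (ba : bilinear2 a) (sa : skew_form a).
Hypothesis aJ : forall x y, a [tuple J x; J y] = a [tuple x; y].
Hypothesis aprim : forall v, wedge_form a (wedge_form om (wedge_form om om)) v = 0.

Let A := form_mx e a.

Let A_inv : X 1 *m A *m (X 1)^T = A.
Proof.
rewrite -(form_mx_act hg he (L := J)) //; last by move=> p q; case: (hq p q).
by apply/matrixP => p q; rewrite !mxE aJ.
Qed.

Let trA1 : \tr (A *m (X 1)^T) = 0.
Proof.
have := aprim (mktuple e); rewrite wedge_form3_wedge4 (wedge4_units a _ _ X1E X1E) //=.
by move/eqP; rewrite mulf_eq0 pnatr_eq0 => /eqP.
Qed.

Let trA2 : \tr (A *m (X 2)^T) = 0. Proof. exact: (invariant_trace0 (m := 1%N) (n := 2%N)). Qed.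
Let trA3 : \tr (A *m (X 3)^T) = 0. Proof. exact: (invariant_trace0 (m := 1%N) (n := 3%N)). Qed.

(** c /\ conj c is t^2 (k1^2 + k2^2) for the Kaehler forms k1, k2 of K and JK.
    By [wedge4_star] each of k1^2, k2^2, om^2 contributes minus the pairing of A
    with its conjugate by the corresponding unit, and for om this conjugate is A
    itself: what is left is a sum of squares. *)
Lemma wedge4_positive (t : R) (c : inv_form R 2) :
  (forall v, c v = t%:C * k1 v + ('i%C * t%:C) * k2 v) ->
  wedge4 a (conj_form a) c (conj_form c) (mktuple e) -
    (2 * t ^+ 2)%:C * wedge4 a (conj_form a) om om (mktuple e) =
  (t ^+ 2 / 2 * (mxsqnorm (A - X 2 *m A *m (X 2)^T) + mxsqnorm (A - X 3 *m A *m (X 3)^T)))%:C.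
Proof.
move=> cE.
have cE' : c = fun v => t%:C * k1 v + ('i%C * t%:C) * k2 v by apply/funext.
have ccE : conj_form c = fun v => t%:C * k1 v + (- 'i%C * t%:C) * k2 v.
  apply/funext => v; rewrite /conj_form cE /k1 /k2 /gform.
  by apply/eqP; rewrite eq_complex /=; apply/andP; split; apply/eqP; ring.
set b := conj_form a; have sb : skew_form b by move=> u v; rewrite /b /conj_form sa rmorphN.
have bE : (form_mx e b)^T = adjmx A by apply/matrixP => p q; rewrite !mxE.
have star x m : unit_index m -> form_mx e x = X m -> \tr (A *m (X m)^T) = 0 ->
    wedge4 a b x x (mktuple e) = - \tr (A *m X m *m adjmx A *m (X m)^T).
  by move=> hm xE t0; rewrite (wedge4_star _ hm sb xE) -/A bE t0 mul0r mulr0 add0r.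
have -> : wedge4 a b c (conj_form c) (mktuple e) =
   (t ^+ 2)%:C * (wedge4 a b k1 k1 (mktuple e) + wedge4 a b k2 k2 (mktuple e)).
  rewrite ccE cE' wedge4D3 !wedge4D !wedge4Z3 !wedge4Z (wedge4_swap34 a b k2 k1).
  rewrite rmorphXn /=; move: (wedge4 _ _ _ _ _) (wedge4 _ _ _ _ _) (wedge4 _ _ _ _ _) => u v w.
  have ii : 'i%C * 'i%C = -1 :> R[i] by rewrite -expr2 sqr_i.
  transitivity (t%:C ^+ 2 * (w - ('i%C * 'i%C) * u)); first by ring.
  by rewrite ii; ring.
rewrite (star k1 2%N) // (star k2 3%N) // (star om 1%N) //.
have -> : \tr (A *m X 1 *m adjmx A *m (X 1)^T) = \tr (A *m adjmx A).
  have inv' : X 1 *m adjmx A *m (X 1)^T = adjmx A.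
    by rewrite -[in RHS]A_inv !adjmxM adjmx_qmx adjmx_qmxT mulmxA.
  by rewrite -!mulmxA (mulmxA (X 1)) inv'.
have split_real (p m n : R) : (p / 2 * (m + n))%:C = p%:C / 2 * (m%:C + n%:C).
  by rewrite rmorphM rmorphD /= rmorphM fmorphV rmorph_nat.
rewrite split_real (mxsqnorm_commutator A (m := 2%N)) // (mxsqnorm_commutator A (m := 3%N)) //.
rewrite (_ : (2 * t ^+ 2)%:C = 2 * (t ^+ 2)%:C); last by rewrite rmorphM rmorph_nat.
move: (\tr _) (\tr _) (\tr _) (_%:C) => u v w y; by field.
Qed.

Lemma commutes_of_zero (t : R) (c : inv_form R 2) : t != 0 ->
  (forall v, c v = t%:C * k1 v + ('i%C * t%:C) * k2 v) ->
  wedge4 a (conj_form a) c (conj_form c) (mktuple e) -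
    (2 * t ^+ 2)%:C * wedge4 a (conj_form a) om om (mktuple e) = 0 ->
  forall x y, a [tuple K x; K y] = a [tuple x; y].
Proof.
move=> t0 cE; rewrite wedge4_positive // => /eqP.
rewrite (fmorph_eq0 (real_complex R)) mulf_eq0 mulf_eq0 invr_eq0 pnatr_eq0 orbF sqrf_eq0 (negbTE t0) /=.
rewrite paddr_eq0 ?mxsqnorm_ge0 // => /andP [/eqP /mxsqnorm_eq0 /eqP + _].
rewrite subr_eq0 => /eqP A2.
pose a' : inv_form R 2 := fun v => a [tuple K (tnth v ord0); K (tnth v ord_max)].
have ba' : bilinear2 a'.
  move=> z s x y; rewrite /a' /= !linearD !linearZ /=.
  by have [h1 h2] := ba (K z) s (K x) (K y); split.
apply: (@bilinear2_ext _ _ hg _ he a' a) => //.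
rewrite -/A A2 -(form_mx_act hg he (L := K)) //; by move=> p q; case: (hq p q).
Qed.

(** Expanding (om + t k1)^3, every term is a multiple of the contraction of a with
    om, which vanishes as a is primitive, or with k1, which vanishes as a is
    J-invariant and k1 changes sign under J. *)
Lemma primitive_rotated (s t : R) (w' : inv_form R 2) :
  (forall v, w' v = s%:C * (om v + t%:C * k1 v)) ->
  forall v, wedge_form a (wedge_form w' (wedge_form w' w')) v = 0.
Proof.
move=> wE v; have -> : w' = fun v => s%:C * (om v + t%:C * k1 v) by apply/funext.
rewrite wedge_form3_wedge4 wedge4Z2 wedge4Z3 wedge4Z.
pose y : inv_form R 2 := fun v => t%:C * k1 v; pose z : inv_form R 2 := fun v => om v + y v.
have bz : bilinear2 z.
  move=> w r x u; rewrite /z /y; have [-> ->] := bom w r x u; have [-> ->] := bk1 w r x u.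
  by split; ring.
rewrite -/y -/z /wedge4 (alternation_frame hg he) //; last exact: tens4_multilinear.
suff : wedge4 a z z z (mktuple e) = 0.
  by move/eqP; rewrite mulf_eq0 invr_eq0 pnatr_eq0 => /eqP ->; rewrite !mulr0.
rewrite /z wedge4D2 !wedge4D3 !wedge4D /y.
rewrite !(wedge4Z2, wedge4Z3, wedge4Z).
have U := wedge4_units a.
rewrite (wedge4_swap24 a om om k1) (wedge4_swap34 a om k1 om) (wedge4_swap24 a om om k1).
rewrite (wedge4_swap24 a k1 k1 om) (wedge4_swap34 a k1 om k1) (wedge4_swap24 a k1 k1 om).
rewrite (U 1%N 1%N om om) // (U 2%N 2%N k1 k1) // (U 1%N 2%N om k1) // (U 2%N 1%N k1 om) //.
by rewrite trA1 trA2 !mulr0 !addr0.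
Qed.

End HYM.

(** * Mean values over the torus by Riemann sums *)

Section Averaging.
Variables (R : realType) (B : 'M[R]_8).
Hypothesis uB : B \in unitmx.
Let Lam : set (V8 R) := [set x | exists z : 'rV[int]_8, x = map_mx intr z *m B].
Local Notation l a := (row a B).

Definition lattice_periodic (f : V8 R -> R) := forall x v, Lam v -> f (x + v) = f x.

Lemma lattice_row a : Lam (l a).
Proof.
exists (delta_mx 0 a); rewrite rowE; congr (_ *m _); apply/matrixP => i j.
by rewrite !mxE; case: (_ && _).
Qed.

(** The fundamental parallelepiped lies in a compact box. *)
Lemma periodic_bounded (f : V8 R -> R) : continuous f -> lattice_periodic f ->
  exists C, forall x, `|f x| <= C.
Proof.
move=> cf pf; pose M := \sum_i \sum_j `|B i j|.
pose Q := [set v : V8 R | forall i, `[- M, M]%classic (v ord0 i)].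
have cQ : compact Q.
  by apply: (@rV_compact _ _ (fun=> `[- M, M]%classic)) => i; exact: segment_compact.
have cfQ : compact (f @` Q).
  by apply: continuous_compact => //; exact: continuous_subspaceT.
have [C [_ HC]] := compact_bounded cfQ.
exists (C + 1) => x; apply: (HC (C + 1)); first by rewrite ltrDl.
pose y := x *m invmx B; pose z := \row_j Num.floor (y 0 j).
have xE : x = (y - map_mx intr z) *m B + map_mx intr z *m B.
  by rewrite -mulmxDl subrK /y mulmxKV.
exists ((y - map_mx intr z) *m B); last by rewrite [in RHS]xE pf //; exists z.
move=> i; rewrite /= in_itv /= -ler_norml mxE.
apply: le_trans (ler_norm_sum _ _ _) _; rewrite /M; apply: ler_sum => j _.
rewrite normrM; apply: (@le_trans _ _ `|B j i|).
  rewrite ler_piMl // !mxE ger0_norm ?subr_ge0 ?floor_le //.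
  by rewrite lerBlDr addrC -[1]/(1%:~R) -intrD ltW // floorD1_gt.
by rewrite (bigD1 i) //= lerDl sumr_ge0.
Qed.

Definition grid_point N (k : {ffun 'I_8 -> 'I_N}) : V8 R :=
  \sum_a ((k a)%:R / N%:R) *: l a.

Definition grid_sum N (f : V8 R -> R) (x : V8 R) : R :=
  \sum_(k : {ffun 'I_8 -> 'I_N}) f (x + grid_point k).

(** Moving by one step in the direction a permutes the grid cyclically, up to a
    lattice vector. *)
Lemma grid_sum_shift N (f : V8 R -> R) x a : (0 < N)%N -> lattice_periodic f ->
  grid_sum N (fun y => f (y + N%:R^-1 *: l a)) x = grid_sum N f x.
Proof.
move=> N0 pf; have N0' : N%:R != 0 :> R by rewrite pnatr_eq0 -lt0n.
pose sh (k : {ffun 'I_8 -> 'I_N}) := [ffun b => if b == a then ordS (k b) else k b].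
rewrite /grid_sum [RHS](reindex sh) /=; last first.
  exists (fun k => [ffun b => if b == a then ord_pred (k b) else k b]) => k _;
    by apply/ffunP => b; rewrite !ffunE; case: (b == a); rewrite ?ordSK ?ord_predK.
apply: eq_bigr => k _.
have rest : \sum_(b | b != a) ((sh k b)%:R / N%:R) *: l b =
   \sum_(b | b != a) ((k b)%:R / N%:R) *: l b.
  by apply: eq_bigr => b /negbTE ba; rewrite ffunE ba.
rewrite /grid_point (bigD1 a) //= [in RHS](bigD1 a) //= rest ffunE eqxx /=.
set S := \sum_(b | _) _.
have kN := ltn_ord (k a).
have [lt|ge] := ltnP (k a).+1 N.
  rewrite modn_small //; congr f; rewrite -!addrA; congr (_ + _).
  by rewrite -natr1 mulrDl mul1r scalerDl -addrA [S + _]addrC addrA.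
have kE : (k a).+1 = N by apply/eqP; rewrite eqn_leq kN ge.
rewrite kE modnn mul0r scale0r add0r -(pf (x + S) (l a) (lattice_row a)); congr f.
rewrite -!addrA; congr (_ + _); rewrite addrCA; congr (_ + _).
by rewrite -scalerDl -[X in _ + X]mul1r -mulrDl natr1 kE divff // scale1r.
Qed.

Lemma grid_card N : #|{ffun 'I_8 -> 'I_N}| = (N ^ 8)%N.
Proof. by rewrite card_ffun !card_ord. Qed.

Lemma grid_sum_le N (f : V8 R -> R) (C : R) x : (forall y, `|f y| <= C) ->
  `|grid_sum N f x| <= C * (N ^ 8)%:R.
Proof.
move=> fC; apply: le_trans (ler_norm_sum _ _ _) _.
apply: (@le_trans _ _ (\sum_(k : {ffun 'I_8 -> 'I_N}) C)); first by apply: ler_sum.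
by rewrite sumr_const grid_card mulr_natr.
Qed.

Lemma derive_line (f : V8 R -> R) x v (s : R) : differentiable f (x + s *: v) ->
  is_derive s 1 (fun r : R => f (x + r *: v)) ('D_v f (x + s *: v)).
Proof.
move=> df; have E (r : R) : f (x + (r *: 1 + s) *: v) = f (r *: v + (x + s *: v)).
  by congr f; rewrite scalerDl addrCA /GRing.scale /= mulr1.
have dv : derivable f (x + s *: v) v by exact: diff_derivable.
apply: DeriveDef.
  by rewrite /derivable /=; under eq_fun do rewrite E.
by rewrite /derive /=; under eq_fun do rewrite E.
Qed.

Lemma mean_value_line (f : V8 R -> R) x v (h : R) : (forall y, differentiable f y) -> 0 < h ->
  exists2 s, 0 < s < h & f (x + h *: v) - f x = 'D_v f (x + s *: v) * h.
Proof.
move=> df h0.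
have [||s] := @MVT R (fun r => f (x + r *: v)) (fun r => 'D_v f (x + r *: v)) 0 h h0.
- by move=> r _; exact: derive_line.
- apply: derivable_within_continuous => r _; have := derive_line (df (x + r *: v)).
  by case.
rewrite in_itv /= scale0r addr0 subr0 => sh eq; by exists s.
Qed.

(** Mean value zero over V / Lam, without integrals: there are N^8 grid points, so
    the Riemann sums tend to 0 at the rate 1/N. *)
Definition mean_zero (f : V8 R -> R) := continuous f /\
  forall x, exists2 C, 0 <= C & forall N, (0 < N)%N -> `|grid_sum N f x| <= C * (N ^ 7)%:R.

(** The derivative along l_a differs from the difference quotient of step l_a / N
    by at most sup |f''| / N, and the difference quotients sum to zero over the
    grid. *)
Lemma mean_zero_derive_row (f : V8 R -> R) a :
  (forall x, differentiable f x) -> (forall x, differentiable ('D_(l a) f) x) ->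
  continuous ('D_(l a) ('D_(l a) f)) -> lattice_periodic f -> mean_zero ('D_(l a) f).
Proof.
move=> df ddf cddf pf.
have pD (g : V8 R -> R) v : lattice_periodic g -> lattice_periodic ('D_v g).
  move=> pg x w Lw; rewrite /derive.
  have -> : (fun r => r^-1 *: ((g \o shift (x + w)) (r *: v) - g (x + w))) =
      (fun r => r^-1 *: ((g \o shift x) (r *: v) - g x)) :> (R -> R).
    by apply/funext => r; rewrite /= addrA !(pg _ w Lw).
  by [].
split=> [x|x]; first exact: differentiable_continuous.
have [C HC] := periodic_bounded cddf (pD _ _ (pD _ _ pf)).
have C0 : 0 <= C by exact: le_trans (normr_ge0 _) (HC 0).
exists C => // N N0; have N0' : 0 < N%:R :> R by rewrite ltr0n.
pose g y := 'D_(l a) f y - N%:R * (f (y + N%:R^-1 *: l a) - f y).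
have -> : grid_sum N ('D_(l a) f) x = grid_sum N g x.
  rewrite /grid_sum sumrB -mulr_sumr sumrB.
  have := grid_sum_shift x a N0 pf; rewrite /grid_sum => ->.
  by rewrite subrr mulr0 subr0.
rewrite (_ : C * (N ^ 7)%:R = C / N%:R * (N ^ 8)%:R); last first.
  rewrite [X in _ = _ * X%:R]expnS natrM -mulrA mulKf //; exact: lt0r_neq0.
apply: grid_sum_le => y.
have hN : 0 < N%:R^-1 :> R by rewrite invr_gt0.
have [s /andP [s0 sN] es] := mean_value_line y (l a) df hN.
have [s' /andP [s0' _] es'] := mean_value_line y (l a) ddf s0.
rewrite /g es mulrCA divff ?mulr1; last exact: lt0r_neq0.
rewrite distrC es' normrM (gtr0_norm s0).
apply: ler_pM => //; exact: ltW.
Qed.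

Lemma mean_zero_sum (I : Type) (r : seq I) (F : I -> V8 R -> R) :
  (forall i, mean_zero (F i)) -> mean_zero (fun x => \sum_(i <- r) F i x).
Proof.
move=> mF; elim: r => [|i r [c IH]].
  split=> [x|x].
    by under eq_fun do rewrite big_nil; exact: cst_continuous.
  exists 0 => // N _; rewrite /grid_sum big1 ?normr0 ?mul0r // => k _.
  by rewrite big_nil.
have [ci hi] := mF i; split=> x.
  under eq_fun do rewrite big_cons.
  exact: (continuousD (ci x) (c x)).
have [C1 C10 h1] := hi x; have [C2 C20 h2] := IH x.
exists (C1 + C2); first exact: addr_ge0.
move=> N N0; rewrite /grid_sum; under eq_bigr do rewrite big_cons.
by rewrite big_split mulrDl; apply: le_trans (ler_normD _ _) _; rewrite lerD ?h1 ?h2.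
Qed.

Lemma mean_zeroZ (k : R) (f : V8 R -> R) : mean_zero f -> mean_zero (fun x => k * f x).
Proof.
move=> [cf hf]; split=> x; first exact: (continuousM (@cst_continuous _ _ k x) (cf x)).
have [C C0 h] := hf x; exists (`|k| * C); first by rewrite mulr_ge0.
by move=> N N0; rewrite /grid_sum -mulr_sumr normrM -mulrA ler_wpM2l ?h.
Qed.

Lemma mean_zero_derive (f : V8 R -> R) v : diff_on 2 setT f -> lattice_periodic f ->
  mean_zero ('D_v f).
Proof.
move=> /= [df d1] pf.
have -> : 'D_v f = fun x => \sum_a (v *m invmx B) 0 a * 'D_(l a) f x.
  apply/funext => x; have dfx := df x I.
  have vE : v = \sum_a (v *m invmx B) 0 a *: l a by rewrite -mulmx_sum_row mulmxKV.
  rewrite deriveE // {1}vE linear_sum; apply: eq_bigr => a _.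
  by rewrite linearZ deriveE.
apply: mean_zero_sum => a; apply: mean_zeroZ.
apply: mean_zero_derive_row => // [x|x|x].
- exact: df.
- by have [h _] := d1 (l a); exact: h.
- have [_ /(_ (l a)) [h _]] := d1 (l a); exact/differentiable_continuous/h.
Qed.

(** If f is positive at x, it exceeds f(x)/2 on a small parallelepiped, which
    contains a fixed fraction q^-8 of the grid points when N is a multiple of q;
    the Riemann sums then cannot be O(1/N). *)
Lemma mean_zero_ge0 (f : V8 R -> R) : mean_zero f -> (forall x, 0 <= f x) -> forall x, f x = 0.
Proof.
move=> [cf hf] f0 x; apply/eqP; rewrite eq_le f0 andbT leNgt; apply/negP => fx.
have [C C0 hC] := hf x.
have : \forall y \near x, f x / 2 < f y.
  have fx2 : f x / 2 < f x by lra.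
  exact: (@cvgr_gt _ _ _ _ f (f x) (cf x) _ fx2).
move/nbhs_ballP => [eps /= eps0 heps].
pose S := \sum_a `|l a|.
have S0 : 0 <= S by exact: sumr_ge0.
pose q := (Num.trunc (S / eps)).+1.
have q0 : 0 < q%:R :> R by rewrite ltr0n.
have Sq : S / q%:R < eps.
  by rewrite ltr_pdivrMr // mulrC -ltr_pdivrMr // truncnS_gt.
pose m := (Num.trunc (C * (q ^ 7)%:R / (f x / 2))).+1.
have m0 : (0 < m)%N by [].
have mq0 : (0 < m * q)%N by rewrite muln_gt0.
have lower : f x / 2 * (m ^ 8)%:R <= grid_sum (m * q) f x.
  pose A := [pred k : {ffun 'I_8 -> 'I_(m * q)} | [forall a, (k a < m)%N]].
  have cA : #|A| = (m ^ 8)%N.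
    have mmq : (m <= m * q)%N by rewrite leq_pmulr.
    have -> : (m ^ 8)%N = #|{ffun 'I_8 -> 'I_m}| by rewrite grid_card.
    pose w (k : {ffun 'I_8 -> 'I_m}) : {ffun 'I_8 -> 'I_(m * q)} := [ffun a => widen_ord mmq (k a)].
    have wi : injective w.
      move=> k k' /ffunP e; apply/ffunP => a; have := e a; rewrite !ffunE => /(congr1 val) /= h.
      exact: val_inj.
    rewrite -(fintype.card_image wi); apply: eq_card => k; rewrite inE.
    apply/fintype.forallP/fintype.imageP.
      move=> h; exists [ffun a => Ordinal (h a)] => //.
      by apply/ffunP => a; rewrite !ffunE; apply: val_inj.
    by move=> [k' _ ->] a; rewrite ffunE /=.
  rewrite /grid_sum (bigID (mem A)) /= -[leLHS]addr0 lerD //; last exact: sumr_ge0.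
  rewrite -cA mulr_natr -sumr_const; apply: ler_sum => k; rewrite inE => /fintype.forallP kA.
  apply/ltW/heps; rewrite -ball_normE /ball_ /= opprD addrA subrr sub0r normrN.
  apply: le_lt_trans Sq; apply: le_trans (ler_norm_sum _ _ _) _.
  rewrite /S mulr_suml; apply: ler_sum => a _.
  rewrite normrZ mulrC ler_wpM2l // ger0_norm ?divr_ge0 //.
  rewrite natrM invfM mulrA ler_piMl ?invr_ge0 ?ler0n //.
  by rewrite ler_pdivrMr ?ltr0n // mul1r ler_nat ltnW.
have upper := le_trans (ler_norm _) (hC (m * q)%N mq0).
have := le_trans lower upper.
rewrite expnMn natrM mulrA (expnS m 7) natrM.
have m70 : 0 < (m ^ 7)%:R :> R by rewrite ltr0n expn_gt0.
rewrite mulrA [C * _]mulrC -[leRHS]mulrA [leRHS]mulrC ler_pM2r //.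
have := truncnS_gt (C * (q ^ 7)%:R / (f x / 2)); rewrite -/m.
rewrite ltr_pdivrMr; last lra.
by rewrite mulrC [ltRHS]mulrC => h1 h2; have := lt_le_trans h1 h2; rewrite ltxx.
Qed.

End Averaging.

(** * Coclosed exact 1-forms *)

Section DiffOn.
Variable R : realType.
Implicit Types f h : V8 R -> R.

Lemma diff_onS k f : diff_on k.+1 setT f -> diff_on k setT f.
Proof.
elim: k f => [|k IH] f /= [df d1]; first by [].
by split=> // v; apply: IH; exact: d1.
Qed.

Lemma diff_on_le k f : diff_on k setT f -> forall x, differentiable f x.
Proof. by case: k => [|k] /= [df _] x; exact: df. Qed.

Lemma diff_on_cst k (a : R) : diff_on k setT (cst a).
Proof.
elim: k a => [|k IH] a /=; first by split=> // x _; exact: differentiable_cst.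
split=> [x _|v]; first exact: differentiable_cst.
have -> : 'D_v (cst a) = cst (0 : R) by apply/funext => x; exact: derive_cst.
exact: IH.
Qed.

Lemma diff_onD k f h : diff_on k setT f -> diff_on k setT h -> diff_on k setT (f + h).
Proof.
elim: k f h => [|k IH] f h /= [df d1] [dh e1].
  by split=> // x _; apply: differentiableD; [exact: df|exact: dh].
split=> [x _|v]; first by apply: differentiableD; [exact: df|exact: dh].
have -> : 'D_v (f + h) = 'D_v f + 'D_v h.
  by apply/funext => x; rewrite deriveD //; apply: diff_derivable; [exact: df|exact: dh].
exact: IH.
Qed.

Lemma diff_onM k f h : diff_on k setT f -> diff_on k setT h -> diff_on k setT (f * h).
Proof.
elim: k f h => [|k IH] f h.
  move=> /= [df _] [dh _]; split=> // x _.
  by apply: differentiableM; [exact: df|exact: dh].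
move=> sf sh; have sf' := diff_onS sf; have sh' := diff_onS sh.
case: sf => df d1; case: sh => dh e1.
split=> [x _|v]; first by apply: differentiableM; [exact: df|exact: dh].
have -> : 'D_v (f * h) = f * 'D_v h + h * 'D_v f.
  by apply/funext => x; rewrite deriveM //; apply: diff_derivable; [exact: df|exact: dh].
by apply: diff_onD; apply: IH => //; [exact: e1|exact: d1].
Qed.

Lemma diff_onB k f h : diff_on k setT f -> diff_on k setT h -> diff_on k setT (f - h).
Proof.
move=> sf sh; have -> : f - h = f + cst (-1) * h.
  by apply/funext => x; exact: (congr1 (fun z => f x + z) (esym (mulN1r (h x)))).
by apply: diff_onD => //; apply: diff_onM => //; exact: diff_on_cst.
Qed.

Lemma diff_on_sum k (I : Type) (r : seq I) (F : I -> V8 R -> R) :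
  (forall i, diff_on k setT (F i)) -> diff_on k setT (fun x => \sum_(i <- r) F i x).
Proof.
move=> sF; elim: r => [|i r IH].
  have -> : (fun x => \sum_(i <- [::]) F i x) = cst 0 by apply/funext => x; rewrite big_nil.
  exact: diff_on_cst.
have -> : (fun x => \sum_(j <- i :: r) F j x) = F i + (fun x => \sum_(j <- r) F j x).
  by apply/funext => x; rewrite big_cons.
exact: diff_onD.
Qed.

Lemma derive_linear f x (I : finType) (s : I -> R) (u : I -> V8 R) : differentiable f x ->
  'D_(\sum_i s i *: u i) f x = \sum_i s i * 'D_(u i) f x.
Proof.
move=> df; rewrite deriveE // linear_sum; apply: eq_bigr => i _.
by rewrite linearZ deriveE.
Qed.

Lemma derive_lincomb x v (I : finType) (s : I -> R) (F : I -> V8 R -> R) :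
  (forall i, differentiable (F i) x) ->
  'D_v (fun y => \sum_i s i * F i y) x = \sum_i s i * 'D_v (F i) x.
Proof.
move=> dF; suff : forall r : seq I, differentiable (fun y => \sum_(i <- r) s i * F i y) x /\
   'D_v (fun y => \sum_(i <- r) s i * F i y) x = \sum_(i <- r) s i * 'D_v (F i) x.
  by move=> h; have [_ ->] := h (index_enum I).
elim=> [|i r [d1 e1]].
  have -> : (fun y => \sum_(i <- [::]) s i * F i y) = cst 0 by apply/funext => y; rewrite big_nil.
  by rewrite big_nil; split; [exact: differentiable_cst|exact: derive_cst].
have -> : (fun y => \sum_(j <- i :: r) s j * F j y) =
    s i \*: F i + (fun y => \sum_(j <- r) s j * F j y).
  by apply/funext => y; rewrite big_cons.
have dz : differentiable (s i \*: F i) x by exact: differentiableZ.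
rewrite big_cons; split; first exact: differentiableD.
by rewrite deriveD ?e1 ?deriveZ //; exact: diff_derivable.
Qed.

End DiffOn.

Section Coclosed.
Variables (R : realType) (B : 'M[R]_8).
Hypothesis uB : B \in unitmx.
Variables (g : V8 R -> V8 R -> R).
Hypothesis hg : scalar_product g.
Variables (e : 'I_8 -> V8 R) (he : orthonormal_frame g e).

(* A real 1-form: p x v is its value at the point x on the vector v. *)
Variable p : V8 R -> V8 R -> R.
Hypothesis plin : forall x (s : R) u v, p x (s *: u + v) = s * p x u + p x v.
Hypothesis psm : forall k v, diff_on k setT (fun x => p x v).
Hypothesis pper : forall v, lattice_periodic B (fun x => p x v).

Definition curl1 x u v := 'D_u (fun y => p y v) x - 'D_v (fun y => p y u) x.

Lemma curl1_smooth k u v : diff_on k setT (fun x => curl1 x u v).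
Proof.
apply: (@diff_onB R k ('D_u (fun y => p y v)) ('D_v (fun y => p y u))).
  by have [_ h] := psm k.+1 v; exact: h.
by have [_ h] := psm k.+1 u; exact: h.
Qed.

Lemma plin_sum x (I : finType) (s : I -> R) (u : I -> V8 R) :
  p x (\sum_i s i *: u i) = \sum_i s i * p x (u i).
Proof.
have p0 : p x 0 = 0 by have := plin x 1 0 0; rewrite scaler0 addr0 mul1r; lra.
by elim/big_rec2: _ => [//|i a b _ <-]; rewrite plin.
Qed.

Lemma curl1_linear x v (I : finType) (s : I -> R) (u : I -> V8 R) :
  curl1 x (\sum_i s i *: u i) v = \sum_i s i * curl1 x (u i) v.
Proof.
have dp w y : differentiable (fun y => p y w) y by exact: (diff_on_le (psm 0 w)).
rewrite /curl1 derive_linear //.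
have -> : (fun y => p y (\sum_i s i *: u i)) = fun y => \sum_i s i * p y (u i).
  by apply/funext => y; exact: plin_sum.
rewrite derive_lincomb //.
by rewrite -sumrB; apply: eq_bigr => i _; rewrite mulrBr.
Qed.

Lemma curl1_skew x u v : curl1 x u v = - curl1 x v u.
Proof. by rewrite /curl1 opprB. Qed.

Hypothesis coclosed : forall x v,
  \sum_i \sum_j dual_metric g i j * 'D_(bvec R i) (fun y => curl1 y (bvec R j) v) x = 0.

Let coclosed_frame x v : \sum_q 'D_(e q) (fun y => curl1 y (e q) v) x = 0.
Proof.
apply: etrans (coclosed x v).
have dc u w y : differentiable (fun y => curl1 y u w) y by exact: (diff_on_le (curl1_smooth 0 u w)).
have eE q : e q = \sum_j e q 0 j *: bvec R j by exact: bvec_sum.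
transitivity (\sum_q \sum_i \sum_j (e q 0 i * e q 0 j) *
   'D_(bvec R i) (fun y => curl1 y (bvec R j) v) x).
  apply: eq_bigr => q _.
  transitivity ('D_(\sum_j e q 0 j *: bvec R j) (fun y => curl1 y (e q) v) x).
    by rewrite -(eE q).
  rewrite derive_linear //.
  apply: eq_bigr => i _; have -> : (fun y => curl1 y (e q) v) =
      fun y => \sum_j e q 0 j * curl1 y (bvec R j) v.
    by apply/funext => y; rewrite {1}(eE q) curl1_linear.
  by rewrite derive_lincomb // mulr_sumr; apply: eq_bigr => j _; rewrite mulrA.
rewrite exchange_big; apply: eq_bigr => i _; rewrite exchange_big; apply: eq_bigr => j _.
by rewrite -mulr_suml (dual_metric_frame hg he).
Qed.

(** |dp|^2 = 2 div (dp . p) - 2 <p, d^* dp>, so for coclosed dp the nonnegative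
    function |dp|^2 is a divergence and has mean value zero. *)
Lemma coclosed_exact_eq0 x u v : curl1 x u v = 0.
Proof.
pose W a b : V8 R -> R := fun y => curl1 y (e a) (e b).
pose P b : V8 R -> R := fun y => p y (e b).
pose F a : V8 R -> R := fun y => \sum_b W a b y * P b y.
have sW k a b : diff_on k setT (W a b) by exact: curl1_smooth.
have sP k b : diff_on k setT (P b) by exact: psm.
have sF k a : diff_on k setT (F a).
  by apply: (@diff_on_sum R k 'I_8 (index_enum _) (fun b => W a b * P b)) => b; exact: diff_onM.
have dW a b y : differentiable (W a b) y by exact: (diff_on_le (sW 0 a b)).
have dP b y : differentiable (P b) y by exact: (diff_on_le (sP 0 b)).
have pD (f : V8 R -> R) w : lattice_periodic B f -> lattice_periodic B ('D_w f).
  move=> pf y z Lz; rewrite /derive.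
  have -> : (fun r => r^-1 *: ((f \o shift (y + z)) (r *: w) - f (y + z))) =
      (fun r => r^-1 *: ((f \o shift y) (r *: w) - f y)) :> (R -> R).
    by apply/funext => r; rewrite /= addrA !(pf _ z Lz).
  by [].
have pF a : lattice_periodic B (F a).
  move=> y z Lz; apply: eq_bigr => b _; rewrite /W /P /curl1.
  by rewrite !(pD _ _ (pper _)) // pper.
have DF a y : 'D_(e a) (F a) y = \sum_b (W a b y * 'D_(e a) (P b) y + P b y * 'D_(e a) (W a b) y).
  rewrite (_ : F a = fun y => \sum_b 1 * (W a b * P b) y); last first.
    by apply/funext => z; apply: eq_bigr => b _; rewrite mul1r.
  rewrite derive_lincomb => [|b]; last exact: differentiableM.
  by apply: eq_bigr => b _; rewrite mul1r deriveM //; exact: diff_derivable.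
have key y : \sum_a \sum_b W a b y ^+ 2 = \sum_a 2 * 'D_(e a) (F a) y.
  have swap : \sum_a \sum_b W a b y * 'D_(e b) (P a) y = - \sum_a \sum_b W a b y * 'D_(e a) (P b) y.
    rewrite exchange_big -sumrN; apply: eq_bigr => a _; rewrite -sumrN; apply: eq_bigr => b _.
    by rewrite /W curl1_skew mulNr.
  have cz : \sum_a \sum_b P b y * 'D_(e a) (W a b) y = 0.
    rewrite exchange_big big1 // => b _; rewrite -mulr_sumr (coclosed_frame y (e b)).
    by rewrite mulr0.
  rewrite -mulr_sumr; under [in RHS]eq_bigr do rewrite DF big_split /=.
  rewrite big_split /= cz addr0.
  transitivity (\sum_a \sum_b W a b y * 'D_(e a) (P b) y - \sum_a \sum_b W a b y * 'D_(e b) (P a) y).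
    rewrite -sumrB; apply: eq_bigr => a _; rewrite -sumrB; apply: eq_bigr => b _.
    by rewrite -mulrBr expr2.
  by rewrite swap opprK mulr_natl mulr2n.
have W0 a b y : W a b y = 0.
  have mz : mean_zero B (fun y => \sum_a \sum_b W a b y ^+ 2).
    rewrite (_ : (fun y => _) = fun y => \sum_a 2 * 'D_(e a) (F a) y); last exact/funext.
    by apply: mean_zero_sum => c; apply: mean_zeroZ; exact: (mean_zero_derive uB).
  have sq y' : 0 <= \sum_a \sum_b W a b y' ^+ 2.
    by do 2!(apply: sumr_ge0 => ? _); exact: sqr_ge0.
  have /eqP := mean_zero_ge0 mz sq y; rewrite psumr_eq0; last first.
    by move=> c _; apply: sumr_ge0 => d _; exact: sqr_ge0.
  move=> /allP /(_ a (mem_index_enum _)) /=; rewrite psumr_eq0; last first.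
    by move=> c _; exact: sqr_ge0.
  by move=> /allP /(_ b (mem_index_enum _)) /=; rewrite sqrf_eq0 => /eqP.
rewrite (frame_expand hg he u) curl1_linear big1 // => a _.
rewrite curl1_skew {1}(frame_expand hg he v) curl1_linear big1 ?oppr0 ?mulr0 // => b _.
by have := W0 b a x; rewrite /W => ->; rewrite mulr0.
Qed.

End Coclosed.

(** * Traceless curvature and Chern forms *)

Section ComplexDerivative.
Variable R : realType.
Implicit Types (f h : V8 R -> R[i]) (u v x : V8 R).

Definition cdiff f x := differentiable (fun y => complex.Re (f y)) x /\
                        differentiable (fun y => complex.Im (f y)) x.

Lemma smooth_cdiff U f x : smooth_on U f -> U x -> cdiff f x.
Proof. by move=> /(_ 0%N) /= [[h1 _] [h2 _]] Ux; split; [exact: h1|exact: h2]. Qed.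

Lemma cderiv_near v f h x : (\forall y \near x, f y = h y) -> cderiv v f x = cderiv v h x.
Proof.
move=> fh; congr (_ +i* _); apply: near_eq_derive; near=> y.
  by rewrite (near fh y).
by rewrite (near fh y).
Unshelve. all: by end_near. Qed.

Lemma cderiv_cst v (k : R[i]) x : cderiv v (fun=> k) x = 0.
Proof. by rewrite /cderiv !derive_cst. Qed.

Lemma cderivD v f h x : cdiff f x -> cdiff h x ->
  cderiv v (fun y => f y + h y) x = cderiv v f x + cderiv v h x.
Proof.
move=> [f1 f2] [h1 h2].
have e1 : (fun y => complex.Re (f y + h y)) = (fun y => complex.Re (f y)) + (fun y => complex.Re (h y)).
  by apply/funext => y; rewrite raddfD.
have e2 : (fun y => complex.Im (f y + h y)) = (fun y => complex.Im (f y)) + (fun y => complex.Im (h y)).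
  by apply/funext => y; rewrite raddfD.
by rewrite /cderiv e1 e2 !deriveD //; exact: diff_derivable.
Qed.

Lemma cdiffZ (k : R[i]) f x : cdiff f x -> cdiff (fun y => k * f y) x.
Proof.
case: k => a b [f1 f2].
have e1 : (fun y => complex.Re ((a +i* b) * f y)) = (a \*: (fun y => complex.Re (f y))) - (b \*: (fun y => complex.Im (f y))).
  by apply/funext => y; rewrite -[RHS]/(a * complex.Re (f y) - b * complex.Im (f y)); case: (f y).
have e2 : (fun y => complex.Im ((a +i* b) * f y)) = (a \*: (fun y => complex.Im (f y))) + (b \*: (fun y => complex.Re (f y))).
  by apply/funext => y; rewrite -[RHS]/(a * complex.Im (f y) + b * complex.Re (f y)); case: (f y).
split; rewrite ?e1 ?e2; [apply: differentiableB|apply: differentiableD]; exact: differentiableZ.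
Qed.

Lemma cderivZ v (k : R[i]) f x : cdiff f x -> cderiv v (fun y => k * f y) x = k * cderiv v f x.
Proof.
case: k => a b [f1 f2].
have e1 : (fun y => complex.Re ((a +i* b) * f y)) = (a \*: (fun y => complex.Re (f y))) - (b \*: (fun y => complex.Im (f y))).
  by apply/funext => y; rewrite -[RHS]/(a * complex.Re (f y) - b * complex.Im (f y)); case: (f y).
have e2 : (fun y => complex.Im ((a +i* b) * f y)) = (a \*: (fun y => complex.Im (f y))) + (b \*: (fun y => complex.Re (f y))).
  by apply/funext => y; rewrite -[RHS]/(a * complex.Im (f y) + b * complex.Re (f y)); case: (f y).
have dd (s : R) (p : V8 R -> R) : differentiable p x -> derivable (s \*: p) x v.
  by move=> dp; apply: diff_derivable; exact: differentiableZ.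
rewrite /cderiv e1 e2 deriveB ?deriveD; try exact: dd.
rewrite !deriveZ; try exact: diff_derivable.
by apply/eqP; rewrite eq_complex /= /GRing.scale /= !eqxx.
Qed.

Lemma cderiv_conj v f x : cdiff f x -> cderiv v (fun y => conjc (f y)) x = conjc (cderiv v f x).
Proof.
move=> [f1 f2].
have e1 : (fun y => complex.Re (conjc (f y))) = (fun y => complex.Re (f y)).
  by apply/funext => y; case: (f y).
have e2 : (fun y => complex.Im (conjc (f y))) = - (fun y => complex.Im (f y)).
  by apply/funext => y; rewrite -[RHS]/(- complex.Im (f y)); case: (f y).
by rewrite /cderiv e1 e2 deriveN //; exact: diff_derivable.
Qed.

Lemma cderiv_dir (s : R) u v f x : cdiff f x ->
  cderiv (s *: u + v) f x = s%:C * cderiv u f x + cderiv v f x.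
Proof.
move=> [f1 f2].
have dir (h : V8 R -> R) : differentiable h x -> 'D_(s *: u + v) h x = s * 'D_u h x + 'D_v h x.
  by move=> dh; rewrite !deriveE //; exact: linearP.
rewrite /cderiv !dir //; move: ('D_u _ _) ('D_v _ _) ('D_u _ _) ('D_v _ _) => a b c d.
by apply/eqP; rewrite eq_complex /=; apply/andP; split; apply/eqP; ring.
Qed.

End ComplexDerivative.

Section Curvature.
Variables (R : realType) (Lam : set (V8 R)) (r : nat) (E : hbundle Lam r) (A : conn_data E).
Hypothesis hA : unitary_connection A.
Variables (i : bidx E) (x : V8 R).
Hypothesis hx : chart i x.

Local Notation F := (curvature (A i) x).

Let dA w a b : cdiff (fun y => A i y w a b) x.
Proof. by case: hA => _ _ sA _ _; apply: smooth_cdiff (sA i w a b) hx. Qed.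

Let near_chart : \forall y \near x, chart i y.
Proof. by apply: open_nbhs_nbhs; split=> //; exact: chart_open. Qed.

Let A_lin y (s : R) u v : chart i y -> A i y (s *: u + v) = s%:C *: A i y u + A i y v.
Proof. by case: hA => h _ _ _ _ cy; exact: h. Qed.

Let A_skew y v : chart i y -> adjmx (A i y v) = - A i y v.
Proof. by case: hA => _ h _ _ _ cy; exact: h. Qed.

Lemma curvature_skew u v : F [tuple v; u] = - F [tuple u; v].
Proof. by rewrite /curvature /= opprD opprB opprB. Qed.

Let mderiv_dir (s : R) u v w :
  mderiv (s *: u + v) (fun y => A i y w) x = s%:C *: mderiv u (fun y => A i y w) x + mderiv v (fun y => A i y w) x.
Proof. by apply/matrixP => a b; rewrite !mxE cderiv_dir. Qed.

Let mderiv_lin (s : R) u v w :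
  mderiv w (fun y => A i y (s *: u + v)) x = s%:C *: mderiv w (fun y => A i y u) x + mderiv w (fun y => A i y v) x.
Proof.
apply/matrixP => a b; rewrite !mxE.
rewrite (@cderiv_near _ _ _ (fun y => s%:C * A i y u a b + A i y v a b)).
  by rewrite cderivD ?cderivZ //; exact: cdiffZ.
near=> y; rewrite A_lin ?mxE //; near: y; exact: near_chart.
Unshelve. all: by end_near. Qed.

Lemma curvature_lin (s : R) u v w :
  F [tuple s *: u + v; w] = s%:C *: F [tuple u; w] + F [tuple v; w].
Proof.
rewrite /curvature /= mderiv_dir mderiv_lin A_lin //.
rewrite mulmxDl mulmxDr -scalemxAl -scalemxAr !scalerDr.
apply/matrixP => a b; rewrite !mxE; ring.
Qed.

Lemma curvature_linr (s : R) u v w :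
  F [tuple w; s *: u + v] = s%:C *: F [tuple w; u] + F [tuple w; v].
Proof. by rewrite curvature_skew curvature_lin [in RHS]curvature_skew [F [tuple w; v]]curvature_skew opprD scalerN. Qed.

Lemma adjmxD (M N : 'M[R[i]]_r) : adjmx (M + N) = adjmx M + adjmx N.
Proof. by rewrite /adjmx linearD map_mxD. Qed.
Lemma adjmxN (M : 'M[R[i]]_r) : adjmx (- M) = - adjmx M.
Proof. by rewrite /adjmx linearN map_mxN. Qed.
Lemma adjmxMr (M N : 'M[R[i]]_r) : adjmx (M *m N) = adjmx N *m adjmx M.
Proof. by rewrite /adjmx trmx_mul map_mxM. Qed.

Lemma curvature_antihermitian w : adjmx (F w) = - F w.
Proof.
have dadj u v : adjmx (mderiv u (fun y => A i y v) x) = - mderiv u (fun y => A i y v) x.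
  apply/matrixP => a b; rewrite !mxE -cderiv_conj //.
  rewrite (@cderiv_near _ _ _ (fun y => -1 * A i y v a b)) ?cderivZ ?mulN1r //.
  near=> y; rewrite mulN1r.
  have cy : chart i y by near: y; exact: near_chart.
  by have := congr1 (fun M : 'M[R[i]]_r => M a b) (A_skew v cy); rewrite !mxE.
rewrite /curvature !adjmxD !adjmxN !dadj !adjmxMr !A_skew // !mulmxN !mulNmx !opprK.
by rewrite !opprD !opprK [in RHS]addrC [in LHS]addrC; congr (_ + _); rewrite addrC.
Unshelve. all: by end_near. Qed.

Local Notation Fo := (traceless F).

Lemma adjmxE (M : 'M[R[i]]_r) a b : adjmx M a b = conjc (M b a). Proof. by rewrite !mxE. Qed.

Lemma traceless_antihermitian a b w : mentry Fo b a w = - conj_form (mentry Fo a b) w.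
Proof.
have Fh a' b' : conjc (F w a' b') = - F w b' a'.
  by rewrite -adjmxE curvature_antihermitian [LHS]mxE.
rewrite /mentry /conj_form /traceless /trF; move: (F w) Fh => G Fh.
rewrite !mxE rmorphD rmorphN rmorphMn /= Fh.
rewrite rmorphM fmorphV rmorph_nat /mxtrace rmorph_sum /=.
under [in RHS]eq_bigr do rewrite Fh.
by rewrite sumrN mulrN mulNrn opprK opprD opprK eq_sym.
Qed.

Lemma traceless_bilinear a b : bilinear2 (mentry Fo a b).
Proof.
move=> z s u v; rewrite /mentry /traceless /trF curvature_lin curvature_linr.
move: (F _) (F _) (F _) (F _) => G1 G2 G3 G4.
by split; rewrite !mxE linearD linearZ /= mulrDr mulrnDl; ring.
Qed.

Lemma traceless_skew a b : skew_form (mentry Fo a b).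
Proof.
move=> u v; rewrite /mentry /traceless /trF curvature_skew; move: (F _) => G.
by rewrite !mxE linearN /= mulrN mulNrn opprK opprD opprK.
Qed.

End Curvature.

Section ChernAlgebra.
Variable R : realType.

Lemma wedge_linl p q k (a a' : inv_form R p) (b : inv_form R q) v :
  wedge_form (fun u => k * a u + a' u) b v = k * wedge_form a b v + wedge_form a' b v.
Proof.
rewrite /wedge_form mulrCA -mulrDr; congr (_ * _); rewrite mulr_sumr -big_split /=.
apply: eq_bigr => s _; move: (_ ^+ s) (a _) (a' _) (b _) => y y1 y2 y3; ring.
Qed.

Lemma wedge_linr p q k (a : inv_form R p) (b b' : inv_form R q) v :
  wedge_form a (fun u => k * b u + b' u) v = k * wedge_form a b v + wedge_form a b' v.
Proof.
rewrite /wedge_form mulrCA -mulrDr; congr (_ * _); rewrite mulr_sumr -big_split /=.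
apply: eq_bigr => s _; move: (_ ^+ s) (a _) (b _) (b' _) => y y1 y2 y3; ring.
Qed.

Lemma wedge_suml p q (I : Type) (rr : seq I) (F : I -> inv_form R p) (b : inv_form R q) v :
  wedge_form (fun u => \sum_(i <- rr) F i u) b v = \sum_(i <- rr) wedge_form (F i) b v.
Proof.
elim: rr => [|i rr IH].
  rewrite big_nil /wedge_form big1 ?mulr0 // => s _.
  by rewrite big_nil mulr0 mul0r.
rewrite big_cons -IH -[X in _ = X + _]mul1r -wedge_linl.
by congr (wedge_form _ b v); apply/funext => u; rewrite big_cons mul1r.
Qed.

Lemma wedge_sumr p q (I : Type) (rr : seq I) (F : I -> inv_form R q) (a : inv_form R p) v :
  wedge_form a (fun u => \sum_(i <- rr) F i u) v = \sum_(i <- rr) wedge_form a (F i) v.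
Proof.
elim: rr => [|i rr IH].
  rewrite big_nil /wedge_form big1 ?mulr0 // => s _.
  by rewrite big_nil mulr0.
rewrite big_cons -IH -[X in _ = X + _]mul1r -wedge_linr.
by congr (wedge_form a _ v); apply/funext => u; rewrite big_cons mul1r.
Qed.

(** The cross terms each give - tau^2 / r and the square of the trace part gives
    + tau^2 / r, where tau is the trace. *)
Lemma traceless_square r (F : mform2 R r) v : (0 < r)%N ->
  \sum_a \sum_b wedge_form (mentry (traceless F) a b) (mentry (traceless F) b a) v =
  \sum_a \sum_b wedge_form (mentry F a b) (mentry F b a) v
   - (r%:R)^-1 * wedge_form (trF F) (trF F) v.
Proof.
move=> r0; have rn0 : r%:R != 0 :> R[i] by rewrite pnatr_eq0 -lt0n.
set tau := trF F; pose k (a b : 'I_r) : R[i] := - (r%:R^-1 *+ (a == b)).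
have FoE a b : mentry (traceless F) a b = fun u => k a b * tau u + mentry F a b u.
  apply/funext => u; rewrite /mentry /traceless !mxE /k mulNr mulrnAl addrC.
  by rewrite -/tau.
transitivity (\sum_a \sum_b (k a b * k b a * wedge_form tau tau v
   + k a b * (wedge_form tau (mentry F b a) v + wedge_form (mentry F b a) tau v)
   + wedge_form (mentry F a b) (mentry F b a) v)).
  apply: eq_bigr => a _.
  have step b : wedge_form (mentry (traceless F) a b) (mentry (traceless F) b a) v =
    k a b * k b a * wedge_form tau tau v + k a b * wedge_form tau (mentry F b a) v
    + k b a * wedge_form (mentry F a b) tau v + wedge_form (mentry F a b) (mentry F b a) v.
    by rewrite !FoE wedge_linl !wedge_linr; ring.
  apply: eq_bigr => b _; rewrite step /k.
  by case: eqP => [->|/eqP/negbTE ab]; rewrite ?eqxx ?[b == a]eq_sym ?ab ?mulr0n; ring.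
under eq_bigr do rewrite !big_split /=.
rewrite !big_split /= addrC; congr (_ + _).
have kk a (G : 'I_r -> R[i]) : \sum_b k a b * G b = - r%:R^-1 * G a.
  rewrite (bigD1 a) //= big1 ?addr0 => [|b /negbTE ba]; first by rewrite /k eqxx.
  by rewrite /k eq_sym ba mulr0n oppr0 mul0r.
under eq_bigr => a _ do under eq_bigr => b _ do rewrite -mulrA.
under eq_bigr => a _ do rewrite (kk a (fun b => k b a * wedge_form tau tau v)).
under [X in _ + X = _]eq_bigr => a _ do
  rewrite (kk a (fun b => wedge_form tau (mentry F b a) v + wedge_form (mentry F b a) tau v)).
rewrite -!mulr_sumr big_split /=.
have tauE : tau = fun u => \sum_a mentry F a a u by [].
have -> : \sum_a wedge_form tau (mentry F a a) v = wedge_form tau tau v.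
  by rewrite {3}tauE wedge_sumr.
have -> : \sum_a wedge_form (mentry F a a) tau v = wedge_form tau tau v.
  by rewrite {2}tauE wedge_suml.
under eq_bigr do rewrite /k eqxx mulr1n.
rewrite sumr_const card_ord -[(_ * _) *+ r]mulr_natl; move: (wedge_form _ _ _) => w; by field.
Qed.

(** The combination c_2 - (r-1)/(2r) c_1^2 is chosen so that the trace of F
    drops out. *)
Lemma chern_beta r (F : mform2 R r) v : (0 < r)%N ->
  chern2 F v - (r%:R - 1) / (2%:R * r%:R) * wedge_form (chern1 F) (chern1 F) v =
  ((8 * pi ^+ 2)^-1)%:C *
  \sum_a \sum_b wedge_form (mentry (traceless F) a b) (mentry (traceless F) b a) v.
Proof.
move=> r0; have rn0 : r%:R != 0 :> R[i] by rewrite pnatr_eq0 -lt0n.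
have pi0 : pi%:C != 0 :> R[i] by rewrite (fmorph_eq0 (real_complex R)) gt_eqF ?pi_gt0.
rewrite traceless_square // /chern2.
have c1E : chern1 F = fun u => ('i%C * ((2 * pi)^-1)%:C) * trF F u + 0.
  by apply/funext => u; rewrite addr0.
have w0 p q (a : inv_form R p) (u : (p + q).-tuple (V8 R)) : wedge_form a (fun=> 0 : R[i]) u = 0 :> R[i].
  by rewrite /wedge_form big1 ?mulr0 // => s _; rewrite mulr0.
have w0' p q (b : inv_form R q) (u : (p + q).-tuple (V8 R)) : @wedge_form R p q (fun=> 0 : R[i]) b u = 0 :> R[i].
  by rewrite /wedge_form big1 ?mulr0 // => s _; rewrite mulr0 mul0r.
have -> : wedge_form (chern1 F) (chern1 F) v =
    - (4 * (pi%:C) ^+ 2)^-1 * wedge_form (trF F) (trF F) v.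
  rewrite {1}c1E wedge_linl w0' addr0 c1E wedge_linr w0 addr0 mulrA; congr (_ * _).
  have ii : 'i%C * 'i%C = -1 :> R[i] by rewrite -expr2 sqr_i.
  have -> : ((2 * pi)^-1)%:C = (2 * pi%:C)^-1 :> R[i] by rewrite fmorphV rmorphM rmorph_nat.
  by rewrite mulrACA ii; move: (pi%:C) pi0 => z z0; field.
rewrite (_ : ((8 * pi ^+ 2)^-1)%:C = (8 * (pi%:C) ^+ 2)^-1); last first.
  by rewrite fmorphV rmorphM rmorph_nat rmorphXn.
move: (wedge_form (trF F) (trF F) v) (\sum_a _) => w S.
move: (pi%:C) pi0 => z z0; field.
by rewrite rn0 z0.
Qed.

End ChernAlgebra.

(** * The class beta as a form *)

Section Exact.
Variables (R : realType) (B : 'M[R]_8).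
Hypothesis uB : B \in unitmx.
Local Notation Lam := [set x | exists z : 'rV[int]_8, x = map_mx intr z *m B].

Lemma mean_zeroD (f h : V8 R -> R) : mean_zero B f -> mean_zero B h -> mean_zero B (fun x => f x + h x).
Proof.
move=> mf mh.
have -> : (fun x => f x + h x) = (fun x => \sum_(b <- [:: true; false]) (if b then f else h) x).
  by apply/funext => x; rewrite !big_cons big_nil addr0.
by apply: mean_zero_sum => -[].
Qed.

Section Wedge.
Variables (k q : nat) (psi : V8 R -> inv_form R k).
Hypothesis psi_smooth : forall v, smooth_on setT (fun x => psi x v).
Hypothesis psi_per : forall x l, Lam l -> forall v, psi (x + l) v = psi x v.

Let mean_zero_cderiv (K : R[i]) u w :
  mean_zero B (fun x => complex.Re (K * cderiv u (fun y => psi y w) x)).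
Proof.
have -> : (fun x => complex.Re (K * cderiv u (fun y => psi y w) x)) =
  (fun x => complex.Re K * 'D_u (fun y => complex.Re (psi y w)) x +
            (- complex.Im K) * 'D_u (fun y => complex.Im (psi y w)) x).
  by apply/funext => x; case: K => a b; rewrite /= mulNr.
apply: mean_zeroD; apply: mean_zeroZ; apply: (mean_zero_derive uB).
- exact: (psi_smooth w 2).1.
- by move=> x v Lv; rewrite psi_per.
- exact: (psi_smooth w 2).2.
- by move=> x v Lv; rewrite psi_per.
Qed.

(** This is Stokes' theorem: the wedge with a constant form is a combination,
    with constant coefficients, of derivatives of periodic functions. *)
Lemma mean_zero_wedge_exact (Phi : inv_form R q) (v : (k.+1 + q).-tuple (V8 R)) (K : R[i]) :
  mean_zero B (fun x => complex.Re (K * wedge_form (extd psi x) Phi v)).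
Proof.
pose c : R[i] := K * ((k.+1)`! * q`!)%N%:R^-1.
pose L (s : 'S_(k.+1 + q)) := c * ((-1) ^+ s * Phi [tuple tnth v (s (rshift k.+1 i)) | i < q]).
pose w (s : 'S_(k.+1 + q)) := [tuple tnth v (s (lshift q i)) | i < k.+1].
have -> : (fun x => complex.Re (K * wedge_form (extd psi x) Phi v)) =
  (fun x => \sum_s \sum_(i < k.+1) complex.Re ((L s * (-1) ^+ i) *
    cderiv (tnth (w s) i) (fun y => psi y [tuple tnth (w s) (lift i j) | j < k]) x)).
  apply/funext => x; rewrite /wedge_form mulrA mulr_sumr raddf_sum; apply: eq_bigr => s _.
  rewrite -raddf_sum; congr (complex.Re _); rewrite -/(w s).
  transitivity (L s * extd psi x (w s)); first last.
    by rewrite /extd mulr_sumr; apply: eq_bigr => i _; rewrite mulrA.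
  rewrite /L -/c; clear L; move: c ((-1) ^+ s) (extd psi x (w s)) (Phi _) => c0 y1 y2 y3; ring.
by apply: mean_zero_sum => s; apply: mean_zero_sum => i; exact: mean_zero_cderiv.
Qed.

End Wedge.

Section Harmonic.
Variables (g : V8 R -> V8 R -> R).
Hypothesis hg : scalar_product g.
Variables (e : 'I_8 -> V8 R) (he : orthonormal_frame g e).
Variable psi : V8 R -> inv_form R 1.
Hypothesis psi_form : forall x, is_form (psi x).
Hypothesis psi_smooth : forall v, smooth_on setT (fun x => psi x v).
Hypothesis psi_per : forall x l, Lam l -> forall v, psi (x + l) v = psi x v.

Lemma extd1E x u v : extd psi x [tuple u; v] =
  cderiv u (fun y => psi y [tuple v]) x - cderiv v (fun y => psi y [tuple u]) x.
Proof.
have face (i : 'I_2) : [tuple tnth [tuple u; v] (lift i j) | j < 1] =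
    [tuple if i == ord0 then v else u].
  by apply: eq_from_tnth => j; rewrite tnth_mktuple (ord1 j); case: (ord2P i) => ->.
rewrite /extd !big_ord_recl big_ord0 addr0 !face /= expr0 mul1r.
by rewrite (_ : lift ord0 ord0 = ord_max) ?expr1 ?mulN1r //; exact: val_inj.
Qed.

Let psi_lin x (s : R) u v : psi x [tuple s *: u + v] = s%:C * psi x [tuple u] + psi x [tuple v].
Proof.
have [h _] := psi_form x; have := h [tuple 0] ord0 s u v.
have updE w : upd [tuple 0] ord0 w = [tuple w] :> 1.-tuple (V8 R).
  by apply: eq_from_tnth => i; rewrite tnth_mktuple (ord1 i).
by rewrite !updE.
Qed.

Let pr x v := complex.Re (psi x [tuple v]).
Let pi' x v := complex.Im (psi x [tuple v]).

Lemma extd1_curl x u v : extd psi x [tuple u; v] = curl1 pr x u v +i* curl1 pi' x u v.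
Proof. by rewrite extd1E. Qed.

Hypothesis coclosed : forall x v,
  \sum_i \sum_j (dual_metric g i j)%:C *
     cderiv (bvec R i) (fun y => extd psi y [tuple bvec R j; v]) x = 0.

Lemma harmonic_exact_eq0 x w : extd psi x w = 0.
Proof.
have co x' v : (\sum_i \sum_j dual_metric g i j * 'D_(bvec R i) (fun y => curl1 pr y (bvec R j) v) x')
  +i* (\sum_i \sum_j dual_metric g i j * 'D_(bvec R i) (fun y => curl1 pi' y (bvec R j) v) x') = 0.
  rewrite -[RHS](coclosed x' v).
  have reE u : (fun y => curl1 pr y u v) = (fun y => complex.Re (extd psi y [tuple u; v])).
    by apply/funext => y; rewrite extd1_curl.
  have imE u : (fun y => curl1 pi' y u v) = (fun y => complex.Im (extd psi y [tuple u; v])).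
    by apply/funext => y; rewrite extd1_curl.
  apply/eqP; rewrite eq_complex !raddf_sum /=; apply/andP; split; apply/eqP;
    apply: eq_bigr => i _; rewrite raddf_sum; apply: eq_bigr => j _.
    by rewrite /= mul0r subr0 reE.
  by rewrite /= mul0r addr0 imE.
have co1 x' v := congr1 (@complex.Re R) (co x' v).
have co2 x' v := congr1 (@complex.Im R) (co x' v).
rewrite [w]tuple2_eta extd1_curl; move: (tnth w _) (tnth w _) => v u.
have -> : curl1 pr x u v = 0.
  apply: (coclosed_exact_eq0 uB hg he _ _ _ co1).
  - by move=> y s a b; rewrite /pr psi_lin; case: (psi y _) => ? ?; case: (psi y _) => ? ? /=; rewrite mul0r subr0.
  - by move=> k a; exact: (psi_smooth [tuple a] k).1.
  - by move=> a y l Ll; rewrite /pr psi_per.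
have -> : curl1 pi' x u v = 0; last by [].
apply: (coclosed_exact_eq0 uB hg he _ _ _ co2).
- by move=> y s a b; rewrite /pi' psi_lin; case: (psi y _) => ? ?; case: (psi y _) => ? ? /=; rewrite mul0r addr0.
- by move=> k a; exact: (psi_smooth [tuple a] k).2.
- by move=> a y l Ll; rewrite /pi' psi_per.
Qed.

End Harmonic.

Section ChernForms.
Variables (g : V8 R -> V8 R -> R).
Hypothesis hg : scalar_product g.
Variables (e : 'I_8 -> V8 R) (he : orthonormal_frame g e).
Variables (r : nat) (E : hbundle Lam r) (A : conn_data E).
Hypotheses (r0 : (0 < r)%N) (hAE : in_AE g A).

(** The difference between the first Chern form and its class is exact, and it is
    coclosed because the trace of the curvature is harmonic. *)
Lemma chern1_constant (c1 : inv_form R 2) : is_c1 E c1 ->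
  forall i x, chart i x -> forall v, chern1 (curvature (A i) x) v = c1 v.
Proof.
case: hAE => hA harm /(_ _ hA) [_ [psi [pf ps pp pe]]] i x cx v.
rewrite (pe i x cx) (harmonic_exact_eq0 hg he pf ps pp) ?addr0 //.
move=> {i cx v} {}x w; have [i cx] := chart_cover E x.
have [_ /(_ [tuple w])] := harm i x cx.
move/eqP; rewrite oppr_eq0 => /eqP.
pose kap : R[i] := 'i%C * ((2 * pi)^-1)%:C.
have kap0 : kap != 0.
  rewrite mulf_neq0 //; first by rewrite -sqrf_eq0 sqr_i oppr_eq0 oner_eq0.
  by rewrite (fmorph_eq0 (real_complex R)) invr_eq0 mulf_neq0 ?gt_eqF ?pi_gt0.
move=> co; transitivity (kap * 0); last exact: mulr0.
rewrite -[in RHS]co mulr_sumr; apply: eq_bigr => a _.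
rewrite mulr_sumr; apply: eq_bigr => b _; rewrite mulrCA; congr (_ * _).
have bE : [tuple of bvec R b :: [tuple w]] = [tuple bvec R b; w] by exact: val_inj.
rewrite bE.
have cdp u y : cdiff (fun y => extd psi y u) y.
  rewrite [u]tuple2_eta; move: (tnth u _) (tnth u _) => u1 u2.
  have -> : (fun y => extd psi y [tuple u2; u1]) = fun y =>
     curl1 (fun x v => complex.Re (psi x [tuple v])) y u2 u1 +i*
     curl1 (fun x v => complex.Im (psi x [tuple v])) y u2 u1.
    by apply/funext => z; rewrite extd1_curl.
  split.
    apply: (diff_on_le (k := 0%N)); apply: curl1_smooth => k v.
    exact: (ps [tuple v] k).1.
  apply: (diff_on_le (k := 0%N)); apply: curl1_smooth => k v.
  exact: (ps [tuple v] k).2.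
have nc : \forall y \near x, chart i y.
  by apply: open_nbhs_nbhs; split=> //; exact: chart_open.
rewrite (@cderiv_near _ _ (fun y => trF (curvature (A i) y) _)
  (fun y => kap^-1 * (c1 [tuple bvec R b; w] + extd psi y [tuple bvec R b; w]))).
  rewrite cderivZ; last first.
    split.
      have -> : (fun y => complex.Re (c1 [tuple bvec R b; w] + extd psi y [tuple bvec R b; w])) =
         cst (complex.Re (c1 [tuple bvec R b; w])) + (fun y => complex.Re (extd psi y [tuple bvec R b; w])).
        by apply/funext => y; rewrite raddfD.
      by apply: differentiableD; [exact: differentiable_cst|exact: (cdp _ x).1].
    have -> : (fun y => complex.Im (c1 [tuple bvec R b; w] + extd psi y [tuple bvec R b; w])) =
       cst (complex.Im (c1 [tuple bvec R b; w])) + (fun y => complex.Im (extd psi y [tuple bvec R b; w])).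
      by apply/funext => y; rewrite raddfD.
    by apply: differentiableD; [exact: differentiable_cst|exact: (cdp _ x).2].
  have cd1 : cdiff (fun=> c1 [tuple bvec R b; w]) x by split; exact: differentiable_cst.
  rewrite (cderivD _ cd1 (cdp _ x)).
  by rewrite cderiv_cst add0r mulrA divff // mul1r.
near=> y; have cy : chart i y by near: y.
have := pe i y cy [tuple bvec R b; w]; rewrite /chern1 -/kap => <-.
by rewrite mulrA mulVf // mul1r.
Unshelve. all: by end_near. Qed.

(** As the first Chern form is constant, its square has no exact correction, and
    the form of beta differs from beta by the exact term of the second Chern form
    alone. *)
Lemma traceless_beta (be : inv_form R 4) : is_beta E be ->
  exists psi : V8 R -> inv_form R 3,
    [/\ forall v, smooth_on setT (fun x => psi x v),
        forall x l, Lam l -> forall v, psi (x + l) v = psi x v &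
        forall i x, chart i x -> forall v,
          ((8 * pi ^+ 2)^-1)%:C * (\sum_a \sum_b
             wedge_form (mentry (traceless (curvature (A i) x)) a b)
                        (mentry (traceless (curvature (A i) x)) b a) v)
          = be v + extd psi x v].
Proof.
case=> c1 [c2 [hc1 hc2 beE]]; have hA : unitary_connection A by case: hAE.
have [_ [psi [_ ps pp pe]]] := hc2 A hA; exists psi; split=> // i x cx v.
rewrite -(chern_beta (curvature (A i) x) v r0) (pe i x cx) beE.
have -> : chern1 (curvature (A i) x) = c1.
  by apply/funext => u; exact: (chern1_constant hc1 cx).
by rewrite addrAC.
Qed.

End ChernForms.
End Exact.

(** * The rotated Kaehler structure *)

Section Rotation.
Variables (R : realType) (g : V8 R -> V8 R -> R) (J K : {linear V8 R -> V8 R}).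
Hypotheses (hg : scalar_product g) (JJ : forall x, J (J x) = - x).
Hypothesis gJJ : forall x y, g (J x) (J y) = g x y.

Lemma sp_ext x y : (forall z, g x z = g y z) -> x = y.
Proof.
move=> h; apply/eqP; rewrite -subr_eq0 -(sp_eq0 hg).
by rewrite (spDl hg) (spNl hg) h subrr.
Qed.

Variable t : R.
Hypothesis KJ : forall x, K (J x) = - J (K x).
Hypothesis Kskew : forall x y, g (K x) y = - g x (K y).
Hypothesis gKK : forall x y, g (K x) (K y) = t ^+ 2 * g x y.

Lemma K_sqr x : K (K x) = - (t ^+ 2 *: x).
Proof. by apply: sp_ext => z; rewrite Kskew gKK (spNl hg) (spZl hg). Qed.

Let s := Num.sqrt (1 + t ^+ 2).

Lemma s_sqr : s ^+ 2 = 1 + t ^+ 2.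
Proof. by rewrite sqr_sqrtr // addr_ge0 // sqr_ge0. Qed.

Lemma s_gt0 : 0 < s.
Proof. by rewrite sqrtr_gt0 ltr_wpDr ?sqr_ge0. Qed.

Variables (om ga : inv_form R 2).
Hypothesis fom : is_form om.
Hypothesis fga : is_form ga.
Hypothesis omE : forall x y, om [tuple x; y] = (g (J x) y)%:C.
Hypothesis gaE : forall x y, ga [tuple x; y] = (g (K x) y)%:C.

(** J and K anticommute, so JK is skew. *)
Lemma gJK x : g (J x) (K x) = 0.
Proof.
have : g (J x) (K x) = - g (J x) (K x).
  by rewrite {1}(J_skew hg JJ gJJ) (sp_sym hg (J x)) Kskew KJ (spNr hg) opprK.
lra.
Qed.

Lemma fnorm_rotated : fnorm g (fun w => om w + ga w) = 2 * s.
Proof.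
have [e he] := exists_orthonormal hg JJ gJJ.
have bo := is_form_bilinear fom; have bg := is_form_bilinear fga.
have bs : bilinear2 (fun w => om w + ga w).
  move=> z r x y; have [-> ->] := bo z r x y; have [-> ->] := bg z r x y.
  by split; ring.
apply/eqP; rewrite -(@eqrXn2 _ 2) ?sqrtr_ge0 ?mulr_ge0 ?(ltW s_gt0) //; apply/eqP.
rewrite (fnorm2_frame hg he bs) exprMn s_sqr.
under eq_bigr => p _.
  under eq_bigr => q _ do rewrite omE gaE -rmorphD sqnormR -(spDl hg) expr2.
  rewrite -(parseval hg he) (spDl hg) !(spDr hg) gJJ gKK gJK (sp_sym hg (K _)) gJK he eqxx.
  over.
by rewrite sumr_const card_ord /= mulr1; field.
Qed.

Let om' := rotated_form g om ga.

Lemma rotated_formE v : om' v = (s^-1)%:C * (om v + ga v).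
Proof.
rewrite /om' /rotated_form fnorm_rotated; congr (_%:C * _).
by rewrite invfM mulrA divff ?mul1r ?pnatr_eq0.
Qed.

Lemma exists_rotated_structure : exists J' : {linear V8 R -> V8 R},
  forall x, J' x = s^-1 *: (J x + K x).
Proof.
have [e he] := exists_orthonormal hg JJ gJJ.
have [|J' hJ'] := riesz2 hg he (a := om').
  move=> z r x y; rewrite !rotated_formE.
  have [-> ->] := is_form_bilinear fom z r x y; have [-> ->] := is_form_bilinear fga z r x y.
  by split; ring.
exists J' => x; apply: sp_ext => y; rewrite -hJ' rotated_formE omE gaE.
by rewrite (spZl hg) (spDl hg) -rmorphD -rmorphM.
Qed.

Lemma flat_kahler_rotated (J' : {linear V8 R -> V8 R}) :
  (forall x, J' x = s^-1 *: (J x + K x)) -> flat_kahler g J' om'.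
Proof.
move=> J'E; have s0 : s != 0 by exact: lt0r_neq0 s_gt0.
have gJ' x y : g (J' x) (J' y) = g x y.
  rewrite !J'E (spZl hg) (spZr hg) (spDl hg) !(spDr hg) gJJ gKK.
  have -> : g (J x) (K y) = - g (K x) (J y).
    by rewrite (J_skew hg JJ gJJ) Kskew KJ (spNr hg) opprK.
  transitivity (s^-1 * s^-1 * (s ^+ 2 * g x y)); first by rewrite s_sqr; ring.
  by field.
have J'2 x : J' (J' x) = - x.
  have JZ r y : J (r *: y) = r *: J y by exact: linearZ.
  have JD y z : J (y + z) = J y + J z by exact: linearD.
  have KZ r y : K (r *: y) = r *: K y by exact: linearZ.
  have KD y z : K (y + z) = K y + K z by exact: linearD.
  rewrite !J'E JZ KZ JD KD JJ K_sqr KJ -scalerDr scalerA.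
  have -> : - x + J (K x) + (- J (K x) - t ^+ 2 *: x) = - (s ^+ 2) *: x.
    by rewrite addrA addrK s_sqr scaleNr scalerDl scale1r opprD.
  by rewrite scalerA mulrN -expr2 -exprMn mulVf // expr1n scaleN1r.
split=> //.
- apply: is_form2I => [z r x y|x].
    rewrite !rotated_formE.
    have [-> ->] := is_form_bilinear fom z r x y; have [-> ->] := is_form_bilinear fga z r x y.
    by split; ring.
  have alt a : is_form a -> a [tuple x; x] = 0 by move=> [_ h]; apply: (h _ ord0 ord_max).
  by rewrite rotated_formE !alt // addr0 mulr0.
move=> x y; rewrite rotated_formE omE gaE -rmorphD -(spDl hg) -rmorphM -(spZl hg) -J'E.
by rewrite gJ'.
Qed.

(** The cross terms a(Jx, Ky) + a(Kx, Jy) cancel because J and K are a-skew and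
    anticommute. *)
Lemma invariant_rotated (J' : {linear V8 R -> V8 R}) (a : inv_form R 2) : 0 < t ->
  (forall x, J' x = s^-1 *: (J x + K x)) -> bilinear2 a ->
  (forall x y, a [tuple J x; J y] = a [tuple x; y]) ->
  (forall x y, a [tuple K x; K y] = (t ^+ 2)%:C * a [tuple x; y]) ->
  @of_type R J' 1 1 a.
Proof.
move=> tpos J'E ba aJ aK; have s0 : s != 0 by exact: lt0r_neq0 s_gt0.
have t20 : (t ^+ 2)%:C != 0 :> R[i].
  by rewrite (fmorph_eq0 (real_complex R)) sqrf_eq0 gt_eqF.
have aJl x y : a [tuple J x; y] = - a [tuple x; J y].
  by rewrite -(aJ x (J y)) JJ (bilinear2Nr _ _ ba) opprK.
have aKl x y : a [tuple K x; y] = - a [tuple x; K y].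
  apply: (mulfI t20); rewrite mulrN -(aK x (K y)) K_sqr.
  by rewrite (bilinear2Nr _ _ ba) (bilinear2Zr _ _ _ ba) opprK.
have aJ' x y : a [tuple J' x; J' y] = a [tuple x; y].
  rewrite !J'E (bilinear2Zl _ _ _ ba) (bilinear2Zr _ _ _ ba) (bilinear2Dl _ _ _ ba) !(bilinear2Dr _ _ _ ba) aJ aK.
  have -> : a [tuple J x; K y] = - a [tuple K x; J y].
    by rewrite aJl aKl KJ (bilinear2Nr _ _ ba) opprK.
  transitivity ((s^-1)%:C * (s^-1)%:C * ((1 + t ^+ 2)%:C * a [tuple x; y])).
    by rewrite rmorphD rmorph1; ring.
  by rewrite -s_sqr mulrA -!rmorphM /= -expr2 -exprMn mulVf // expr1n mul1r.
apply/of_type11P => x y; split; first exact: aJ'.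
have J'2 : J' (J' y) = - y by have [_ ->] := flat_kahler_rotated J'E.
by rewrite -[in RHS](aJ' x (J' y)) J'2 (bilinear2Nr _ _ ba) opprK.
Qed.

End Rotation.

Section Type20.
Variables (R : realType) (J : V8 R -> V8 R).

Lemma type20_im (c : inv_form R 2) : @of_type R J 2 0 c ->
  forall x y, complex.Im (c [tuple x; y]) = - complex.Re (c [tuple J x; y]).
Proof.
move=> tc x y; rewrite (of_type20P tc x y).1.
by case: (c _) => a b /=; ring.
Qed.

(** A (2,0)-form is determined by its real part. *)
Lemma type20_inj (c c' : inv_form R 2) : @of_type R J 2 0 c -> @of_type R J 2 0 c' ->
  (forall v, (c v + conj_form c v) / 2%:R = (c' v + conj_form c' v) / 2%:R) -> c = c'.
Proof.
move=> tc tc' h; have hre v : complex.Re (c v) = complex.Re (c' v).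
  have := congr1 (@complex.Re R) (h v); rewrite /conj_form.
  have half (z : R[i]) : complex.Re ((z + conjc z) / 2%:R) = complex.Re z.
    have -> : 2%:R^-1 = (2^-1)%:C :> R[i] by rewrite fmorphV rmorph_nat.
    by case: z => a b /=; field.
  by rewrite !half.
apply/funext => v; rewrite [v]tuple2_eta; apply/eqP; rewrite eq_complex; apply/andP; split; apply/eqP.
  exact: hre.
by rewrite !type20_im // hre.
Qed.

End Type20.

(** * The curvature commutes with K *)

Section Commuting.
Variables (R : realType) (B : 'M[R]_8).
Hypothesis uB : B \in unitmx.
Local Notation Lam := [set x | exists z : 'rV[int]_8, x = map_mx intr z *m B].
Variables (g : V8 R -> V8 R -> R) (J K : {linear V8 R -> V8 R}).
Hypotheses (hg : scalar_product g) (JJ : forall x, J (J x) = - x).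
Hypothesis gJJ : forall x y, g (J x) (J y) = g x y.
Variables (e : 'I_8 -> V8 R) (he : orthonormal_frame g e).
Hypothesis hq : forall p q, [/\ g (J (e p)) (e q) = (qent 1 p q)%:~R,
  g (K (e p)) (e q) = (qent 2 p q)%:~R & g (J (K (e p))) (e q) = (qent 3 p q)%:~R].

Let om := gform g J.

Variables (t : R) (c : inv_form R 2).
Hypothesis t0 : t != 0.
Hypothesis cE : forall v, c v = t%:C * gform g K v + ('i%C * t%:C) * gform g (J \o K) v.

Variables (r : nat) (E : hbundle Lam r) (A : conn_data E) (be : inv_form R 4).
Hypotheses (r0 : (0 < r)%N) (hAE : in_AE g A) (hbe : is_beta E be).
Hypothesis hym : traceless_HYM_conn J om A.
Let v0 : 8.-tuple (V8 R) := mktuple e.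
Hypothesis hint : wedge_form be (wedge_form c (conj_form c)) v0 =
  (2 * t ^+ 2)%:C * wedge_form be (wedge_form om om) v0.

Local Notation Fo i x := (mentry (traceless (curvature (A i) x))).

Let Q i x a b : R := t ^+ 2 / 2 *
  (mxsqnorm (form_mx e (Fo i x a b) - qmx R 2 *m form_mx e (Fo i x a b) *m (qmx R 2)^T) +
   mxsqnorm (form_mx e (Fo i x a b) - qmx R 3 *m form_mx e (Fo i x a b) *m (qmx R 3)^T)).

Let Q_ge0 i x a b : 0 <= Q i x a b.
Proof.
apply: mulr_ge0; first by rewrite divr_ge0 ?sqr_ge0.
by apply: addr_ge0; exact: mxsqnorm_ge0.
Qed.

Let hA : unitary_connection A. Proof. by case: hAE. Qed.

Let QE i x a b : chart i x ->
  wedge4 (Fo i x a b) (conj_form (Fo i x a b)) c (conj_form c) v0 -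
    (2 * t ^+ 2)%:C * wedge4 (Fo i x a b) (conj_form (Fo i x a b)) om om v0 = (Q i x a b)%:C.
Proof.
move=> cx; have [h11 hprim] := hym cx a b.
have aJ u v : Fo i x a b [tuple J u; J v] = Fo i x a b [tuple u; v].
  by have /of_type11P /(_ u v) [] := h11.
exact: (wedge4_positive hg JJ gJJ he hq (traceless_bilinear hA cx a b)
  (traceless_skew A i x a b) aJ hprim cE).
Qed.

Let C0 : R := (8 * pi ^+ 2)^-1.
Let C0_gt0 : 0 < C0.
Proof. by rewrite invr_gt0 mulr_gt0 // exprn_gt0 ?pi_gt0. Qed.

(** The product of the form of beta with c /\ conj c - 2 t^2 om^2 is computed in
    two ways: from the curvature it is minus a sum of squares, and from the
    class of beta, by the hypothesis on beta, it is exact. *)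
Lemma wedge_exact_defect (psi : V8 R -> inv_form R 3) i x : chart i x ->
  (forall v, C0%:C * (\sum_a \sum_b wedge_form (Fo i x a b) (Fo i x b a) v) = be v + extd psi x v) ->
  wedge_form (extd psi x) (wedge_form c (conj_form c)) v0 -
   (2 * t ^+ 2)%:C * wedge_form (extd psi x) (wedge_form om om) v0 =
  - (C0 * \sum_a \sum_b Q i x a b)%:C.
Proof.
move=> cx bE.
have wE (x1 x2 : inv_form R 2) : wedge_form (extd psi x) (wedge_form x1 x2) v0 =
   - (C0%:C * \sum_a \sum_b wedge4 (Fo i x a b) (conj_form (Fo i x a b)) x1 x2 v0)
   - wedge_form be (wedge_form x1 x2) v0.
  pose S : inv_form R 4 := fun v => \sum_a \sum_b wedge_form (Fo i x a b) (Fo i x b a) v.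
  have exE : extd psi x = fun v => C0%:C * S v + (-1 * be v + 0).
    by apply/funext => v; rewrite /S bE; ring.
  have -> : wedge_form (extd psi x) (wedge_form x1 x2) v0 =
     C0%:C * wedge_form S (wedge_form x1 x2) v0 - wedge_form be (wedge_form x1 x2) v0.
    rewrite exE (wedge_linl C0%:C S (fun v => -1 * be v + 0)) (wedge_linl (-1) be (fun=> 0)).
    have -> : @wedge_form R 4 4 (fun=> 0) (wedge_form x1 x2) v0 = 0.
      by rewrite /wedge_form big1 ?mulr0 // => s _; rewrite mulr0 mul0r.
    by rewrite addr0 mulN1r.
  congr (_ - _); rewrite -mulrN; congr (_ * _).
  rewrite /S (wedge_suml _ (fun a => fun v => \sum_b wedge_form (Fo i x a b) (Fo i x b a) v)) -sumrN.
  apply: eq_bigr => a _; rewrite (wedge_suml _ (fun b => wedge_form (Fo i x a b) (Fo i x b a))) -sumrN.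
  apply: eq_bigr => b _; rewrite wedge_form_wedge4.
  have -> : Fo i x b a = fun v => -1 * conj_form (Fo i x a b) v.
    by apply/funext => v; rewrite mulN1r (traceless_antihermitian hA cx).
  by rewrite wedge4Z2 mulN1r.
rewrite !wE hint.
transitivity (- (C0%:C * \sum_a \sum_b (Q i x a b)%:C)); last first.
  rewrite rmorphM rmorph_sum; congr (- (_ * _)); apply: eq_bigr => a _.
  by rewrite rmorph_sum.
have -> : \sum_a \sum_b (Q i x a b)%:C =
  \sum_a \sum_b wedge4 (Fo i x a b) (conj_form (Fo i x a b)) c (conj_form c) v0 -
  (2 * t ^+ 2)%:C * \sum_a \sum_b wedge4 (Fo i x a b) (conj_form (Fo i x a b)) om om v0.
  rewrite mulr_sumr -sumrB; apply: eq_bigr => a _; rewrite mulr_sumr -sumrB.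
  by apply: eq_bigr => b _; rewrite QE.
move: (C0%:C) ((2 * t ^+ 2)%:C) (\sum_a _) (\sum_a _) (wedge_form be _ v0) => y1 y2 y3 y4 y5.
ring.
Qed.

(** A nonnegative function of mean value zero vanishes; so all the squares vanish. *)
Lemma curvature_commutes i x : chart i x -> forall a b u v,
  Fo i x a b [tuple K u; K v] = Fo i x a b [tuple u; v].
Proof.
move=> cx a b u v.
have [psi [ps pp pE]] := traceless_beta uB hg he r0 hAE hbe.
pose f y := complex.Re (-1 * wedge_form (extd psi y) (wedge_form c (conj_form c)) v0) +
  complex.Re ((2 * t ^+ 2)%:C * wedge_form (extd psi y) (wedge_form om om) v0).
have fE j y : chart j y -> f y = C0 * \sum_a \sum_b Q j y a b.
  move=> cy; rewrite /f -raddfD mulN1r.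
  by have := wedge_exact_defect cy (pE j y cy); move/(congr1 -%R); rewrite opprB opprK addrC => ->.
have mf : mean_zero B f by apply: mean_zeroD; exact: mean_zero_wedge_exact.
have f0 y : 0 <= f y.
  have [j cy] := chart_cover E y; rewrite (fE j y cy) mulr_ge0 ?(ltW C0_gt0) //.
  by do 2!(apply: sumr_ge0 => ? _); exact: Q_ge0.
have := mean_zero_ge0 mf f0 x; rewrite (fE i x cx) => /eqP.
rewrite mulf_eq0 (gt_eqF C0_gt0) /= psumr_eq0; last first.
  by move=> a' _; apply: sumr_ge0 => b' _; exact: Q_ge0.
move=> /allP /(_ a (mem_index_enum _)) /=; rewrite psumr_eq0; last first.
  by move=> b' _; exact: Q_ge0.
move=> /allP /(_ b (mem_index_enum _)) /= /eqP Q0.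
have [h11 hprim] := hym cx a b.
have aJ u' v' : Fo i x a b [tuple J u'; J v'] = Fo i x a b [tuple u'; v'].
  by have /of_type11P /(_ u' v') [] := h11.
apply: (commutes_of_zero hg JJ gJJ he hq (traceless_bilinear hA cx a b)
  (traceless_skew A i x a b) aJ hprim t0 cE).
by rewrite QE // Q0.
Qed.

End Commuting.

Theorem theorem14 (R : realType) (Lam : set (V8 R)) (hLam : is_lattice Lam)
    (g : V8 R -> V8 R -> R) (J : {linear V8 R -> V8 R})
    (om : inv_form R 2) (th : inv_form R 4) (hSU4 : flat_SU4 g J om th)
    (ga : inv_form R 2) (hga : A_plus g J th ga)
    (c : inv_form R 2) (hc : is_form c) (hc20 : @of_type R J 2 0 c)
    (hgac : forall v, ga v = (c v + conj_form c v) / 2%:R)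
    (be : inv_form R 4) (hbe : integral_class Lam be)
    (h1 : traceless_HYM Lam g J om be)
    (k : R)
    (hk : forall v, wedge_form be (wedge_form om om) v = (24%:R * k)%:C * vol_form om v)
    (h2 : forall v, wedge_form be (wedge_form c (conj_form c)) v
                    = (6%:R * k * fnorm g c ^+ 2)%:C * vol_form om v) :
  exists J' : {linear V8 R -> V8 R},
    flat_kahler g J' (rotated_form g om ga) /\
    traceless_HYM Lam g J' (rotated_form g om ga) be.
Proof.
have [hK fth _ nth4] := hSU4; have [hg JJ gJJ fom gom] := hK.
have sJ := J_skew hg JJ gJJ.
have [e0 he0] := exists_orthonormal hg JJ gJJ.
have bc := is_form_bilinear hc.
have cJ := of_type20P hc20.
have ccth v : wedge_form c c v = (fnorm g c ^+ 2 / 4)%:C * th v.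
  (* A (2,0)-form is determined by its real part: c is the witness of gamma in A_+. *)
  have [c' [fc' tc' ccth' gac']] := hga.
  have -> // : c = c' by apply: (type20_inj hc20 tc') => w; rewrite -hgac -gac'.
have [K KE] := riesz2 hg he0 bc.
pose n := fnorm g c ^+ 2.
have gKn x y : g (K x) (K y) = n / 8 * g x y.
  exact: (conformal hg JJ gJJ hc fth nth4 cJ ccth KE).
have n0 : 0 <= n by exact: sqr_ge0.
pose t := Num.sqrt (n / 8).
have t2 : t ^+ 2 = n / 8 by rewrite sqr_sqrtr // divr_ge0.
have t0 : 0 <= t by exact: sqrtr_ge0.
have gKK x y : g (K x) (K y) = t ^+ 2 * g x y by rewrite gKn t2.
have Ksk x y : g (K x) y = - g x (K y).
  by rewrite -KE (is_form_skew hc) raddfN /= KE (sp_sym hg).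
have KJ x : K (J x) = - J (K x).
  apply: (sp_ext hg) => y; rewrite -KE (cJ x y).1 -(cJ x y).2 KE.
  by rewrite (spNl hg) sJ opprK.
have gaE x y : ga [tuple x; y] = (g (K x) y)%:C.
  rewrite hgac -KE /conj_form; have -> : 2%:R^-1 = (2^-1)%:C :> R[i] by rewrite fmorphV rmorph_nat.
  by case: (c _) => a b; apply/eqP; rewrite eq_complex /=; apply/andP; split; apply/eqP; field.
have fga : is_form ga.
  apply: is_form2I => [z s x y|x].
    rewrite !gaE linearP /= (spDl hg) (spZl hg) (spDr hg) (spZr hg) !rmorphD !rmorphM /=.
    by split.
  by rewrite gaE; have := Ksk x x; rewrite (sp_sym hg x) => h; have -> : g (K x) x = 0 by lra.
have omE x y : om [tuple x; y] = (g (J x) y)%:C.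
  by rewrite -[y in LHS]opprK -JJ -gom linearN (spNr hg) sJ.
have rotE := rotated_formE hg JJ gJJ KJ Ksk gKK fom fga omE gaE.
(* For c = 0 the rotated structure is the given one. *)
have [t_eq0|tn0] := eqVneq t 0.
  have gaz v : ga v = 0.
    rewrite [v]tuple2_eta gaE; have -> : K (tnth v ord0) = 0.
      by apply/eqP; rewrite -(sp_eq0 hg) gKK t_eq0 expr0n mul0r.
    by rewrite (sp0l hg).
  have -> : rotated_form g om ga = om; last by exists J.
  apply/funext => v; rewrite rotE gaz addr0 t_eq0 expr0n addr0 sqrtr1 invr1.
  by rewrite rmorph1 mul1r.
have tpos : 0 < t by rewrite lt_neqAle eq_sym tn0.
(* K1 = K / t is an orthogonal complex structure that anticommutes with J. *)
have [K1 K1E'] : exists K1 : {linear V8 R -> V8 R}, forall x, K1 x = t^-1 *: K x.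
  have [|K1 K1E] := riesz2 hg he0 (a := fun v => (t^-1)%:C * c v).
    by move=> z s x y; have [-> ->] := bc z s x y; split; ring.
  exists K1 => x; apply: (sp_ext hg) => y; rewrite -K1E (spZl hg) -KE.
  by case: (c _) => a b /=; rewrite mul0r subr0.
have KK1 x : K x = t *: K1 x by rewrite K1E' scalerA divff // scale1r.
have K1K1 x : K1 (K1 x) = - x.
  rewrite !K1E' linearZ /= (K_sqr hg Ksk gKK) scalerN scalerN !scalerA.
  by rewrite (_ : _ * _ = 1) ?scale1r //; field.
have gK1 x y : g (K1 x) (K1 y) = g x y.
  by rewrite !K1E' (spZl hg) (spZr hg) gKK; field.
have K1J x : K1 (J x) = - J (K1 x).
  have JZ : J (t^-1 *: K x) = t^-1 *: J (K x) by exact: linearZ.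
  by rewrite !K1E' KJ scalerN JZ.
have [e [he hq]] := exists_quaternionic_frame hg JJ K1K1 gJJ gK1 K1J.
have cE v : c v = t%:C * gform g K1 v + ('i%C * t%:C) * gform g (J \o K1) v.
  rewrite [v]tuple2_eta; move: (tnth v _) (tnth v _) => y x.
  rewrite !gformE /=.
  have re : complex.Re (c [tuple x; y]) = t * g (K1 x) y by rewrite KE KK1 (spZl hg).
  have im : complex.Im (c [tuple x; y]) = t * g (J (K1 x)) y.
    by rewrite (type20_im hc20) KE KJ KK1 linearZ /= (spNl hg) opprK (spZl hg).
  apply/eqP; rewrite eq_complex re im /=; apply/andP; split; apply/eqP; ring.
have omg : om = gform g J.
  by apply/funext => v; rewrite [v]tuple2_eta omE gformE.
have [B [uB LamE]] := hLam.
have [J' J'E] := exists_rotated_structure hg JJ gJJ KJ Ksk gKK fom fga omE gaE.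
exists J'; split; first exact: (flat_kahler_rotated hg JJ gJJ KJ Ksk gKK fom fga omE gaE J'E).
move: h1; rewrite /traceless_HYM LamE => -[r [E [A [r0 hb hAE hym]]]].
exists r, E, A; split=> // i x cx a b.
have hA : unitary_connection A by case: hAE.
have [h11 hprim] := hym i x cx a b.
have ba := traceless_bilinear hA cx a b.
have sa := traceless_skew A i x a b.
have aJ u v : mentry (traceless (curvature (A i) x)) a b [tuple J u; J v] =
    mentry (traceless (curvature (A i) x)) a b [tuple u; v].
  by have /of_type11P /(_ u v) [] := h11.
(* 6 k |c|^2 = 2 t^2 24 k, as |c|^2 = 8 t^2. *)
have hint : wedge_form be (wedge_form c (conj_form c)) (mktuple e) =
   (2 * t ^+ 2)%:C * wedge_form be (wedge_form (gform g J) (gform g J)) (mktuple e).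
  rewrite -omg h2 hk [RHS]mulrA -rmorphM; congr (_%:C * _).
  by rewrite t2 -/n; field.
have aK1 u v : mentry (traceless (curvature (A i) x)) a b [tuple K1 u; K1 v] =
    mentry (traceless (curvature (A i) x)) a b [tuple u; v].
  by apply: (curvature_commutes uB hg JJ gJJ he hq tn0 cE r0 hAE hb _ hint cx); rewrite -omg.
split.
  apply: (invariant_rotated hg JJ gJJ KJ Ksk gKK fom fga omE gaE tpos J'E ba aJ) => u v.
  rewrite !KK1 (bilinear2Zl _ _ _ ba) (bilinear2Zr _ _ _ ba) aK1 mulrA -rmorphM.
  by rewrite expr2.
rewrite omg in hprim.
apply: (primitive_rotated hg JJ K1K1 gJJ gK1 he hq ba aJ hprim (s := (Num.sqrt (1 + t ^+ 2))^-1) (t := t)).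
move=> v; rewrite rotE omg; congr (_ * (_ + _)).
rewrite [v]tuple2_eta gaE gformE KK1 (spZl hg) rmorphM //.
Qed.
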